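(* Let $X$ be a reflexive Banach space with an unconditional asymptotic structure, and let $G$ be any non-trivial countably branching bundle graph. Then the following properties are equivalent. (1) $S_Z(X^* )\le\omega$. (2) $X$ admits an equivalent AUC norm. (3) The family $(G^{\oslash n})_{n\ge1}$ does not equi-Lipschitz embed into $X$.
   Context: Szlenk index of a Banach space $E$. For a weak$^*$-compact $K\subset E^*$ and $\varepsilon>0$, let $s_\varepsilon(K)$ be $K$ minus the union of all (relatively) weak$^*$-open subsets $V$ of $K$ with $\operatorname{diam}V\le\varepsilon$. Put $s^1_\varepsilon(K)=s_\varepsilon(K)$, $s^{\alpha+1}_\varepsilon(K)=s_\varepsilon(s^\alpha_\varepsilon(K))$, and $s^\alpha_\varepsilon(K)=\bigcap_{\beta<\alpha}s^\beta_\varepsilon(K)$ for limit $\alpha$. Let $S_Z(K,\varepsilon)$ be the least $\alpha$ with $s^\alpha_\varepsilon(K)=\emptyset$ if it exists and $\infty$ otherwise, and $S_Z(E)=\sup_{\varepsilon>0}S_Z(B_{E^*},\varepsilon)$, $B_{E^*}$ being the closed unit ball of $E^*$. $\omega$ is the first infinite ordinal. Let $\mathrm{cof}(X)$ be the set of closed subspaces of $X$ of finite codimension; $S_Y$ denotes the unit sphere of $Y$; $\inf\emptyset=+\infty$. $X$ has an unconditional asymptotic structure if there is $C\ge1$ such that for every $n\ge1$: $\exists X_1\in\mathrm{cof}(X)\ \forall x_1\in S_{X_1}\ \cdots\ \exists X_n\in\mathrm{cof}(X)\ \forall x_n\in S_{X_n}$: $(x_i)_{i=1}^n$ is $C$-unconditional,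 i.e. $\|\sum\epsilon_ia_ix_i\|\le C\|\sum a_ix_i\|$ for all scalars $a_i$ and signs $\epsilon_i$. A norm on $X$ is AUC if for all $t>0$, $\inf_{x\in S_X}\sup_{Y\in\mathrm{cof}(X)}\inf_{y\in S_Y}(\|x+ty\|-1)>0$. Bundle graphs. A top-bottom graph is a (simple) graph with two distinguished vertices, one designated as the top and the other as the bottom. A countably branching bundle graph is a top-bottom graph that can be formed, starting from a path of length $1$, by a finite sequence of the following operations: (i) given two countably branching bundle graphs, identify the top of one with the bottom of the other, the bottom of the first being the new bottom and the top of the second the new top; (ii) take countably infinitely many copies of a countably branching bundle graph and identify all the bottoms with each other and all the tops with each other. It is non-trivial if it is obtained by such a sequence with at least one operation (ii) (applied to a graph other than a single edge). Bundle graphs carry the graph distance. Edges are oriented from bottom to top; $G\oslash H$ is obtained by replacing every edge of $G$ by a copy of $H$ (bottom and top of $H$ placed at the lower and upper endpoint of the edge), and $G^{\oslash1}=G$, $G^{\oslash(n+1)}=G\oslash G^{\oslash n}$. A family $(M_n,d_n)$ equi-Lipschitz embeds into $X$ if there are $D\ge1$, maps $f_n:M_n\to X$ and $s_n>0$ with $s_nd_n(x,y)\le\|f_n(x)-f_n(y)\|\le s_nD\,d_n(x,y)$ for all $n$ and $x,y\in M_n$. *)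

(* Defs.v *)
From HB Require Import structures.
From mathcomp Require Import all_boot all_order all_algebra.
From mathcomp Require Import all_classical all_reals all_analysis.

Set Implicit Arguments.
Unset Strict Implicit.
Unset Printing Implicit Defensive.

Import Order.TTheory GRing.Theory Num.Theory.
Import numFieldNormedType.Exports.

Local Open Scope classical_set_scope.
Local Open Scope ring_scope.

Section Dual.
Context {R : realType} {E : normedModType R}.

Definition is_functional : {pred E -> R^o} :=
  [pred f : E -> R^o | `[< linear f /\ continuous f >]].

Lemma functional_submod_closed : submod_closed is_functional.
Proof.
split; first by apply/asboolP; split => [a x y|x]; [rewrite /= scaler0 addr0|exact: cvg_cst].
move=> a f g /asboolP[lf cf] /asboolP[lg cg]; apply/asboolP; split => [b x y|x].
  rewrite !fctE /= (lf b x y) (lg b x y) !scalerDr !scalerA (mulrC a b) -!addrA.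
  by congr (_ + _); rewrite addrCA.
by apply: cvgD; [apply: cvgZr; exact: cf|exact: cg].
Qed.

HB.instance Definition _ := GRing.isSubmodClosed.Build R (E -> R^o)
  is_functional functional_submod_closed.

End Dual.

Record dual (R : realType) (E : normedModType R) := Dual {
  dual_fun :> E -> R^o ;
  _ : dual_fun \in is_functional }.

Section DualNorm.
Context {R : realType} {E : normedModType R}.

HB.instance Definition _ := [isSub for @dual_fun R E].
HB.instance Definition _ := gen_eqMixin (dual E).
HB.instance Definition _ := gen_choiceMixin (dual E).
HB.instance Definition _ := [SubChoice_isSubLmodule of dual E by <:].

Definition dual_norm (f : dual E) : R := sup [set `|f x| | x in [set x | `|x| <= 1]].

Lemma dual_linear (f : dual E) : linear f.
Proof. by case: f => f /= /asboolP[]. Qed.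

Lemma dual_continuous (f : dual E) : continuous f.
Proof. by case: f => f /= /asboolP[]. Qed.

Lemma dual_funZ (f : dual E) a x : f (a *: x) = a * f x.
Proof.
have f0 : f 0 = 0 by have := dual_linear f (-1) 0 0; rewrite scaleN1r addNr scaleN1r addNr.
by have := dual_linear f a x 0; rewrite addr0 f0 addr0.
Qed.

Lemma dual_has_sup (f : dual E) : has_sup [set `|f x| | x in [set x | `|x| <= 1]].
Proof.
split; first by exists `|f 0|, 0 => //=; rewrite normr0.
pose g := GRing.isLinear.Build R E R^o _ f (dual_linear f).
pose h : {linear E -> R^o} := HB.pack (f : E -> R^o) g.
have /linear_bounded_continuous/bounded_funP/(_ 1)[M hM] : continuous h
  by exact: dual_continuous.
by exists M => _ [x /= x1 <-]; exact: hM.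
Qed.

Lemma dual_norm_ub (f : dual E) x : `|x| <= 1 -> `|f x| <= dual_norm f.
Proof. by move=> x1; apply: (ub_le_sup (dual_has_sup f).2); exists x. Qed.

Lemma dual_norm_lub (f : dual E) M :
  (forall x, `|x| <= 1 -> `|f x| <= M) -> dual_norm f <= M.
Proof.
by move=> fM; apply: ge_sup (dual_has_sup f).1 _ => _ [x /= x1 <-]; exact: fM.
Qed.

Lemma dual_normD (f g : dual E) : dual_norm (f + g) <= dual_norm f + dual_norm g.
Proof.
apply: dual_norm_lub => x x1; apply: le_trans (ler_normD _ _) _.
by rewrite lerD// dual_norm_ub.
Qed.

Lemma dual_normZ (a : R) (f : dual E) : dual_norm (a *: f) = `|a| * dual_norm f.
Proof.
have le b (h : dual E) : dual_norm (b *: h) <= `|b| * dual_norm h.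
  apply: dual_norm_lub => x x1; rewrite [X in `|X|](_ : _ = b * h x)// normrM.
  by rewrite ler_wpM2l// dual_norm_ub.
apply/eqP; rewrite eq_le le/=; have [->|a0] := eqVneq a 0.
  rewrite normr0 mul0r; apply: le_trans (normr_ge0 _) (dual_norm_ub _ (x := 0) _).
  by rewrite normr0.
rewrite -ler_pdivlMl ?normr_gt0// -normfV.
by rewrite -[in leLHS](scale1r f) -(mulVf a0) -scalerA.
Qed.

Lemma dual_norm0_eq0 (f : dual E) : dual_norm f = 0 -> f = 0.
Proof.
move=> f0; apply/val_inj/funext => x /=.
have [->|x0] := eqVneq x 0; first by rewrite -(scale0r 0) dual_funZ mul0r.
have : `|f (`|x|^-1 *: x)| <= 0.
  rewrite -f0 dual_norm_ub// normrZ normfV normr_id mulVf// normr_eq0//.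
by rewrite normr_le0 dual_funZ mulf_eq0 invr_eq0 normr_eq0 (negbTE x0)/= => /eqP.
Qed.

HB.instance Definition _ := Lmodule_isNormed.Build R (dual E)
  dual_normD dual_normZ dual_norm0_eq0.

End DualNorm.

Definition reflexive_space (R : realType) (X : normedModType R) : Prop :=
  forall phi : dual (dual X), exists x : X, forall f : dual X, phi f = f x.

Definition weak_star (R : realType) (E : normedModType R) : Type :=
  initial_topology (fun f : dual E => (f : {ptws E -> R^o})).
HB.instance Definition _ (R : realType) (E : normedModType R) :=
  Topological.copy (weak_star E)
    (initial_topology (fun f : dual E => (f : {ptws E -> R^o}))).

(** Ordinals are presented by well-founded trees, [Olim f] being the supremum of
    the family [f] (not necessarily a limit ordinal).  Two presentations [a], [b]
    denote the same ordinal when [ole a b] and [ole b a]. *)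
Inductive Ord : Type :=
| Ozero
| Osucc (a : Ord)
| Olim (I : Type) (f : I -> Ord).

HB.instance Definition _ := gen_eqMixin Ord.
HB.instance Definition _ := gen_choiceMixin Ord.

Fixpoint ole (a : Ord) : Ord -> Prop :=
  match a with
  | Ozero => fun=> True
  | Osucc a' => fix olt (b : Ord) : Prop := match b with
      | Ozero => False
      | Osucc b' => ole a' b'
      | Olim _ g => exists i, olt (g i)
      end
  | Olim _ f => fun b => forall i, ole (f i) b
  end.

Definition olt (a b : Ord) : Prop := ole (Osucc a) b.

Lemma ole_lim a I (f : I -> Ord) i : ole a (f i) -> ole a (Olim f).
Proof.
elim: a => [|a IH|J g IH] //= ag; first by exists i.
by move=> j; apply: IH; exact: ag.
Qed.

Lemma ole_refl a : ole a a.
Proof. by elim: a => //= I f IH i; apply: (@ole_lim _ _ _ i). Qed.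

Lemma ole_trans b a c : ole a b -> ole b c -> ole a c.
Proof.
elim: a b c => [//|a IHa|I f IHf] b c; last by move=> /= fb bc i; exact: IHf bc.
elim: b c => [//|b _|I g IHg] c; last by move=> /= [i agi] /(_ i); exact: IHg.
by move=> ab; elim: c => [//|c _|I g IHg] /=; [exact: IHa|case=> i /IHg; exists i].
Qed.

Lemma ole_succ a : ole a (Osucc a).
Proof.
elim: a => //= I f IH i; apply: ole_trans (IH i) _ => /=.
by apply: ole_lim (ole_refl _).
Qed.

Lemma oltW a b : olt a b -> ole a b.
Proof. exact: ole_trans (ole_succ a). Qed.

Lemma ole_total a b : ole a b \/ olt b a.
Proof.
elim: a b => [|a IHa|I f IHf] b; first by left.
- elim: b => [|b _|I g IHg]; first by right.
    exact: IHa.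
  have [?|nag] := pselect (exists i, olt a (g i)); [by left|right => i].
  by case: (IHg i) => // agi; case: nag; exists i.
- have [?|/existsNP[i nfb]] := pselect (forall i, ole (f i) b); first by left.
  by right; exists i; case: (IHf i b).
Qed.

Lemma olt_irr a : ~ olt a a.
Proof.
elim: a => [//|//|I f IH [i fi]]; apply: (IH i).
apply: (@ole_trans (Osucc (Olim f))) fi => /=.
by apply: ole_lim (ole_refl _).
Qed.

Definition limit_ord (a : Ord) : Prop :=
  olt Ozero a /\ forall b, olt b a -> olt (Osucc b) a.

Definition omega : Ord := Olim (fun n : nat => iter n Osucc Ozero).

(** [None] stands for the value infinity of the index. *)
Definition eole (a b : option Ord) : Prop :=
  match a, b with
  | _, None => True
  | None, Some _ => False
  | Some a, Some b => ole a b
  end.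

Section Szlenk.
Context {R : realType} (E : normedModType R).
Implicit Types (K V : set (dual E)) (eps : R).

Definition rel_open K V : Prop := exists2 U : set (weak_star E), open U & V = K `&` U.

Definition diam V : \bar R := ereal_sup [set `|p.1 - p.2|%:E | p in V `*` V].

Definition szlenk_step eps K : set (dual E) :=
  K `\` \bigcup_(V in [set V | rel_open K V /\ (diam V <= eps%:E)%E]) V.

(** In the last clause the intersection with [K] only matters for an empty
    family, whose supremum is [0]; see [szlenk_derivative_limit]. *)
Fixpoint szlenk_derivative eps K (a : Ord) : set (dual E) :=
  match a with
  | Ozero => K
  | Osucc b => szlenk_step eps (szlenk_derivative eps K b)
  | Olim _ f => K `&` \bigcap_i szlenk_derivative eps K (f i)
  end.

Lemma szlenk_step_mono eps K K' :
  K `<=` K' -> szlenk_step eps K `<=` szlenk_step eps K'.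
Proof.
move=> KK' f [Kf nf]; split; first exact: KK'.
move=> [V [[U oU VE] dV] Vf]; apply: nf; exists (K `&` V); last by split.
split; first by exists U => //; rewrite VE setIA (setIidl KK').
apply: le_trans dV; apply: ereal_sup_le => _ [p [[_ V1] [_ V2]] <-].
by exists p.
Qed.

Lemma szlenk_derivative_sub eps K a : szlenk_derivative eps K a `<=` K.
Proof. by elim: a => [|a IH|I f IH] g //= [] // /IH. Qed.

Lemma szlenk_derivative_anti eps K a b :
  ole a b -> szlenk_derivative eps K b `<=` szlenk_derivative eps K a.
Proof.
elim: a b => [|a IHa|I f IHf] b /=; first by move=> _; exact: szlenk_derivative_sub.
- elim: b => [//|b _|I f IHf]; first by move=> /IHa; exact: szlenk_step_mono.
  by move=> [i /IHf sub] g [_ /(_ i Logic.I)]; exact: sub.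
- move=> fb g bg; split; first exact: szlenk_derivative_sub bg.
  by move=> i _; apply: IHf bg; exact: fb.
Qed.

Lemma szlenk_derivative_limit eps K a : limit_ord a ->
  szlenk_derivative eps K a = \bigcap_(b in [set b | olt b a]) szlenk_derivative eps K b.
Proof.
move=> lima; apply/seteqP; split.
  by move=> f af b /= /oltW ba; exact: szlenk_derivative_anti af.
elim: a lima => [|a _|I f IHf] [a0 lima] g ga; first by [].
  by have /olt_irr := lima _ (ole_refl (Osucc a)).
split; first exact: (ga Ozero).
move=> i _; have fi : ole (f i) (Olim f) by apply: ole_lim (ole_refl _).
have [af|af] := ole_total (Olim f) (f i); last exact: ga.
apply: IHf => [|b /= bfi]; last by apply: ga; exact: ole_trans fi.
split => [|b bfi]; first exact: ole_trans af.
by apply: ole_trans af; apply: lima; exact: ole_trans fi.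
Qed.

Definition szlenk_index_at K eps : option Ord :=
  xget None [set Some a | a in [set a | szlenk_derivative eps K a = set0 /\
    forall b, szlenk_derivative eps K b = set0 -> ole a b]].

Definition dual_ball : set (dual E) := [set f | `|f| <= 1].

Definition szlenk_index : option Ord :=
  xget None [set a |
    (forall eps, 0 < eps -> eole (szlenk_index_at dual_ball eps) a) /\
    forall b, (forall eps, 0 < eps -> eole (szlenk_index_at dual_ball eps) b) ->
      eole a b].

End Szlenk.

Section Asymptotic.
Context {R : realType} (X : normedModType R).

Definition cof (Y : set X) : Prop :=
  [/\ closed Y,
      Y 0 /\ (forall (a : R) x y, Y x -> Y y -> Y (a *: x + y)) &
      exists n (v : 'I_n -> X), forall x, exists c : 'I_n -> R,
        Y (x - \sum_i c i *: v i)].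

Definition unconditional (C : R) (s : seq X) : Prop :=
  forall (a : 'I_(size s) -> R) (e : 'I_(size s) -> bool),
    `|\sum_i ((-1) ^+ e i * a i) *: s`_i| <= C * `|\sum_i a i *: s`_i|.

(** [exists Y1, forall y1 in the sphere of Y1, ..., exists Yn, forall yn in the
    sphere of Yn, P (s ++ [:: y1; ...; yn])]. *)
Fixpoint asymptotic_game (n : nat) (P : seq X -> Prop) (s : seq X) : Prop :=
  if n is n'.+1 then
    exists2 Y, cof Y &
      forall y, Y y -> `|y| = 1 -> asymptotic_game n' P (rcons s y)
  else P s.

Definition unconditional_asymptotic_structure : Prop :=
  exists2 C : R, 1 <= C &
    forall n, (1 <= n)%N -> asymptotic_game n (unconditional C) [::].

Definition is_norm (N : X -> R) : Prop :=
  [/\ forall x y, N (x + y) <= N x + N y,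
      forall (a : R) x, N (a *: x) = `|a| * N x &
      forall x, N x = 0 -> x = 0].

Definition equivalent_norm (N : X -> R) : Prop :=
  is_norm N /\ exists c C : R,
    [/\ 0 < c, 0 < C & forall x, c * `|x| <= N x <= C * `|x|].

(** For [N] equivalent to the norm of [X], [N] has the same closed subspaces of
    finite codimension as the norm of [X]. *)
Definition AUC (N : X -> R) : Prop :=
  forall t : R, 0 < t ->
    (0 < ereal_inf [set
           ereal_sup [set
             ereal_inf [set (N (x + t *: y)%R - 1)%:E | y in [set y | Y y /\ N y = 1%R]]
           | Y in cof]
         | x in [set x | N x = 1%R]])%E.

End Asymptotic.

Record tbgraph := TBGraph {
  vertex :> Type ;
  adj : vertex -> vertex -> Prop ;
  bot : vertex ;
  top : vertex ;
  adj_sym : forall x y, adj x y -> adj y x ;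
  adj_irr : forall x, ~ adj x x ;
  bot_neq_top : bot <> top }.

Arguments adj {t}.
Arguments bot {t}.
Arguments top {t}.

Fixpoint walk (G : tbgraph) (n : nat) (x y : G) : Prop :=
  if n is n'.+1 then exists2 z, adj x z & walk n' z y else x = y.

(** The length of a shortest walk, and [0] if there is none. *)
Definition gdist (G : tbgraph) (x y : G) : nat :=
  xget 0%N [set n | walk n x y /\ forall m, walk m x y -> (n <= m)%N].

Definition tbgraph_iso (G H : tbgraph) : Prop :=
  exists2 phi : G -> H, bijective phi &
    [/\ forall x y, adj (phi x) (phi y) <-> adj x y,
        phi bot = bot & phi top = top].

Lemma path1_neq_sym (x y : bool) : x <> y -> y <> x.
Proof. by move=> /nesym. Qed.

Lemma path1_irr (x : bool) : ~ x <> x.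
Proof. by apply. Qed.

Lemma path1_bot_top : false <> true.
Proof. by []. Qed.

Definition path1 : tbgraph := TBGraph path1_neq_sym path1_irr path1_bot_top.

(** Adjacency in a union of images of a graph. *)
Definition image_adj (I : Type) (G : tbgraph) (T : Type) (copy : I -> G -> T)
    (x y : T) : Prop :=
  exists i u v, [/\ adj u v, copy i u = x & copy i v = y].

Lemma image_adj_sym I (G : tbgraph) T (copy : I -> G -> T) x y :
  image_adj copy x y -> image_adj copy y x.
Proof. by move=> [i [u [v [/adj_sym uv <- <-]]]]; exists i, v, u. Qed.

Lemma image_adj_irr I (G : tbgraph) T (copy : I -> G -> T) x :
  (forall i, injective (copy i)) -> ~ image_adj copy x x.
Proof. by move=> inj [i [u [v [uv <- /inj e]]]]; move: uv; rewrite e; exact: adj_irr. Qed.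

Section Series.
Variables G H : tbgraph.

(** The bottom of [H] is dropped and played by the top of [G]. *)
Definition series_vertex : Type := (G + {v : H | v <> bot})%type.

Definition series_lower (_ : unit) (u : G) : series_vertex := inl u.

Definition series_upper (_ : unit) (v : H) : series_vertex :=
  match pselect (v = bot) with
  | left _ => inl top
  | right nv => inr (exist _ v nv)
  end.

Definition series_adj (x y : series_vertex) : Prop :=
  image_adj series_lower x y \/ image_adj series_upper x y.

Lemma series_adj_sym x y : series_adj x y -> series_adj y x.
Proof.
by case=> xy; [left|right]; exact: image_adj_sym xy.
Qed.

Lemma series_adj_irr x : ~ series_adj x x.
Proof.
case; apply: image_adj_irr => i u v; first by case.
rewrite /series_upper; case: pselect => [->|nu]; case: pselect => [->|nv]//.
by case.
Qed.

Lemma series_bot_top :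
  (inl bot : series_vertex) <> inr (exist _ top (nesym (@bot_neq_top H))).
Proof. by []. Qed.

(** The top of [G] is identified with the bottom of [H]. *)
Definition series : tbgraph :=
  TBGraph series_adj_sym series_adj_irr series_bot_top.

End Series.

Definition interior (G : tbgraph) : Type := {v : G | v <> bot /\ v <> top}.

(** A copy of [G] with bottom [a], top [b] and interior vertices given by [i]. *)
Definition glue (G : tbgraph) (T : Type) (a b : T) (i : interior G -> T) (v : G) : T :=
  match pselect (v = bot), pselect (v = top) with
  | left _, _ => a
  | right _, left _ => b
  | right nb, right nt => i (exist _ v (conj nb nt))
  end.

Lemma glue_inj (G : tbgraph) T (a b : T) (i : interior G -> T) :
  a <> b -> (forall w, i w <> a) -> (forall w, i w <> b) -> injective i ->
  injective (glue a b i).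
Proof.
move=> ab ia ib inj u v; rewrite /glue.
case: (pselect (u = bot)) => [->|nbu]; case: (pselect (v = bot)) => [->|nbv] //.
- by case: pselect => [_ /ab|ntv /esym/ia].
- by case: pselect => [_ /esym/ab|ntu /ia].
case: (pselect (u = top)) => [->|ntu]; case: (pselect (v = top)) => [->|ntv] //.
- by move=> /esym/ib.
- by move=> /ib.
- by move=> /inj[].
Qed.

Section Parallel.
Variable G : tbgraph.

Definition par_vertex : Type := (bool + nat * interior G)%type.

Definition par_copy (n : nat) : G -> par_vertex :=
  glue (inl false) (inl true) (fun w => inr (n, w)).

Lemma par_adj_irr x : ~ image_adj par_copy x x.
Proof. by apply: image_adj_irr => n; apply: glue_inj => // u v []. Qed.

Lemma par_bot_top : (inl false : par_vertex) <> inl true.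
Proof. by []. Qed.

(** Infinitely many copies of [G] with all bottoms and all tops identified. *)
Definition par : tbgraph :=
  TBGraph (@image_adj_sym _ _ _ par_copy) par_adj_irr par_bot_top.

End Parallel.

Section Oslash.
Variables G H : tbgraph.

(** The edges of [G] oriented from bottom to top. *)
Definition arc : Type := {e : G * G | adj e.1 e.2 /\ (gdist bot e.1 < gdist bot e.2)%N}.

Definition oslash_vertex : Type := (G + arc * interior H)%type.

Definition oslash_copy (e : arc) : H -> oslash_vertex :=
  glue (inl (sval e).1) (inl (sval e).2) (fun w => inr (e, w)).

Lemma oslash_adj_irr x : ~ image_adj oslash_copy x x.
Proof.
apply: image_adj_irr => -[[a b] /= [ab d]]; apply: glue_inj => //=.
- by case=> e; move: ab; rewrite e; exact: adj_irr.
- by move=> u v [].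
Qed.

Lemma oslash_bot_top : (inl bot : oslash_vertex) <> inl top.
Proof. by move=> [e]; exact: (@bot_neq_top G e). Qed.

Definition oslash : tbgraph :=
  TBGraph (@image_adj_sym _ _ _ oslash_copy) oslash_adj_irr oslash_bot_top.

End Oslash.

(** [oslash_pow G n] is the power of [G] with exponent [n.+1]. *)
Fixpoint oslash_pow (G : tbgraph) (n : nat) : tbgraph :=
  if n is n'.+1 then oslash G (oslash_pow G n') else G.

(** [formed b G]: [G] is a countably branching bundle graph; [b] records whether
    some parallel operation was applied to a graph other than a single edge.
    As graphs are simple, [par path1] is again a single edge. *)
Inductive formed : bool -> tbgraph -> Prop :=
| formed_path1 : formed false path1
| formed_series b c G H : formed b G -> formed c H -> formed (b || c) (series G H)
| formed_par_edge b G : formed b G -> tbgraph_iso G path1 -> formed b (par G)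
| formed_par b G : formed b G -> ~ tbgraph_iso G path1 -> formed true (par G)
| formed_iso b G H : formed b G -> tbgraph_iso G H -> formed b H.

Definition nontrivial_bundle_graph (G : tbgraph) : Prop := formed true G.

Definition equi_lipschitz_embeds (R : realType) (X : normedModType R)
    (I : Type) (M : I -> Type) (d : forall i, M i -> M i -> R) : Prop :=
  exists2 D : R, 1 <= D &
  exists (f : forall i, M i -> X) (s : I -> R),
    (forall i, 0 < s i) /\
    forall i (x y : M i),
      s i * d i x y <= `|f i x - f i y| <= s i * D * d i x y.

(* Main.v *)
From HB Require Import structures.
Require Import Defs.
From mathcomp Require Import all_boot all_order all_algebra.
From mathcomp Require Import all_classical all_reals all_analysis.
From mathcomp Require Import zify ring lra.
Import Order.TTheory GRing.Theory Num.Theory.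
Import numFieldNormedType.Exports.
Local Open Scope classical_set_scope.
Local Open Scope ring_scope.

(** The three properties are linked in a cycle: an equivalent AUC norm excludes the
    embeddings, the absence of embeddings bounds the Szlenk index of the dual by
    omega, and this bound produces an equivalent AUC norm.

    AUC norms exclude the embeddings.  A non-trivial bundle graph contains a parallel
    composition of height at least two.  Let [w] be the difference of the images of
    its top and bottom, and [p i] the difference of the images of a first level
    vertex of the [i]-th copy and of the bottom.  If the map is [L]-Lipschitz, then
    [w + (p i - p j)] is the sum of [p i] and [w - p j], so its norm is at most
    [h * L].  But some [p i - p j] is almost in any prescribed subspace of finite
    codimension and is not small, so AUC makes the norm of [w] smaller than [h * L]
    by a definite factor ([bundle_contraction]).  In the iterated graphs this factor
    is gained at every level ([pow_contraction]), which contradicts a uniform lower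
    bound.

    A large index gives embeddings.  If no finite derivation at scale [eps] of the
    ball of the bidual is empty, then by reflexivity a surviving point gives, for
    every length, a strategy against an opponent who chooses subspaces of finite
    codimension: unit vectors [y i] of these subspaces are played so that some
    combination with coefficients at least [eps / 4] has norm at most 3
    ([szlenk_game]).  The unconditional asymptotic structure turns this into a bound
    on all sums with coefficients in [[-1, 1]], uniform in the length
    ([not_szlenk_cube_game]).  Playing along all branches of the tree of finite
    sequences gives a tree of vectors with upper sup-norm estimates on branches and
    lower sup-norm estimates everywhere ([tree_of_game], [coordinate_bound]).  A
    bundle graph maps into it by the level, placed at the root, and by the distance
    to the nearer end of each copy in nested parallel compositions, placed at the
    node naming the copy.  Neighbours differ by at most one in coordinates along a
    common branch, and the largest difference of coordinates controls the distance,
    with constants independent of the graph ([coded_embeds]); the iterated graphs are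
    themselves coordinatized in this way ([coded_oslash_pow]).

    A small index gives an AUC norm.  At scale [eps] finitely many derivations exhaust
    the ball of the bidual.  Giving a slightly larger weight to the points that
    survive longer defines an equivalent norm whose dual norm grows by a small
    multiple of [eps * sigma] only, when a norming functional [f] is perturbed to
    [f + sigma *: g] with [g] vanishing at finitely many points
    ([admissible_perturb]): near a point [psi] of the bidual ball, the points of the
    same rank as [psi] are within [eps] of it, and the others have smaller weight.
    By duality the norm is AUC for displacements large compared with [eps]
    ([scale_norm_gain]), and summing over a sequence of scales gives an AUC norm
    ([AUC_renorming]). *)

Set Implicit Arguments.
Unset Strict Implicit.
Unset Printing Implicit Defensive.

(** * The Hahn-Banach theorem *)

Section HahnBanach.
Context {R : realType} {V : lmodType R}.
Implicit Types p q : V -> R.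

Definition sublinear q : Prop :=
  (forall x y, q (x + y) <= q x + q y) /\
  (forall (t : R) x, 0 <= t -> q (t *: x) = t * q x).

Lemma sublinear0 q : sublinear q -> q 0 = 0.
Proof. by move=> [_ qZ]; have := qZ 0 0 (lexx _); rewrite scaler0 mul0r. Qed.

Lemma sublinear_opp q x : sublinear q -> - q (- x) <= q x.
Proof.
move=> sq; have := sq.1 x (- x); rewrite subrr (sublinear0 sq); lra.
Qed.

(** Zorn's lemma: the pointwise infimum of a chain is finite, because a sublinear
    functional is bounded below by minus its value at the opposite vector. *)
Lemma sublinear_minimal p : sublinear p -> exists q, [/\ sublinear q,
  forall x, q x <= p x &
  forall r, sublinear r -> (forall x, r x <= q x) -> r = q].
Proof.
move=> sp.
pose T := {q | sublinear q /\ forall x, q x <= p x}.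
pose rel (a b : T) := `[< forall x, sval b x <= sval a x >].
have lbT (a : T) x : - p (- x) <= sval a x.
  case: a => a [sa ap] /=; apply: le_trans (sublinear_opp x sa).
  by rewrite lerN2.
have [| | |A totA|q maxq] := @Zorn T rel.
- by move=> t; apply/asboolP.
- move=> a b c /asboolP ab /asboolP bc; apply/asboolP => x.
  exact: le_trans (bc x) (ab x).
- move=> [a Ha] [b Hb] /asboolP /= ab /asboolP /= ba.
  have e : a = b by apply/funext => x; apply/le_anti; rewrite ab ba.
  by subst b; congr exist; exact: Prop_irrelevance.
- have [A0|/set0P[a0 Aa0]] := eqVneq A set0.
    have pT : sublinear p /\ forall x, p x <= p x by [].
    by exists (exist _ p pT) => s; rewrite A0.
  pose m x := inf [set sval a x | a in A].
  have hl x : has_inf [set sval a x | a in A].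
    split; first by exists (sval a0 x), a0.
    by exists (- p (- x)) => _ [a _ <-].
  have mle a x : A a -> m x <= sval a x.
    by move=> Aa; apply: ge_inf; [exact: (hl x).2|exists a].
  have glb x z : (forall a, A a -> z <= sval a x) -> z <= m x.
    by move=> h; apply: lb_le_inf; [exact: (hl x).1|move=> _ [a Aa <-]; exact: h].
  have sm : sublinear m.
    split=> [x y|t x t0].
      rewrite -lerBlDr; apply/glb => a Aa.
      rewrite lerBlDr -lerBlDl; apply/glb => b Ab.
      rewrite lerBlDr.
      have [ab|ba] := totA _ _ Aa Ab.
        move/asboolP : ab => ab; apply: le_trans (mle b _ Ab) _.
        apply: le_trans ((svalP b).1.1 x y) _.
        by rewrite addrC lerD2l; exact: ab.
      move/asboolP : ba => ba; apply: le_trans (mle a _ Aa) _.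
      apply: le_trans ((svalP a).1.1 x y) _.
      by rewrite addrC lerD2r; exact: ba.
    have [->|tn0] := eqVneq t 0.
      rewrite scale0r mul0r; apply/le_anti/andP; split.
        by apply: le_trans (mle a0 _ Aa0) _; rewrite (sublinear0 (svalP a0).1).
      by apply/glb => a _; rewrite (sublinear0 (svalP a).1).
    have t1 : 0 < t by rewrite lt_neqAle eq_sym tn0.
    apply/le_anti/andP; split.
      rewrite -ler_pdivrMl//; apply/glb => a Aa.
      by rewrite ler_pdivrMl// -(svalP a).1.2//; exact: mle.
    apply/glb => a Aa; rewrite (svalP a).1.2// ler_pM2l//; exact: mle.
  have mp x : m x <= p x.
    by apply: le_trans (mle a0 x Aa0) _; exact: (svalP a0).2.
  exists (exist _ m (conj sm mp)) => a Aa; apply/asboolP => x /=; exact: mle.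
exists (sval q); split; [exact: (svalP q).1|exact: (svalP q).2|].
move=> r sr rq.
have rp x : r x <= p x by apply: le_trans (rq x) ((svalP q).2 x).
have := maxq (exist _ r (conj sr rp)).
by move=> <- //; apply/asboolP => x /=; exact: rq.
Qed.

(** The infimum over [t >= 0] of [q (x + t *: y) - t * q y] is sublinear and below
    [q]: it is [q] itself when [q] is minimal, which forces additivity. *)
Lemma sublinear_shift q y : sublinear q -> exists r,
  [/\ sublinear r, forall x, r x <= q x & forall x, r x <= q (x + y) - q y].
Proof.
move=> sq; pose S x := [set q (x + t *: y) - t * q y | t in [set t : R | 0 <= t]].
have lbS x : has_inf (S x).
  split; first by exists (q (x + 0 *: y) - 0 * q y), 0 => //=.
  exists (- q (- x)) => _ [t /= t0 <-].
  rewrite -(sq.2 _ y t0).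
  have := sq.1 (- x) (x + t *: y); rewrite addKr; lra.
pose r x := inf (S x).
have rle x t : 0 <= t -> r x <= q (x + t *: y) - t * q y.
  by move=> t0; apply: ge_inf; [exact: (lbS x).2|exists t].
have ler x z : (forall t, 0 <= t -> z <= q (x + t *: y) - t * q y) -> z <= r x.
  by move=> h; apply: lb_le_inf; [exact: (lbS x).1|move=> _ [t t0 <-]; exact: h].
exists r; split.
- split=> [a b|t x t0].
    rewrite -lerBlDr; apply/ler => s s0.
    rewrite lerBlDr -lerBlDl; apply/ler => u u0.
    rewrite lerBlDr; apply: le_trans (rle _ (s + u) (addr_ge0 s0 u0)) _.
    have -> : a + b + (s + u) *: y = (a + s *: y) + (b + u *: y).
      by rewrite scalerDl addrACA.
    have := sq.1 (a + s *: y) (b + u *: y); lra.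
  have [->|tn0] := eqVneq t 0.
    rewrite scale0r mul0r; apply/le_anti/andP; split.
      by apply: le_trans (rle 0 0 (lexx _)) _; rewrite add0r scale0r (sublinear0 sq) mul0r subr0.
    by apply/ler => s s0; rewrite add0r sq.2// subrr.
  have t1 : 0 < t by rewrite lt_neqAle eq_sym tn0.
  apply/le_anti/andP; split.
    rewrite -ler_pdivrMl//; apply/ler => s s0.
    rewrite ler_pdivrMl//; apply: le_trans (rle _ (t * s) (mulr_ge0 t0 s0)) _.
    by rewrite -scalerA -scalerDr sq.2// mulrBr mulrA.
  apply/ler => s s0.
  have := rle x (t^-1 * s) (mulr_ge0 (ltW (_ : 0 < t^-1)) s0).
  rewrite invr_gt0 => /(_ t1); rewrite -(ler_pM2l t1) => /le_trans; apply.
  by rewrite mulrBr -sq.2// scalerDr scalerA !mulrA divff ?gt_eqF// mul1r.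
- move=> x; apply: le_trans (rle _ 0 (lexx _)) _.
  by rewrite scale0r addr0 mul0r subr0.
- move=> x; apply: le_trans (rle _ 1 ler01) _.
  by rewrite scale1r mul1r.
Qed.

(** A minimal sublinear functional is additive, hence linear; taking it below the
    shift of [p] along [x0] makes it agree with [p] at [x0]. *)
Lemma hahn_banach_sublinear p x0 : sublinear p -> exists f : V -> R,
  [/\ forall (a : R) x y, f (a *: x + y) = a * f x + f y,
      forall x, f x <= p x & f x0 = p x0].
Proof.
move=> sp; have [p0 [sp0 p0p p0x]] := sublinear_shift x0 sp.
have [f [sf fp0 minf]] := sublinear_minimal sp0.
have fD x y : f (x + y) = f x + f y.
  apply/le_anti; rewrite sf.1/=.
  have [r [sr rf ry]] := sublinear_shift y sf.
  by have := ry x; rewrite (minf r sr rf); lra.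
have fN x : f (- x) = - f x.
  by have := fD x (- x); rewrite subrr (sublinear0 sf); lra.
exists f; split.
- move=> a x y; rewrite fD; congr (_ + _).
  have [a0|a0] := leP 0 a; first exact: sf.2.
  have na : 0 <= - a by rewrite oppr_ge0 ltW.
  by have := sf.2 (- a) x na; rewrite scaleNr fN mulNr => /oppr_inj.
- by move=> x; apply: le_trans (fp0 x) (p0p x).
- apply/le_anti; rewrite (le_trans (fp0 _) (p0p _))/=.
  have := le_trans (fp0 (- x0)) (p0x (- x0)).
  by rewrite addNr (sublinear0 sp) fN; lra.
Qed.

End HahnBanach.

(** * Functionals and subspaces of finite codimension *)

(** Dependent choice in which each term may depend on all the previous ones. *)
Lemma list_choice (T : Type) (Q : seq T -> Prop) :
  Q [::] -> (forall l, Q l -> exists x, Q (rcons l x)) ->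
  exists e : nat -> T, forall n, Q (mkseq e n).
Proof.
move=> Q0 QS.
pose step (l : {l | Q l}) : {l | Q l} :=
  let xP := cid (QS (sval l) (svalP l)) in
  exist _ (rcons (sval l) (sval xP)) (svalP xP).
pose F n := iter n step (exist _ [::] Q0).
have [x0 _] := QS _ Q0.
pose e n := last x0 (sval (F n.+1)).
exists e => n.
suff -> : mkseq e n = sval (F n) by exact: svalP.
elim: n => [//|n IH].
rewrite /mkseq -addn1 iotaD map_cat -/(mkseq e n) IH /= add0n addn1.
by rewrite /e /= last_rcons cats1.
Qed.

Section Functionals.
Context {R : realType} {X : normedModType R}.
Implicit Types (f g : dual X) (x y : X).

Lemma dualE f (a : R) x y : f (a *: x + y) = a * f x + f y.
Proof. exact: dual_linear. Qed.

Lemma dual0 f : f 0 = 0.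
Proof. by have := dualE f (-1) 0 0; rewrite scaleN1r addNr mulN1r addNr. Qed.

Lemma dualD f x y : f (x + y) = f x + f y.
Proof. by have := dualE f 1 x y; rewrite scale1r mul1r. Qed.

Lemma dualN f x : f (- x) = - f x.
Proof. by rewrite -scaleN1r dual_funZ mulN1r. Qed.

Lemma dualB f x y : f (x - y) = f x - f y.
Proof. by rewrite dualD dualN. Qed.

Lemma dual_sum f I (r : seq I) (F : I -> X) :
  f (\sum_(i <- r) F i) = \sum_(i <- r) f (F i).
Proof.
elim: r => [|i r IH]; first by rewrite !big_nil dual0.
by rewrite !big_cons dualD IH.
Qed.

Lemma dual_norm_le f x : `|f x : R| <= `|f| * `|x|.
Proof.
have [->|x0] := eqVneq x 0; first by rewrite dual0 !normr0 mulr0.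
have := @dual_norm_ub R X f (`|x|^-1 *: x).
rewrite normrZ normfV normr_id mulVf ?normr_eq0// => /(_ (lexx _)).
by rewrite dual_funZ normrM normfV normr_id ler_pdivrMl ?normr_gt0// mulrC.
Qed.

Lemma dual_norm1_le f x : `|f| <= 1 -> f x <= `|x|.
Proof.
move=> f1; apply: le_trans (ler_norm _) _; apply: le_trans (dual_norm_le f x) _.
by rewrite ler_piMl.
Qed.

Lemma dual_norm_bound f M : 0 <= M -> (forall x, `|f x : R| <= M * `|x|) -> `|f| <= M.
Proof.
move=> M0 fM; apply: dual_norm_lub => x x1; apply: le_trans (fM x) _.
by rewrite ler_piMr.
Qed.

Lemma dual_of (f : X -> R) (M : R) :
  (forall (a : R) x y, f (a *: x + y) = a * f x + f y) ->
  (forall x, `|f x| <= M * `|x|) ->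
  exists F : dual X, forall x, F x = f x.
Proof.
move=> lf fM.
pose g := GRing.isLinear.Build R X R^o _ (f : X -> R^o) lf.
pose h : {linear X -> R^o} := HB.pack (f : X -> R^o) g.
have ch : continuous h.
  apply/linear_bounded_continuous/bounded_funP => r; exists (`|M| * r) => x xr.
  apply: le_trans (fM x) _; apply: le_trans (ler_wpM2r _ (ler_norm M)) _ => //.
  by rewrite ler_wpM2l.
have fP : (f : X -> R^o) \in is_functional by apply/asboolP; split => //; exact: lf.
by exists (Dual fP).
Qed.

Lemma dominated_functional (p : X -> R) x : sublinear p ->
  (forall y, p y <= `|y|) ->
  exists f : dual X, [/\ `|f| <= 1, forall y, f y <= p y & f x = p x].
Proof.
move=> sp p1; have [f [lf fp fx]] := hahn_banach_sublinear x sp.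
have f0 : f 0 = 0 by have := lf (-1) 0 0; rewrite scaleN1r addNr mulN1r addNr.
have fN y : f (- y) = - f y by have := lf (-1) y 0; rewrite addr0 scaleN1r mulN1r f0 addr0.
have f1 y : `|f y| <= 1 * `|y|.
  rewrite mul1r ler_norml (le_trans (fp y) (p1 y)) andbT.
  by rewrite lerNl -fN -(normrN y); exact: le_trans (fp _) (p1 _).
have [F FE] := dual_of lf f1.
exists F; split => [|y|]; rewrite ?FE//.
by apply: dual_norm_bound => // y; rewrite FE.
Qed.

Lemma norm_sublinear : sublinear (fun x : X => `|x|).
Proof.
by split=> [x y|t x t0]; [exact: ler_normD|rewrite normrZ ger0_norm].
Qed.

Lemma norming_functional x : exists2 f : dual X, `|f| <= 1 & f x = `|x|.
Proof.
have [f [f1 _ fx]] := dominated_functional x norm_sublinear (fun y => lexx _).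
by exists f.
Qed.

Definition subspace (Y : set X) : Prop :=
  Y 0 /\ (forall (a : R) x y, Y x -> Y y -> Y (a *: x + y)).

Lemma subspaceZ Y (a : R) x : subspace Y -> Y x -> Y (a *: x).
Proof. by move=> [Y0 YL] Yx; rewrite -[_ *: _]addr0; exact: YL. Qed.

Lemma subspaceD Y x y : subspace Y -> Y x -> Y y -> Y (x + y).
Proof. by move=> [Y0 YL] Yx Yy; rewrite -[x]scale1r; exact: YL. Qed.

Lemma subspaceN Y x : subspace Y -> Y x -> Y (- x).
Proof. by move=> sY Yx; rewrite -scaleN1r; exact: subspaceZ. Qed.

Lemma subspace_sum Y I (r : seq I) (F : I -> X) : subspace Y ->
  (forall i, Y (F i)) -> Y (\sum_(i <- r) F i).
Proof.
move=> sY YF; elim: r => [|i r IH]; first by rewrite big_nil; exact: sY.1.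
by rewrite big_cons; exact: subspaceD.
Qed.

Definition dist_to (Y : set X) x : R := inf [set `|x - y| | y in Y].

Lemma dist_to_le Y x y : Y y -> dist_to Y x <= `|x - y|.
Proof.
move=> Yy; apply: ge_inf; last by exists y.
by exists 0 => _ [z _ <-].
Qed.

Lemma le_dist_to Y x (z : R) : subspace Y -> (forall y, Y y -> z <= `|x - y|) ->
  z <= dist_to Y x.
Proof.
move=> sY h; apply: lb_le_inf; first by exists (`|x - 0|), 0 => //; exact: sY.1.
by move=> _ [y Yy <-]; exact: h.
Qed.

Lemma dist_to_sublinear Y : subspace Y -> sublinear (dist_to Y).
Proof.
move=> sY; have Y0 := sY.1; split=> [x y|t x t0].
  rewrite -lerBlDr; apply: (le_dist_to sY) => u Yu.
  rewrite lerBlDr -lerBlDl; apply: (le_dist_to sY) => v Yv.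
  rewrite lerBlDl; apply: le_trans (dist_to_le _ (subspaceD sY Yu Yv)) _.
  by rewrite opprD addrACA; exact: ler_normD.
have [->|tn0] := eqVneq t 0.
  rewrite scale0r mul0r; apply/le_anti/andP; split.
    by apply: le_trans (dist_to_le _ Y0) _; rewrite subr0 normr0.
  exact: le_dist_to.
have t1 : 0 < t by rewrite lt_neqAle eq_sym tn0.
apply/le_anti/andP; split.
  rewrite -ler_pdivrMl//; apply: (le_dist_to sY) => y Yy.
  rewrite ler_pdivrMl//; apply: le_trans (dist_to_le _ (subspaceZ t sY Yy)) _.
  by rewrite -scalerBr normrZ ger0_norm.
apply: (le_dist_to sY) => y Yy.
rewrite -ler_pdivlMl//; apply: le_trans (dist_to_le _ (subspaceZ t^-1 sY Yy)) _.
rewrite -[x in x - _]scale1r -(mulVf tn0) -scalerA -scalerBr normrZ ger0_norm//.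
by rewrite invr_ge0.
Qed.

(** The distance to a subspace is a seminorm vanishing on it, so a functional
    dominated by it vanishes there as well. *)
Lemma dist_functional Y x : subspace Y ->
  exists f : dual X, [/\ `|f| <= 1, forall y, Y y -> f y = 0 & f x = dist_to Y x].
Proof.
move=> sY; have [|f [f1 fp fx]] := dominated_functional x (dist_to_sublinear sY).
  by move=> y; rewrite -[in leRHS](subr0 y); exact: dist_to_le sY.1.
have fY y : Y y -> f y <= 0.
  move=> Yy; apply: le_trans (fp y) _.
  by apply: le_trans (dist_to_le _ Yy) _; rewrite subrr normr0.
exists f; split => // y Yy; apply/le_anti; rewrite fY//=.
by rewrite -oppr_le0 -dualN; apply: fY; exact: subspaceN.
Qed.

Lemma dist_to_gt0 Y x : closed Y -> subspace Y -> ~ Y x -> 0 < dist_to Y x.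
Proof.
move=> cY sY nYx; have oY : open (~` Y) by exact: closed_openC.
have /nbhs_ballP[e /= e0 be] : nbhs x (~` Y) by exact: open_nbhs_nbhs.
apply: lt_le_trans e0 _; apply: (le_dist_to sY) => y Yy.
rewrite leNgt; apply/negP => xye; apply: (be y) => //.
by rewrite -ball_normE /ball_ /=.
Qed.

(** For a biorthogonal family of pairs, the projection onto the common kernel of the
    functionals. *)
Definition proj (s : seq (dual X * X)) x : X := x - \sum_(p <- s) (p.1 x : R) *: p.2.

Lemma projL s (a : R) x y : proj s (a *: x + y) = a *: proj s x + proj s y.
Proof.
rewrite /proj; under eq_bigr do rewrite dualE scalerDl -scalerA.
by rewrite big_split /= -scaler_sumr scalerBr opprD addrACA.
Qed.

Lemma proj0 s : proj s 0 = 0.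
Proof. by have := projL s (-1) 0 0; rewrite scaleN1r addNr scaleN1r addNr. Qed.

Lemma proj_sum s I (r : seq I) (c : I -> R) (F : I -> X) :
  proj s (\sum_(i <- r) c i *: F i) = \sum_(i <- r) c i *: proj s (F i).
Proof.
elim: r => [|i r IH]; first by rewrite !big_nil proj0.
by rewrite !big_cons projL IH.
Qed.

Lemma proj_id (s : seq (dual X * X)) x : (forall p, p \in s -> p.1 x = 0) -> proj s x = x.
Proof.
by move=> h; rewrite /proj big1_seq ?subr0// => p /= ps; rewrite h ?scale0r.
Qed.

Lemma norm_proj_sub (s : seq (dual X * X)) x (d : R) : (forall p, p \in s -> `|p.1 x : R| <= d) ->
  `|x - proj s x| <= d * \sum_(p <- s) `|p.2|.
Proof.
move=> h; rewrite /proj opprB addrC subrK mulr_sumr.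
apply: le_trans (ler_norm_sum _ _ _) _.
rewrite big_seq [leRHS]big_seq; apply: ler_sum => p ps.
by rewrite normrZ ler_wpM2r// h.
Qed.

(** Gram-Schmidt with functionals instead of scalar products: as long as some
    projected [v] is off [Y], Hahn-Banach separates it from [Y]. *)
Lemma biorthogonal_system (Y : set X) (vs : seq X) : closed Y -> subspace Y ->
  exists s : seq (dual X * X),
    [/\ forall p y, p \in s -> Y y -> p.1 y = 0,
        forall p x, p \in s -> p.1 (proj s x) = 0 &
        forall v, v \in vs -> Y (proj s v)].
Proof.
move=> cY sY.
suff [s [s1 s2 _ s3]] : exists s : seq (dual X * X),
    [/\ forall p y, p \in s -> Y y -> p.1 y = 0,
        forall p x, p \in s -> p.1 (proj s x) = 0,
        forall p, p \in s -> proj s p.2 = 0 &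
        forall v, v \in vs -> Y (proj s v)] by exists s.
elim: vs => [|v vs [s [s1 s2 s3 s4]]]; first by exists [::].
have [Yv|nYv] := pselect (Y (proj s v)).
  by exists s; split => // w; rewrite inE => /orP[/eqP ->|/s4].
have PP x : proj s (proj s x) = proj s x by apply: proj_id => p /s2; exact.
have d0 := dist_to_gt0 cY sY nYv.
have [f0 [_ f0Y f0v]] := dist_functional (proj s v) sY.
pose d := dist_to Y (proj s v).
have fE x : d^-1 * f0 (proj s x) =
   d^-1 * f0 x - \sum_(p <- s) (p.1 x : R) * (d^-1 * f0 p.2).
  rewrite /proj dualB dual_sum mulrBr; congr (_ - _).
  rewrite mulr_sumr; apply: eq_bigr => p _.
  by rewrite dual_funZ; ring.
have [f fP] : exists f : dual X, forall x, f x = d^-1 * f0 (proj s x).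
  apply: (@dual_of (fun x => d^-1 * f0 (proj s x))
    (d^-1 * `|f0| + \sum_(p <- s) `|p.1| * `|d^-1 * f0 p.2|)).
    by move=> a x y; rewrite projL dualE; ring.
  move=> x; rewrite fE; apply: le_trans (ler_normB _ _) _; rewrite mulrDl.
  apply: lerD.
    rewrite normrM (ger0_norm (x := d^-1)) ?invr_ge0 ?(ltW d0)// -mulrA.
    by rewrite ler_wpM2l ?invr_ge0 ?(ltW d0)// dual_norm_le.
  apply: le_trans (ler_norm_sum _ _ _) _; rewrite mulr_suml.
  by apply: ler_sum => p _; rewrite normrM mulrAC ler_wpM2r// dual_norm_le.
have fv : f (proj s v) = 1 by rewrite fP PP f0v mulVf// gt_eqF.
have PE x : proj ((f, proj s v) :: s) x = proj s x - (f x : R) *: proj s v.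
  by rewrite /proj big_cons /= opprD addrCA addrC.
have fPx x : f (proj s x) = f x by rewrite !fP PP.
exists ((f, proj s v) :: s); split.
- move=> p y; rewrite inE => /orP[/eqP -> /= Yy|/s1]; last exact.
  by rewrite fP proj_id ?f0Y ?mulr0// => q qs; exact: s1.
- move=> p x; rewrite PE dualB dual_funZ inE => /orP[/eqP -> /=|ps].
    by rewrite fv fPx mulr1 subrr.
  by rewrite !s2// mulr0 subr0.
- move=> p; rewrite PE inE => /orP[/eqP -> /=|ps].
    by rewrite fv PP scale1r subrr.
  by rewrite s3// -fPx s3// dual0 scale0r subr0.
- move=> w; rewrite PE inE => /orP[/eqP ->|wvs].
    by rewrite -fPx fv scale1r subrr; exact: sY.1.
  rewrite fP (f0Y _ (s4 _ wvs)) mulr0 scale0r subr0; exact: s4.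
Qed.

Lemma cof_subspace Y : cof Y -> subspace Y.
Proof. by case. Qed.

(** Hence [Y] contains the common kernel of finitely many functionals, and a vector at
    which these are small is close to [Y]. *)
Lemma cof_proj Y : cof Y -> exists s, forall x, Y (proj s x).
Proof.
move=> [cY sY [n [v vP]]].
have [s [s1 _ s3]] := biorthogonal_system [seq v i | i : 'I_n] cY sY.
exists s => x; have [c cP] := vP x.
rewrite -(subrK (\sum_i c i *: v i) x) -[x - _]scale1r projL proj_sum.
apply: (subspaceD sY).
  by rewrite scale1r proj_id// => p ps; exact: s1.
apply: (subspace_sum _ sY) => i; apply: (subspaceZ _ sY); apply: s3.
by apply/mapP; exists i => //; rewrite mem_enum.
Qed.

Lemma cof_setT : cof [set: X].
Proof. by split; [exact: closedT|split|exists 0%N, (fun=> 0) => x; exists (fun=> 0)]. Qed.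

Lemma cof_ker Y f : cof Y -> cof (Y `&` [set x | f x = 0]).
Proof.
move=> [cY sY [n [v vP]]]; split.
- apply: closedI => //; rewrite (_ : [set x | f x = 0] = f @^-1` [set (0 : R^o)])//.
  apply: preimage_closed; first by move=> x _; exact: dual_continuous.
  exact: closed_eq.
- split; first by split; [exact: sY.1|exact: dual0].
  move=> a x y [Yx fx] [Yy fy]; split; first exact: sY.2.
  by rewrite /= dualE fx fy mulr0 addr0.
(* If [f] does not vanish on [Y], one vector [u] of [Y] off its kernel completes a
   complement of [Y] to one of the smaller subspace. *)
have [[u Yu fu]|nu] := pselect (exists2 u, Y u & f u != 0); last first.
  exists n, v => x; have [c cP] := vP x; exists c; split=> //=.
  by apply: contra_notP nu => fx; exists (x - \sum_i c i *: v i) => //; apply/eqP.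
exists n.+1, (fun i => if unlift ord0 i is Some j then v j else u) => x.
have [c cP] := vP x; set w := x - _ in cP.
exists (fun i => if unlift ord0 i is Some j then c j else f w / f u).
rewrite big_ord_recl unlift_none.
under eq_bigr do rewrite liftK.
rewrite opprD addrCA -/w addrC -scaleNr addrC; split.
  exact: sY.2.
by rewrite /= dualE mulNr divfK// addNr.
Qed.

Lemma cof_kers Y (fs : seq (dual X)) : cof Y ->
  exists Z, [/\ cof Z, Z `<=` Y & forall f z, f \in fs -> Z z -> f z = 0].
Proof.
move=> cY; elim: fs => [|f fs [Z [cZ ZY Zf]]]; first by exists Y; split.
exists (Z `&` [set x | f x = 0]); split; first exact: cof_ker.
  by move=> z [/ZY].
by move=> g z; rewrite inE => /orP[/eqP -> []//|gfs [Zz _]]; exact: Zf.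
Qed.

Lemma cof_meet (Y Y' : set X) : cof Y -> cof Y' -> exists Z, [/\ cof Z, Z `<=` Y & Z `<=` Y'].
Proof.
move=> cY /cof_proj[s sY']; have [Z [cZ ZY Zs]] := cof_kers (map fst s) cY.
exists Z; split => // z Zz; rewrite -(@proj_id s z) => [|p ps]; first exact: sY'.
by apply: Zs => //; apply: map_f.
Qed.

Lemma pigeonhole_functionals (fs : seq (dual X)) (p : nat -> X) (M d : R) :
  0 < d -> (forall i, `|p i| <= M) ->
  exists i j, (i < j)%N /\ forall f, f \in fs -> `|f (p i - p j) : R| < d.
Proof.
move=> d0 pM.
have M0 : 0 <= M by apply: le_trans (pM 0).
pose B := \sum_(f <- fs) `|f| * M.
have B0 : 0 <= B by apply: sumr_ge0 => f _; rewrite mulr_ge0.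
have fB f i : f \in fs -> `|f (p i) : R| <= B.
  move=> ffs; apply: le_trans (dual_norm_le _ _) _.
  rewrite /B (big_rem f)//= ler_wpDr//; first by apply: sumr_ge0 => g _; rewrite mulr_ge0.
  by rewrite ler_wpM2l.
pose q := Num.truncn ((B + B) / d).
pose cell (i : nat) (f : dual X) := Num.truncn ((f (p i) + B) / d).
have cq i f : f \in fs -> (cell i f < q.+1)%N.
  move=> ffs; rewrite ltnS; apply: le_truncn.
  rewrite ler_pM2r ?invr_gt0// lerD2r; apply: le_trans (ler_norm _) _; exact: fB.
pose T := {ffun 'I_(size fs) -> 'I_q.+1}.
pose c (i : 'I_(#|T|.+1)) : T := [ffun k : 'I_(size fs) => inord (cell i fs`_k)].
have /injectivePn[i [j ij cij]] : ~~ injectiveb c.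
  apply/negP => /injectiveP/leq_card; by rewrite card_ord ltnn.
have close f : f \in fs -> `|f (p i) - f (p j) : R| < d.
  move=> ffs; have k_lt : (index f fs < size fs)%N by rewrite index_mem.
  have := congr1 (fun g : T => val (g (Ordinal k_lt))) cij.
  rewrite !ffunE /= nth_index// !inordK ?cq// /cell => e.
  have nn k : 0 <= (f (p k) + B) / d.
    rewrite divr_ge0 ?(ltW d0)//; have := fB f k ffs; rewrite ler_norml; lra.
  have /andP[h1 h2] := truncn_itv (nn i).
  have /andP[h3 h4] := truncn_itv (nn j).
  rewrite -e in h3 h4; rewrite -natr1 in h2; rewrite -natr1 in h4.
  have {}h2 := lt_le_trans h2 (lerD h3 (lexx 1)).
  have {}h4 := lt_le_trans h4 (lerD h1 (lexx 1)).
  rewrite ltr_pdivrMr// mulrDl mulfVK ?gt_eqF// mul1r in h2.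
  rewrite ltr_pdivrMr// mulrDl mulfVK ?gt_eqF// mul1r in h4.
  by rewrite ltr_norml; lra.
have [lt_ij|lt_ji|e] := ltngtP i j; last by move: ij; rewrite (val_inj e) eqxx.
  by exists i, j; split=> // f ffs; rewrite dualB; exact: close.
by exists j, i; split=> // f ffs; rewrite dualB distrC; exact: close.
Qed.

Definition span_of (F : seq X) : set X :=
  [set x | exists c : nat -> R, x = \sum_(i < size F) c i *: F`_i].

Lemma span_subspace F : subspace (span_of F).
Proof.
split; first by exists (fun=> 0); rewrite big1// => i _; rewrite scale0r.
move=> a _ _ [c ->] [c' ->]; exists (fun i => a * c i + c' i).
rewrite scaler_sumr -big_split; apply: eq_bigr => i _ /=.
by rewrite scalerA -scalerDl.
Qed.

Lemma span_mem F x : x \in F -> span_of F x.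
Proof.
move=> xF; have k_lt : (index x F < size F)%N by rewrite index_mem.
exists (fun i => (i == index x F)%:R); rewrite (bigD1 (Ordinal k_lt))//= eqxx scale1r.
rewrite nth_index// big1 ?addr0// => i ine; rewrite (_ : (_ == _) = false) ?scale0r//.
by apply/negbTE; apply: contra ine => /eqP e; apply/eqP/val_inj.
Qed.

(** The unit sphere of a finite-dimensional space is half-normed by finitely many
    functionals: otherwise it would contain an infinite separated sequence. *)
Lemma half_norming (F : seq X) : exists fs : seq (dual X),
  forall u, span_of F u -> `|u| = 1 ->
  exists f : dual X, [/\ f \in fs, `|f| <= 1 & 1 / 2 <= f u].
Proof.
apply: contrapT => nfs.
have c0 : closed [set (0 : X)].
  exact/accessible_closed_set1/hausdorff_accessible/norm_hausdorff.
have s0 : subspace [set (0 : X)].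
  by split => // a x y -> ->; rewrite scaler0 addr0.
have [s [_ _ sF]] := biorthogonal_system F c0 s0.
have projF u : span_of F u -> proj s u = 0.
  move=> [c ->]; rewrite proj_sum big1// => i _; rewrite sF ?scaler0//.
  exact: mem_nth.
pose Q (l : seq (dual X * X)) :=
  (forall i, (i < size l)%N -> [/\ `|(nth (0, 0) l i).1| <= 1, span_of F (nth (0, 0) l i).2,
    `|(nth (0, 0) l i).2| = 1 & (nth (0, 0) l i).1 (nth (0, 0) l i).2 = 1]) /\
  (forall i j, (i < j)%N -> (j < size l)%N ->
     (nth (0, 0) l i).1 (nth (0, 0) l j).2 < 1 / 2).
have [//|l [Q1 Q2]|e eQ] := @list_choice _ Q.
  have [u Fu [u1 hu]] : exists2 u, span_of F u & `|u| = 1 /\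
      forall f, f \in map fst l -> `|f| <= 1 -> f u < 1 / 2.
    apply: contra_notP nfs => nu; exists (map fst l) => u Fu u1.
    apply: contra_notP nu => nf; exists u => //; split => // f fl f1.
    by rewrite ltNge; apply/negP => h; apply: nf; exists f.
  have [f f1 fu] := norming_functional u.
  exists (f, u); split=> [i|i j ij]; rewrite size_rcons ltnS.
    rewrite leq_eqVlt => /orP[/eqP ->|il]; rewrite nth_rcons.
      by rewrite ltnn eqxx /= fu u1.
    by rewrite il; exact: Q1.
  rewrite leq_eqVlt => /orP[/eqP e|jl]; rewrite !nth_rcons.
    rewrite -e ij ltnn eqxx /=; apply: hu; last by case: (Q1 i); rewrite -?e.
    by apply/map_f/mem_nth; rewrite -e.
  by rewrite jl (ltn_trans ij jl); exact: Q2.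
have eP i : [/\ `|(e i).1| <= 1, span_of F (e i).2, `|(e i).2| = 1 & (e i).1 (e i).2 = 1].
  by have [/(_ i)] := eQ i.+1; rewrite size_mkseq nth_mkseq// => + _; apply.
have eP2 i j : (i < j)%N -> (e i).1 (e j).2 < 1 / 2.
  move=> ij; have [_ /(_ i j ij)] := eQ j.+1; rewrite size_mkseq !nth_mkseq//; first exact.
  exact: ltnW.
pose S := 1 + \sum_(p <- s) `|p.2|.
have S0 : 0 < S by rewrite ltr_pwDl// sumr_ge0.
have [||i [j [ij hij]]] := @pigeonhole_functionals (map fst s) (fun i => (e i).2) 1 (2 * S)^-1.
- by rewrite invr_gt0 mulr_gt0.
- by move=> i; case: (eP i) => _ _ ->.
have [f1 Fi ui fi] := eP i; have [_ Fj uj _] := eP j.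
have sFij : span_of F ((e i).2 - (e j).2).
  by apply: (subspaceD (span_subspace F)) => //; exact: (subspaceN (span_subspace F)).
have : `|(e i).2 - (e j).2| <= 1 / 2.
  rewrite -[X in `|X|]subr0 -{1}(projF _ sFij).
  apply: le_trans (norm_proj_sub (d := (2 * S)^-1) _) _.
    by move=> p ps; apply/ltW/hij/map_f.
  rewrite invfM -mulrA div1r ler_piMr ?invr_ge0// mulrC ler_pdivrMr// mul1r.
  by rewrite /S lerDr.
apply/negP; rewrite -ltNge; apply: lt_le_trans (dual_norm1_le _ f1).
by rewrite dualB fi; have := eP2 _ _ ij; lra.
Qed.

(** [Y] is the common kernel of the functionals half-norming the span: moving a point
    [u] of the span along [Y] cannot reduce its norm by more than half. *)
Lemma cof_away (F : seq X) : exists2 Y, cof Y &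
  forall y u, Y y -> span_of F u -> `|y| <= 3 * `|y - u|.
Proof.
have [fs fsP] := half_norming F.
have [Y [cY _ Yfs]] := cof_kers fs cof_setT.
exists Y => // y u Yy Fu.
have h : `|u| <= 2 * `|y - u|.
  have [->|u0] := eqVneq u 0; first by rewrite normr0 mulr_ge0.
  have nu : 0 < `|u| by rewrite normr_gt0.
  have [||f [ffs f1]] := fsP (`|u|^-1 *: u).
  - exact: (subspaceZ _ (span_subspace F)).
  - by rewrite normrZ normfV normr_id mulVf ?gt_eqF.
  rewrite dual_funZ ler_pdivlMl// => fu.
  have := dual_norm1_le (u - y) f1; rewrite dualB (Yfs f y ffs Yy) subr0 distrC.
  by lra.
have := ler_normD (y - u) u; rewrite subrK; lra.
Qed.

End Functionals.

(** * Weak-star compactness and Szlenk derivations *)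

Section WeakStar.
Context {R : realType} (E : normedModType R).
Implicit Types (phi psi : dual E) (e : E).

(* Compactness in terms of covers is stated for pointed spaces. *)
HB.instance Definition _ := isPointed.Build (weak_star E) (0 : dual E).

Lemma weak_star_eval_continuous e :
  continuous (fun phi : weak_star E => (phi : dual E) e : R^o).
Proof.
move=> phi.
have := @initial_continuous (dual E) {ptws E -> R^o} (fun f => f) phi.
move=> c1; have c2 := @proj_continuous E (fun=> R^o) e (phi : dual E).
exact: continuous_comp c1 c2.
Qed.

Lemma weak_star_basic_open phi (es : seq E) (d : R) : 0 < d ->
  exists U : set (weak_star E), [/\ open U, U phi &
    forall psi e, e \in es -> U psi -> `|psi e - phi e : R| < d].
Proof.
move=> d0; elim: es => [|e es [U [oU Uphi hU]]].
  by exists setT; split => //; exact: openT.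
exists (U `&` ((fun psi : weak_star E => (psi : dual E) e : R^o) @^-1`
  (ball (phi e : R^o) d))); split.
- apply: openI => //; apply: open_comp; last exact: ball_open.
  by move=> x _; exact: weak_star_eval_continuous.
- by split => //; exact: ballxx.
- move=> psi g; rewrite inE => /orP[/eqP ->|ges] [Upsi h]; last exact: hU.
  by rewrite distrC; move: h; rewrite /= -ball_normE.
Qed.

(** Banach-Alaoglu: along an ultrafilter, each evaluation stays in a compact interval
    and converges there; the limits form a functional of norm at most one. *)
Lemma dual_ball_compact : compact (@dual_ball R E : set (weak_star E)).
Proof.
rewrite compact_ultra => F UF FB.
pose ev e (phi : weak_star E) : R^o := (phi : dual E) e.
have cv e : exists l : R^o, ev e @ F --> l /\ `|l| <= `|e|.
  have cK : compact (`[- `|e|, `|e|]%classic : set R^o) by exact: segment_compact.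
  have [|l [Kl cl]] := cK (ev e @ F) _.
    rewrite /nbhs /=; apply: filterS FB => phi /= phi1.
    rewrite in_itv /= -ler_norml; apply: le_trans (dual_norm_le _ _) _.
    by rewrite ler_piMl.
  exists l; split; last by move: Kl; rewrite /= in_itv /= -ler_norml.
  move=> N Nl; have [//|FN] := in_ultra_setVsetC (ev e @^-1` N) UF.
  have [x [+ /=]] := cl (~` N) N FN Nl; exact.
have {cv} [L LP] := choice cv.
have Llin (a : R) x y : L (a *: x + y) = a * L x + L y.
  apply: (cvg_unique (@norm_hausdorff _ R^o) (LP _).1).
  rewrite (_ : ev (a *: x + y) = (fun phi => a *: ev x phi + ev y phi)); last first.
    by apply/funext => phi; rewrite /ev dualE.
  by apply: cvgD; [apply: cvgZr; exact: (LP x).1|exact: (LP y).1].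
have [phi phiE] : exists phi : dual E, forall x, phi x = L x.
  by apply: (dual_of (M := 1) Llin) => x; rewrite mul1r; exact: (LP x).2.
exists phi; split.
  by apply: dual_norm_bound => // x; rewrite phiE mul1r; exact: (LP x).2.
have cvp : {ptws, (fun f : weak_star E => (f : dual E) : E -> R^o) @ F
    --> (dual_fun phi : E -> R^o)}.
  apply/(@pointwise_cvgP E R^o ((fun f : weak_star E => (f : dual E) : E -> R^o) @ F)).
  by move=> e; rewrite phiE; exact: (LP e).1.
move=> A [_ [[B oB <-] Bphi BA]].
apply: filterS BA _; apply: cvp; exact: open_nbhs_nbhs.
Qed.

Lemma dual_ball_finite_cover (U : weak_star E -> set (weak_star E)) :
  (forall phi, dual_ball phi -> open (U phi)) ->
  (forall phi, dual_ball phi -> U phi phi) ->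
  exists s : seq (dual E), (forall phi, phi \in s -> dual_ball phi) /\
    forall psi, dual_ball psi -> exists2 phi, phi \in s & U phi psi.
Proof.
move=> oU Ux; have := dual_ball_compact; rewrite compact_cover.
move=> /(_ _ (@dual_ball R E : set (weak_star E)) U oU)[|s sB sU].
  by move=> phi Bphi; exists phi => //; exact: Ux.
exists (finmap.enum_fset s); split => [phi /sB|psi /sU[phi phis]]; first by rewrite inE.
by exists phi.
Qed.

Lemma nested_closed_nonempty (D : nat -> set (dual E)) :
  (forall n, closed (D n : set (weak_star E))) -> (forall n, D n `<=` dual_ball (E := E)) ->
  (forall m n, (m <= n)%N -> D n `<=` D m) -> (forall n, D n !=set0) ->
  \bigcap_n D n !=set0.
Proof.
move=> cD DB Danti D0; have [phi phiD] := choice D0.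
have [|p [_ clp]] := dual_ball_compact (F := (phi : nat -> weak_star E) @ \oo) _.
  by exists 0%N => // n _; exact: (DB n _ (phiD n)).
exists p => m _; apply: (cD m) => B Bp; apply: clp => //.
exists m => // n /= mn; exact: (Danti _ _ mn _ (phiD n)).
Qed.

End WeakStar.

Section Derivation.
Context {R : realType} (E : normedModType R).
Implicit Types (K : set (dual E)) (eps : R).

Definition derived eps (n : nat) : set (dual E) :=
  szlenk_derivative eps (@dual_ball R E) (iter n Osucc Ozero).

Lemma diam_le K eps : (diam K <= eps%:E)%E <->
  (forall phi psi, K phi -> K psi -> `|phi - psi| <= eps).
Proof.
split=> [h phi psi Kphi Kpsi|h].
  rewrite -lee_fin; apply: le_trans h; apply: ereal_sup_ubound.
  by exists (phi, psi).
by apply: ge_ereal_sup => _ [[phi psi] [/= Kphi Kpsi] <-]; rewrite lee_fin h.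
Qed.

(** Otherwise the neighbourhood [U] would have diameter at most [eps], by the triangle
    inequality through [phi]. *)
Lemma szlenk_step_separated K eps phi (U : set (weak_star E)) :
  szlenk_step eps K phi -> open U -> U phi ->
  exists psi, [/\ K psi, U psi & eps / 2 < `|psi - phi|].
Proof.
move=> [Kphi h] oU Uphi; apply: contrapT => nex; apply: h.
exists (K `&` U); last by split.
split; first by exists U.
apply/diam_le => p q [Kp Up] [Kq Uq].
have h r : K r -> U r -> `|r - phi| <= eps / 2.
  by move=> Kr Ur; rewrite leNgt; apply/negP => hr; apply: nex; exists r.
rewrite -(subrKA phi); apply: le_trans (ler_normD _ _) _.
rewrite (distrC phi); have := h p Kp Up; have := h q Kq Uq; lra.
Qed.

Lemma not_szlenk_step K eps phi : K phi -> ~ szlenk_step eps K phi ->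
  exists U : set (weak_star E), [/\ open U, U phi,
    forall psi chi, K psi -> U psi -> K chi -> U chi -> `|psi - chi| <= eps &
    forall psi, U psi -> ~ szlenk_step eps K psi].
Proof.
move=> Kphi ns.
have [V [[U oU VE] dV] Vphi] : (\bigcup_(V in [set V | rel_open K V /\
    (diam V <= eps%:E)%E]) V) phi by apply: contrapT => h; apply: ns.
rewrite VE in dV Vphi; exists U; split => //; first exact: Vphi.2.
  by move/diam_le : dV => dV psi chi Kpsi Upsi Kchi Uchi; exact: dV.
by move=> psi Upsi [Kpsi]; apply; exists (K `&` U) => //; split => //; exists U.
Qed.

Lemma szlenk_step_closed K eps : closed (K : set (weak_star E)) ->
  closed (szlenk_step eps K : set (weak_star E)).
Proof.
move=> cK.
pose W := \bigcup_(U in [set U : set (weak_star E) | open U /\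
   (diam (K `&` (U : set (dual E))) <= eps%:E)%E]) U.
have oW : open W by apply: bigcup_open => U [].
rewrite (_ : szlenk_step eps K = (K : set (weak_star E)) `&` ~` W).
  by apply: closedI => //; exact: open_closedC.
apply/seteqP; split=> phi [Kphi h]; split => // -[V].
  by move=> [oV dV] Vphi; apply: h; exists (K `&` V) => //; split => //; exists V.
move=> [[U oU VE] dV] Vphi; apply: h; rewrite VE in dV Vphi.
by exists U; [split|exact: Vphi.2].
Qed.

Lemma derived_closed eps n : closed (derived eps n : set (weak_star E)).
Proof.
elim: n => [|n IH]; last exact: szlenk_step_closed.
move=> phi clphi; apply: dual_norm_bound => // e; rewrite mul1r.
apply/ler_addgt0Pr => d d0.
have [U [oU Uphi hU]] := weak_star_basic_open phi [:: e] d0.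
have [psi [psi1 Upsi]] := clphi U (open_nbhs_nbhs (conj oU Uphi)).
have := hU psi e (mem_head _ _) Upsi.
have : `|psi e : R| <= `|e|.
  by apply: le_trans (dual_norm_le _ _) _; rewrite ler_piMl.
have := ler_normB (psi e : R) (psi e - phi e); rewrite opprB addrC subrK; lra.
Qed.

Lemma iter_Osucc_le m n : (m <= n)%N ->
  ole (iter m Osucc Ozero) (iter n Osucc Ozero).
Proof. by elim: m n => [//|m IH] [//|n] /=; exact: IH. Qed.

Lemma derived_anti eps m n : (m <= n)%N -> derived eps n `<=` derived eps m.
Proof. by move=> mn; apply: szlenk_derivative_anti; exact: iter_Osucc_le. Qed.

Lemma derived_ball eps n : derived eps n `<=` dual_ball (E := E).
Proof. exact: szlenk_derivative_sub. Qed.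

(** The finite derivations are nested and weak-star compact, so they have a common
    point unless one of them is empty. *)
Lemma derived_omega eps : szlenk_derivative eps (@dual_ball R E) omega = set0 ->
  exists n, derived eps n = set0.
Proof.
move=> om0; apply: contrapT => nex.
have [||||phi phiD] := @nested_closed_nonempty R E (derived eps).
- exact: derived_closed.
- exact: derived_ball.
- exact: derived_anti.
- by move=> n; apply/set0P/eqP => n0; apply: nex; exists n.
have : szlenk_derivative eps (@dual_ball R E) omega phi.
  by split=> [|n _]; [exact: (phiD 0%N)|exact: phiD].
by rewrite om0.
Qed.

(** By induction on a presentation of an upper bound of the ordinal. *)
Lemma olt_wf : well_founded olt.
Proof.
suff h a b : ole b a -> Acc olt b by move=> a; apply: h (ole_refl a).
elim: a b => [|a IH|I f IH] b ba; constructor=> c cb; have := ole_trans cb ba.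
- by [].
- exact: IH.
- by move=> [i /oltW]; exact: IH.
Qed.

Lemma ole_least (P : Ord -> Prop) a : P a -> exists b, P b /\ forall c, P c -> ole b c.
Proof.
elim/(well_founded_ind olt_wf) : a => a IH Pa.
have [[b [Pb ba]]|h] := pselect (exists b, P b /\ olt b a); first exact: IH ba Pb.
exists a; split=> // c Pc; have [//|ca] := ole_total a c.
by case: h; exists c.
Qed.

(** The least ordinals and least upper bounds in the definition of the index exist by
    well-foundedness; compactness then replaces [omega] by a finite order. *)
Lemma szlenk_index_omegaP : eole (szlenk_index E) (Some omega) <->
  forall eps, 0 < eps -> exists n, derived eps n = set0.
Proof.
split=> [|fin].
  rewrite /szlenk_index; set S := (X in xget _ X).
  have [[a Sa]|nS] := pselect (exists a, S a); last first.
    by rewrite xgetPN// => a Sa; apply: nS; exists a.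
  have := xgetI None Sa; case: (xget None S) => //= {Sa}a [aub _] aom eps eps0.
  have := aub eps eps0; rewrite /szlenk_index_at; set T := (X in xget _ X).
  have [[c Tc]|nT] := pselect (exists c, T c); last first.
    by rewrite xgetPN// => c Tc; apply: nT; exists c.
  have := xgetI None Tc; case: (xget None T) => //= _ [b [b0 _] [<-]] ba.
  apply: derived_omega; rewrite -subset0 -b0; apply: szlenk_derivative_anti.
  exact: ole_trans aom.
have ubom eps : 0 < eps -> eole (szlenk_index_at (@dual_ball R E) eps) (Some omega).
  move=> eps0; have [n n0] := fin eps eps0; rewrite /szlenk_index_at.
  set T := (X in xget _ X).
  have [b [b0 bmin]] := @ole_least (fun a =>
    szlenk_derivative eps (@dual_ball R E) a = set0) (iter n Osucc Ozero) n0.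
  have Tb : T (Some b) by exists b.
  have := xgetI None Tb; case: (xget None T) => [c [d [d0 dmin] [<-]]|[]//] /=.
  by apply: ole_trans (dmin _ n0) _; apply: ole_lim; exact: ole_refl.
rewrite /szlenk_index; set S := (X in xget _ X).
have [a [aub amin]] := @ole_least (fun a => forall eps, 0 < eps ->
  eole (szlenk_index_at (@dual_ball R E) eps) (Some a)) omega ubom.
have Sa : S (Some a) by split => // -[b|//] bub; exact: amin.
by have [_] := xgetI None Sa; apply.
Qed.

End Derivation.

(** * From a Szlenk index at most omega to an AUC norm *)

Section Renorming.
Context {R : realType} {X : normedModType R}.
Implicit Types (x y : X) (f g : dual X) (p q : X -> R).

Definition seminorm p : Prop :=
  (forall x y, p (x + y) <= p x + p y) /\ (forall (a : R) x, p (a *: x) = `|a| * p x).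

Lemma seminorm_sublinear p : seminorm p -> sublinear p.
Proof. by move=> [pD pZ]; split => // t x t0; rewrite pZ ger0_norm. Qed.

Lemma seminorm_ge0 p x : seminorm p -> 0 <= p x.
Proof.
move=> sp; have := sublinear_opp x (seminorm_sublinear sp).
by rewrite -scaleN1r sp.2 normrN1 mul1r; lra.
Qed.

Lemma seminorm_functional f : seminorm (fun x => `|f x : R|).
Proof.
split=> [x y|a x]; first by rewrite dualD; exact: ler_normD.
by rewrite dual_funZ normrM.
Qed.

Lemma seminorm_sum (r : seq nat) (P : pred nat) (w : nat -> R) (p : nat -> X -> R) :
  (forall k, 0 <= w k) -> (forall k, seminorm (p k)) ->
  seminorm (fun x => \sum_(k <- r | P k) w k * p k x).
Proof.
move=> w0 sp; split=> [x y|a x].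
  rewrite -big_split; apply: ler_sum => k _ /=.
  by rewrite -mulrDr ler_wpM2l// (sp k).1.
by rewrite mulr_sumr; apply: eq_bigr => k _; rewrite (sp k).2 mulrCA.
Qed.

Section Sup.
Context (I : Type) (A : set I) (p : I -> X -> R) (A0 : A !=set0).
Context (sp : forall i, A i -> seminorm (p i)).
Context (p1 : forall i x, A i -> p i x <= `|x|).

Definition sup_of x : R := sup [set p i x | i in A].

Lemma sup_of_ub i x : A i -> p i x <= sup_of x.
Proof.
move=> Ai; apply: ub_le_sup; last by exists i.
by exists `|x| => _ [j Aj <-]; exact: p1.
Qed.

Lemma sup_of_le x (z : R) : (forall i, A i -> p i x <= z) -> sup_of x <= z.
Proof.
move=> h; apply: ge_sup; last by move=> _ [i Ai <-]; exact: h.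
by case: A0 => i Ai; exists (p i x), i.
Qed.

Lemma sup_of_adherent x (d : R) : 0 < d -> exists2 i, A i & sup_of x - d < p i x.
Proof.
move=> d0; have [|_ [i Ai <-] h] := @sup_adherent R [set p i x | i in A] d d0.
  split; first by case: A0 => i Ai; exists (p i x), i.
  by exists `|x| => _ [j Aj <-]; exact: p1.
by exists i.
Qed.

Lemma sup_of_le_norm x : sup_of x <= `|x|.
Proof. by apply: sup_of_le => i Ai; exact: p1. Qed.

Lemma sup_of_seminorm : seminorm sup_of.
Proof.
split=> [x y|a x].
  apply: sup_of_le => i Ai; apply: le_trans ((sp Ai).1 x y) _.
  by apply: lerD; exact: sup_of_ub.
have le b z : sup_of (b *: z) <= `|b| * sup_of z.
  apply: sup_of_le => i Ai; rewrite (sp Ai).2 ler_wpM2l//; exact: sup_of_ub.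
apply/le_anti; rewrite le/=.
have [->|a0] := eqVneq a 0.
  rewrite normr0 mul0r; have [i Ai] := A0.
  by apply: le_trans (sup_of_ub _ Ai); exact: seminorm_ge0 (sp Ai).
rewrite -ler_pdivlMl ?normr_gt0// -normfV.
by apply: le_trans (le a^-1 (a *: x)); rewrite scalerA mulVf// scale1r.
Qed.

End Sup.

Lemma canonical_bidual x : exists2 phi : dual (dual X),
  (forall f, phi f = f x) & `|phi| <= `|x|.
Proof.
have [phi phiE] := @dual_of R (dual X) (fun f => f x) `|x|
  (fun a f g => erefl)
  (fun f => eq_ind_r (fun z => `|f x : R| <= z) (dual_norm_le f x) (mulrC _ _)).
exists phi => //; apply: dual_norm_bound => // f.
by rewrite phiE mulrC dual_norm_le.
Qed.

Context (X_reflexive : reflexive_space X).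

Section OneScale.
Context (eps : R) (n : nat) (eps0 : 0 < eps) (n0 : (0 < n)%N).
Context (Dn0 : @derived R (dual X) eps n = set0).

Let weight (m : nat) : R := 1 + m%:R / n%:R.
(* A drop of one rank lowers the weight by [1 / n = 8 * sigma]; this pays for adding
   [sigma *: g] and for the oscillation, at most [sigma], of [f] near a point. *)
Let sigma : R := (8 * n%:R)^-1.

Let nR : 0 < n%:R :> R. Proof. by rewrite ltr0n. Qed.

Let sigma0 : 0 < sigma. Proof. by rewrite invr_gt0 mulr_gt0. Qed.

Let sigmaE : n%:R^-1 = 8 * sigma.
Proof. by rewrite /sigma invfM mulrA divff// mul1r. Qed.

Let weight_le m : (m < n)%N -> weight m <= 2 - n%:R^-1.
Proof.
move=> mn; have : m.+1%:R / n%:R <= 1 :> R by rewrite ler_pdivrMr// mul1r ler_nat.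
by rewrite -natr1 mulrDl mul1r /weight; lra.
Qed.

Let weight_ge1 m : 1 <= weight m.
Proof. by rewrite /weight lerDl divr_ge0. Qed.

(** The unit ball of the dual of the new norm: the points of the bidual ball that
    survive more derivations count with a larger weight. *)
Definition admissible : set (dual X) := [set f | forall m phi, (m < n)%N ->
  @derived R (dual X) eps m phi -> weight m * `|phi f : R| <= 1].

Lemma admissible_norm f : admissible f -> `|f| <= 1.
Proof.
move=> af; apply: dual_norm_lub => x x1.
have [phi phiE phix] := canonical_bidual x.
have := af 0%N phi n0 (le_trans phix x1).
by rewrite /weight mul0r addr0 mul1r phiE.
Qed.

Lemma half_admissible f : `|f| <= 1 / 2 -> admissible f.
Proof.
move=> f2 m phi mn /derived_ball phi1.
have : `|phi f : R| <= 1 / 2.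
  apply: le_trans (dual_norm_le _ _) _; apply: le_trans f2.
  by rewrite ler_piMl.
have := weight_le mn; have := weight_ge1 m.
have : 0 < n%:R^-1 :> R by rewrite invr_gt0.
have := normr_ge0 (phi f : R); nra.
Qed.

(** Perturbing an admissible functional by [sigma *: g] costs only a multiple of
    [eps * sigma] when [g] vanishes at suitable finitely many points: near such a point [psi] of
    rank [m], a point either has rank [m] and is [eps]-close to [psi], or has a
    smaller weight. *)
Lemma admissible_perturb f : admissible f -> exists F : seq X,
  forall g, `|g| <= 1 -> (forall x, x \in F -> g x = 0) ->
  admissible ((1 + 2 * eps * sigma)^-1 *: (f + sigma *: g)).
Proof.
move=> af.
pose good (psi : dual (dual X)) (U : set (weak_star (dual X))) := exists m,
  [/\ (m < n)%N, @derived R (dual X) eps m psi,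
   open U /\ U psi /\ (forall phi, U phi -> `|phi f - psi f : R| < sigma),
   (forall phi, U phi -> @derived R (dual X) eps m phi -> `|phi - psi| <= eps) &
   (forall phi m', U phi -> @derived R (dual X) eps m' phi -> (m' <= m)%N)].
have [U UP] : exists U, forall psi, dual_ball psi -> good psi (U psi).
  suff h psi : exists U, dual_ball psi -> good psi U.
    by have [U UP] := choice h; exists U.
  have [psi1|] := pselect (dual_ball psi); last by exists setT.
  have [m [mn Dm DSm]] : exists m, [/\ (m < n)%N, @derived R (dual X) eps m psi &
      ~ @derived R (dual X) eps m.+1 psi].
    apply: contrapT => nm.
    have : forall m, (m <= n)%N -> @derived R (dual X) eps m psi.
      elim=> [//|m IH mn]; apply: contrapT => DSm; apply: nm; exists m.
      by split => //; apply: IH; exact: ltnW.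
    by move=> /(_ n (leqnn n)); rewrite Dn0.
  have [U [oU Upsi dU nU]] := not_szlenk_step Dm DSm.
  have [V [oV Vpsi hV]] := weak_star_basic_open psi [:: f] sigma0.
  exists (U `&` V) => _; exists m; split => //.
  - split; first exact: openI.
    by split => // phi [_ Vphi]; exact: hV (mem_head _ _) Vphi.
  - by move=> phi [Uphi _] Dphi; exact: dU.
  - move=> phi m' [Uphi _] Dphi; rewrite leqNgt; apply/negP => mm'.
    by apply: (nU phi Uphi); exact: (derived_anti mm').
have [||s [sB sP]] := @dual_ball_finite_cover R (dual X) U.
- by move=> phi /UP[m [_ _ []]].
- by move=> phi /UP[m [_ _ [_ []]]].
have [J JE] := choice X_reflexive.
exists (map J s) => g g1 gF m' phi m'n Dphi.
have phi1 := derived_ball Dphi.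
have [psi psis Uphi] := sP phi phi1.
have [m [mn Dm [_ [_ hf]] hd hr]] := UP psi (sB _ psis).
have psig : psi g = 0 by rewrite JE; apply: gF; exact: map_f.
have k0 : 0 < 1 + 2 * eps * sigma by rewrite ltr_pwDl// !mulr_ge0// ltW.
rewrite dual_funZ normrM normfV (gtr0_norm k0) mulrCA ler_pdivrMl// mulr1.
rewrite dualD dual_funZ.
have hn : `|phi f + sigma * phi g : R| <= `|phi f| + sigma * `|phi g|.
  by apply: le_trans (ler_normD _ _) _; rewrite normrM (gtr0_norm sigma0).
apply: le_trans (ler_wpM2l (le_trans ler01 (weight_ge1 m')) hn) _.
have w2 := weight_le m'n; have w1 := weight_ge1 m'; have s0 := sigma0.
have := hr _ _ Uphi Dphi; rewrite leq_eqVlt => /orP[/eqP e|m'm].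
  have phig : `|phi g : R| <= eps.
    rewrite -[phi g]subr0 -psig; apply: le_trans (dual_norm_le (phi - psi) g) _.
    apply: le_trans (ler_wpM2l (normr_ge0 _) g1) _; rewrite mulr1.
    by apply: hd => //; rewrite -e.
  have := af _ _ m'n Dphi; rewrite mulrDr => h1.
  have : weight m' * (sigma * `|phi g : R|) <= 2 * (sigma * eps).
    apply: ler_pM; rewrite ?mulr_ge0 ?(ltW s0) ?(le_trans ler01 w1)//.
      by apply: le_trans w2 _; rewrite gerBl invr_ge0 ltW.
    by rewrite ler_wpM2l// ltW.
  by lra.
have phig : `|phi g : R| <= 1.
  apply: le_trans (dual_norm_le _ _) _; apply: le_trans g1.
  by rewrite ler_piMl.
have pf : `|phi f : R| <= `|psi f| + sigma.
  by have := ler_normD (phi f - psi f : R) (psi f); rewrite subrK; have := hf _ Uphi; lra.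
have wm : weight m' + n%:R^-1 <= weight m.
  rewrite /weight -addrA lerD2l -[X in _ + X]mul1r -mulrDl natr1.
  by rewrite ler_pM2r ?invr_gt0// ler_nat.
have := af _ _ mn Dm; have := weight_le mn.
rewrite sigmaE in w2 wm *.
have : 0 <= `|psi f : R| by [].
have : 0 <= `|phi f : R| by [].
have : 0 <= `|phi g : R| by [].
have es : 0 < eps * sigma by rewrite mulr_gt0.
move: (`|psi f|) (`|phi f|) (`|phi g|) (weight m) (weight m') w1 w2 wm pf phig
   => a b c W w w1 w2 wm pf phig c0 b0 a0 W2 Wa.
apply: (@le_trans _ _ 1); last by lra.
have : w * (b + sigma * c) <= w * (a + 2 * sigma).
  by apply: ler_wpM2l; [lra|nra].
move=> /le_trans; apply.
have s8 : 8 * sigma <= 1 by rewrite -sigmaE invf_le1// ler1n.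
by have [a2|a2] := leP (1 / 2) a; nra.
Qed.

Definition scale_norm : X -> R := sup_of admissible (fun f x => `|f x : R|).

Let admissible0 : admissible !=set0.
Proof. by exists 0; apply: half_admissible; rewrite normr0. Qed.

Let admissible_le f x : admissible f -> `|f x : R| <= `|x|.
Proof.
move=> /admissible_norm f1; apply: le_trans (dual_norm_le _ _) _.
by rewrite ler_piMl.
Qed.

Lemma scale_norm_seminorm : seminorm scale_norm.
Proof. by apply: sup_of_seminorm => // f _; exact: seminorm_functional. Qed.

Lemma scale_norm_le x : scale_norm x <= `|x|.
Proof. exact: sup_of_le_norm. Qed.

Lemma scale_norm_ge x : `|x| / 2 <= scale_norm x.
Proof.
have [f f1 fx] := norming_functional x.
have af : admissible ((1 / 2) *: f).
  apply: half_admissible; rewrite normrZ ger0_norm ?divr_ge0//.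
  by rewrite ler_piMr// divr_ge0.
have := sup_of_ub admissible_le x af.
rewrite [X in `|X|](_ : _ = (1 / 2) * f x)// fx ger0_norm ?mulr_ge0// -/scale_norm.
by lra.
Qed.

(** Along a suitable [Y], some [g] vanishing at [x] and at the finitely many points
    above takes at [y] a third of its norm; [x + y] is tested against the
    perturbation by this [g] of a functional norming [x]. *)
Lemma scale_norm_gain x (d : R) : 0 < d -> exists2 Y, cof Y & forall y, Y y ->
  scale_norm x - d + sigma * `|y| / 3 <= (1 + 2 * eps * sigma) * scale_norm (x + y).
Proof.
move=> d0; have [f1 af1 f1x] := sup_of_adherent admissible0 admissible_le x d0.
have [f af fx] : exists2 f, admissible f & scale_norm x - d < f x.
  have [h|h] := leP 0 (f1 x : R); first by exists f1; rewrite // -(ger0_norm h).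
  exists (- f1); last by move: f1x; rewrite (ltr0_norm h).
  by move=> m phi mn Dphi; rewrite dualN normrN; exact: af1.
have [F FP] := admissible_perturb af.
have [Y0 cY0 Y0P] := cof_away (x :: F).
have [Y [cY YY0 Yf]] := cof_kers [:: f] cY0.
exists Y => // y Yy; have sF := span_subspace (x :: F).
have [g [g1 gF gy]] := dist_functional y sF.
have gy3 : `|y| / 3 <= g y.
  rewrite gy; apply: le_dist_to => // u uF.
  by rewrite ler_pdivrMr// mulrC; apply: Y0P => //; exact: YY0.
have [gx gF0] : g x = 0 /\ forall z, z \in F -> g z = 0.
  by split=> [|z zF]; apply/gF/span_mem; rewrite inE ?eqxx// zF orbT.
have := sup_of_ub admissible_le (x + y) (FP g g1 gF0).
rewrite -/scale_norm; set h := _ *: _.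
have -> : h (x + y) = (1 + 2 * eps * sigma)^-1 * (f (x + y) + sigma * g (x + y)) by [].
have k0 : 0 < 1 + 2 * eps * sigma by rewrite ltr_pwDl// !mulr_ge0// ltW.
rewrite normrM normfV (gtr0_norm k0) ler_pdivrMl// => /(le_trans (ler_norm _)).
rewrite !dualD (Yf f y (mem_head _ _) Yy) gx addr0 add0r; apply: le_trans.
by have := ler_wpM2l (ltW sigma0) gy3; rewrite mulrA; lra.
Qed.

End OneScale.

End Renorming.

Lemma sum_half_powers (R : realType) (K : nat) :
  \sum_(0 <= k < K) (2^-1 : R) ^+ k.+1 = 1 - 2^-1 ^+ K.
Proof.
elim: K => [|K IH]; first by rewrite big_geq// expr0 subrr.
by rewrite big_nat_recr//= IH exprS; lra.
Qed.

(** At scale [eps], a vector [y] increases the norm by the order of [sigma * `|y|], up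
    to the loss [2 * eps * sigma], which is negligible when [eps] is small compared
    with [`|y|].  In a weighted sum over the scales, the one adapted to [t] gains a
    fixed amount, and the other terms do not decrease along the kernel of a
    functional norming their sum at [x]. *)
Lemma AUC_renorming (R : realType) (X : normedModType R) : reflexive_space X ->
  (forall eps : R, 0 < eps -> exists n, @derived R (dual X) eps n = set0) ->
  exists N : X -> R, equivalent_norm N /\ AUC N.
Proof.
move=> rX fin; pose e (k : nat) : R := k.+1%:R^-1.
have e0 k : 0 < e k by rewrite invr_gt0.
have [n nP] : exists n : nat -> nat,
    forall k, (0 < n k)%N /\ @derived R (dual X) (e k) (n k) = set0.
  suff h k : exists n, (0 < n)%N /\ @derived R (dual X) (e k) n = set0.
    by have [n nP] := choice h; exists n.
  have [m m0] := fin (e k) (e0 k); exists m.+1; split => //.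
  by rewrite -subset0 -m0; exact: derived_anti.
pose p k := @scale_norm R X (e k) (n k).
pose w (k : nat) : R := 2^-1 ^+ k.+1.
have w0 k : 0 <= w k by rewrite exprn_ge0.
have sp k : seminorm (p k) by apply: scale_norm_seminorm (nP k).1.
have p1 k x : p k x <= `|x| by apply: scale_norm_le (nP k).1 _.
have sum_le (P : pred nat) K x : \sum_(0 <= k < K | P k) w k * p k x <= `|x|.
  apply: (@le_trans _ _ (\sum_(0 <= k < K) w k * `|x|)).
    rewrite big_mkcond; apply: ler_sum => k _ /=.
    by case: ifP => _; rewrite ?mulr_ge0// ler_wpM2l.
  rewrite -mulr_suml sum_half_powers mulrBl mul1r gerBl mulr_ge0// exprn_ge0//.
pose S (K : nat) x := \sum_(0 <= k < K) w k * p k x.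
have sS K : seminorm (S K) by exact: seminorm_sum.
have S1 K x : setT K -> S K x <= `|x| by move=> _; exact: sum_le.
have T0 : [set: nat] !=set0 by exists 0%N.
pose N := sup_of [set: nat] S.
have sN : seminorm N by apply: sup_of_seminorm.
have N1 x : N x <= `|x| by apply: sup_of_le_norm.
have NS K x : S K x <= N x by apply: (sup_of_ub S1).
have N4 x : `|x| <= 4 * N x.
  have := NS 1%N x; rewrite /S big_nat1 /w expr1.
  have : `|x| / 2 <= p 0%N x by apply: scale_norm_ge (nP 0%N).1 _.
  by lra.
exists N; split.
  split; last by exists 4^-1, 1; split => // x; rewrite mul1r N1 ler_pdivrMl// N4.
  split; [exact: sN.1|exact: sN.2|] => x x0.
  by apply/normr0_eq0/le_anti; rewrite normr_ge0 andbT; have := N4 x; rewrite x0 mulr0.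
move=> t t0; pose k := Num.truncn (48 / t).
have ek : e k * 48 <= t.
  rewrite /e mulrC ler_pdivrMr// mulrC -ler_pdivrMr//; apply/ltW.
  by have /andP[] := truncn_itv (ltW (divr_gt0 (ltr0n _ 48) t0)).
have ek1 : e k <= 1 by rewrite /e invf_le1// ler1n.
pose s : R := (8 * (n k)%:R)^-1.
have s0 : 0 < s by rewrite invr_gt0 mulr_gt0// ltr0n (nP k).1.
have s1 : 8 * s <= 1.
  rewrite /s invfM mulrA divff// mul1r invf_le1 ?ler1n ?ltr0n; exact: (nP k).1.
pose d := s * t / 24; have d0 : 0 < d by rewrite divr_gt0// mulr_gt0.
have wk : 0 < w k by rewrite exprn_gt0.
pose d1 := w k * d / 2; have d10 : 0 < d1 by rewrite divr_gt0// mulr_gt0.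
apply: (@lt_le_trans _ _ d1%:E); first by rewrite lte_fin.
apply: le_ereal_inf_tmp => _ [x Nx1 <-].
have [Y0 cY0 Y0P] := scale_norm_gain rX (e0 k) (nP k).1 (nP k).2 x d0.
(* The truncation depends on [x], but the gain [2 * d1] does not. *)
have [K _ KP] := sup_of_adherent T0 S1 x d10.
pose K' := maxn K k.+1.
have SE z : S K' z = w k * p k z + \sum_(0 <= j < K' | j != k) w j * p j z.
  rewrite /S [LHS](bigD1_seq k) ?iota_uniq//= mem_index_iota /=.
  by rewrite /K' leq_max ltnSn orbT.
have KK' z : S K z <= S K' z.
  rewrite /S (big_cat_nat _ (leq_maxl K k.+1))//= lerDl sumr_ge0// => j _.
  by rewrite mulr_ge0//; exact: seminorm_ge0 (sp j).
pose T z := \sum_(0 <= j < K' | j != k) w j * p j z.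
have [h [h1 hT hx]] := @dominated_functional R X T x
  (seminorm_sublinear (seminorm_sum _ _ w0 sp)) (sum_le _ _).
have [Y [cY YY0 Yh]] := cof_kers [:: h] cY0.
apply: (@le_trans _ _ (ereal_inf [set (N (x + t *: y) - 1)%:E | y in [set y | Y y /\ N y = 1]]));
  last by apply: ereal_sup_ubound; exists Y.
apply: le_ereal_inf_tmp => _ [y [Yy Ny1] <-]; rewrite lee_fin.
have Yty : Y (t *: y) by apply: subspaceZ => //; exact: cof_subspace.
have Tge : T x <= T (x + t *: y).
  by rewrite -hx -[h x]addr0 -(Yh h _ (mem_head _ _) Yty) -dualD hT.
have y1 : 1 <= `|y| by rewrite -Ny1 N1.
have := Y0P _ (YY0 _ Yty); rewrite normrZ gtr0_norm// -/(p k) -/s => gain.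
have x4 : p k x <= 4 by apply: le_trans (p1 k x) _; have := N4 x; rewrite Nx1 mulr1.
have px0 := seminorm_ge0 x (sp k).
have gain2 : p k x + d <= p k (x + t *: y).
  rewrite leNgt; apply/negP => lt.
  have ty : t <= t * `|y| by rewrite ler_peMr// ltW.
  have st : s * t <= s * (t * `|y|) by rewrite ler_wpM2l// ltW.
  have es : 2 * e k * s <= 1 / 4.
    by have := ler_pM (ltW (e0 k)) (mulr_ge0 (ler0n _ 8) (ltW s0)) ek1 s1; lra.
  have es0 : 0 < e k * s by rewrite mulr_gt0.
  have : (1 + 2 * e k * s) * p k (x + t *: y) <= (1 + 2 * e k * s) * (p k x + d).
    by apply: ler_wpM2l; [lra|exact: ltW].
  have : (2 * e k * s) * p k x <= (2 * e k * s) * 4 by apply: ler_wpM2l; [lra|].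
  have : e k * 48 * s <= t * s by rewrite ler_wpM2r// ltW.
  have : (2 * e k * s) * d <= 1 / 4 * d by rewrite ler_wpM2r// ltW.
  have : d = s * t / 24 by [].
  by lra.
have := NS K' (x + t *: y); rewrite SE -/(T _).
have := KK' x; rewrite SE -/(T x).
have := ler_wpM2l (w0 k) gain2; rewrite -/N Nx1 in KP *.
by rewrite /d1 in KP *; lra.
Qed.

(** * Graded graphs and bundle graphs *)

Section Walks.
Context {G : tbgraph}.
Implicit Types x y z : G.

Lemma walk_cat n m x y z : walk n x y -> walk m y z -> walk (n + m) x z.
Proof.
elim: n x => [|n IH] x /=; first by move=> ->.
by move=> [u xu uy] yz; exists u => //; exact: IH.
Qed.

Lemma walk1 x y : adj x y -> walk 1 x y.
Proof. by move=> xy; exists y. Qed.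

Lemma walk_rev n x y : walk n x y -> walk n y x.
Proof.
elim: n x => [|n IH] x /=; first by move=> ->.
move=> [u xu uy]; rewrite -/(walk n.+1 y x) -addn1.
by apply: walk_cat (IH _ uy) (walk1 (adj_sym xu)).
Qed.

Lemma walk_map (H : tbgraph) (phi : G -> H) n x y :
  (forall u v, adj u v -> adj (phi u) (phi v)) ->
  walk n x y -> walk n (phi x) (phi y).
Proof.
move=> hphi; elim: n x => [|n IH] x /=; first by move=> ->.
by move=> [u xu uy]; exists (phi u); [exact: hphi|exact: IH].
Qed.

Lemma walk_lipschitz (psi : G -> nat) n x y :
  (forall u v, adj u v -> (psi u <= (psi v).+1)%N) ->
  walk n x y -> (psi x <= psi y + n)%N.
Proof.
move=> lip; elim: n x => [|n IH] x /=; first by move=> ->; rewrite addn0.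
by move=> [u xu uy]; have := lip _ _ xu; have := IH _ uy; lia.
Qed.

Lemma gdistP n x y : walk n x y -> walk (gdist x y) x y /\ (gdist x y <= n)%N.
Proof.
move=> xy; rewrite /gdist; set S := (X in xget _ X).
have ex : exists n, `[< walk n x y >] by exists n; apply/asboolP.
have Sm : S (ex_minn ex).
  case: ex_minnP => m /asboolP xym mmin; split => // k xyk.
  by apply: mmin; apply/asboolP.
by have [w wmin] := xgetI 0%N Sm; split => //; exact: wmin.
Qed.

End Walks.

(** Bundle graphs are graded by the distance to the bottom, and every vertex lies on
    a monotone walk from the bottom to the top. *)
Definition graded (G : tbgraph) (h : nat) (lev : G -> nat) : Prop :=
  [/\ lev bot = 0%N, lev top = h,
      forall u v : G, adj u v -> lev v = (lev u).+1 \/ lev u = (lev v).+1,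
      forall v : G, walk (lev v) bot v &
      forall v : G, (lev v <= h)%N /\ walk (h - lev v) v top].

Section Graded.
Context {G : tbgraph} {h : nat} {lev : G -> nat} (gr : graded h lev).

Lemma graded_lipschitz (u v : G) : adj u v -> (lev u <= (lev v).+1)%N.
Proof. by case: gr => _ _ adjP _ _ /adjP; lia. Qed.

Lemma graded_gdist v : gdist bot v = lev v.
Proof.
case: (gr) => l0 _ _ up _; have [w le] := gdistP (up v).
apply/eqP; rewrite eqn_leq le /=.
have := walk_lipschitz graded_lipschitz (walk_rev w); rewrite l0; lia.
Qed.

Lemma graded_connected (u v : G) : exists n, walk n u v.
Proof.
case: (gr) => _ _ _ up _.
by exists (lev u + lev v)%N; apply: walk_cat (walk_rev (up u)) (up v).
Qed.

Lemma graded_height : h = gdist (bot : G) top.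
Proof. by rewrite graded_gdist; case: gr => _ ->. Qed.

Lemma graded_height_gt0 : (0 < h)%N.
Proof.
case: (gr) => l0 <- _ up _; rewrite lt0n; apply/negP => /eqP t0.
by have := up top; rewrite t0 /= => /bot_neq_top.
Qed.

End Graded.

Definition edge_like (G : tbgraph) : Prop :=
  (forall v : G, v = bot \/ v = top) /\ adj (bot : G) top.

Lemma graded_edge_like (G : tbgraph) h (lev : G -> nat) :
  graded h lev -> adj (bot : G) top -> edge_like G.
Proof.
move=> [l0 lt adjP up down] bt; split => // v.
have h1 : h = 1%N by have := adjP _ _ bt; rewrite l0 lt; lia.
have [lev1 dv] := down v; have := up v.
have [->|e] : lev v = 0%N \/ lev v = 1%N by lia.
  by move=> /= ->; left.
by move: dv; rewrite h1 e subnn /= => ->; right.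
Qed.

(** Series and parallel compositions described by maps from the parts instead of by a
    construction of the vertices; the description is invariant under isomorphism and
    passes from [G] to [oslash G K]. *)
Record series_cover (G G1 G2 : tbgraph) (i1 : G1 -> G) (i2 : G2 -> G) : Prop :=
  SeriesCover {
    series_inj1 : injective i1 ;
    series_inj2 : injective i2 ;
    series_bot : i1 bot = bot ;
    series_top : i2 top = top ;
    series_cut : i1 top = i2 bot ;
    series_meet : forall u v, i1 u = i2 v -> u = top /\ v = bot ;
    series_surj : forall x, (exists u, i1 u = x) \/ (exists v, i2 v = x) ;
    series_adj1 : forall u v, adj u v -> adj (i1 u) (i1 v) ;
    series_adj2 : forall u v, adj u v -> adj (i2 u) (i2 v) ;
    series_adjP : forall x y, adj x y ->
      (exists u v, [/\ adj u v, i1 u = x & i1 v = y]) \/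
      (exists u v, [/\ adj u v, i2 u = x & i2 v = y]) }.

Record par_cover (G G1 : tbgraph) (c : nat -> G1 -> G) : Prop := ParCover {
    par_inj : forall i, injective (c i) ;
    par_bot : forall i, c i bot = bot ;
    par_top : forall i, c i top = top ;
    par_meet : forall i j u v, i <> j -> c i u = c j v ->
      u = bot /\ v = bot \/ u = top /\ v = top ;
    par_surj : forall x, exists i u, c i u = x ;
    par_adj : forall i u v, adj u v -> adj (c i u) (c i v) ;
    par_adjP : forall x y, adj x y ->
      exists i u v, [/\ adj u v, c i u = x & c i v = y] }.

Lemma par_cover_par (G1 : tbgraph) : @par_cover (par G1) G1 (@par_copy G1).
Proof.
have copy_bot i : par_copy i (bot : G1) = inl false.
  by rewrite /par_copy /Defs.glue; case: (pselect (bot = bot :> G1)).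
have copy_top i : par_copy i (top : G1) = inl true.
  rewrite /par_copy /Defs.glue.
  case: (pselect (top = bot :> G1)) => [/esym/bot_neq_top//|nt].
  by case: (pselect (top = top :> G1)).
split => //.
- by move=> i; apply: glue_inj => // u v [].
- move=> i j u v ij; rewrite /par_copy /Defs.glue.
  case: (pselect (u = bot)) => [->|nu]; case: (pselect (v = bot)) => [->|nv].
  + by left.
  + by case: (pselect (v = top)).
  + by case: (pselect (u = top)).
  case: (pselect (u = top)) => [->|tu]; case: (pselect (v = top)) => [->|tv] //.
    by right.
  by move=> [].
- move=> [[]|[i [v [nb nt]]]].
  + by exists 0%N, top.
  + by exists 0%N, bot.
  exists i, v; rewrite /par_copy /Defs.glue; case: (pselect (v = bot)) => // nb'.
  by case: (pselect (v = top)) => // nt'; congr (inr (_, _)); exact: eq_exist.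
- by move=> i u v uv; exists i, u, v.
Qed.

Section Covers.
Context (G G1 G2 : tbgraph).

Lemma series_cover_series :
  @series_cover (Defs.series G1 G2) G1 G2 (@series_lower G1 G2 tt) (@series_upper G1 G2 tt).
Proof.
split => //.
- by move=> u v [].
- move=> u v; rewrite /series_upper.
  by case: pselect => [->|nu]; case: pselect => [->|nv]// [].
- rewrite /series_upper; case: pselect => [/esym/bot_neq_top//|nt].
  by congr inr; exact: eq_exist.
- by rewrite /series_upper; case: pselect.
- by move=> u v; rewrite /series_upper; case: pselect => // -> [].
- move=> [u|[v nv]]; first by left; exists u.
  right; exists v; rewrite /series_upper; case: pselect => // nv'.
  by congr inr; exact: eq_exist.
- by move=> u v uv; left; exists tt, u, v.
- by move=> u v uv; right; exists tt, u, v.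
- by move=> x y [[[] [u [v [uv <- <-]]]]|[[] [u [v [uv <- <-]]]]];
    [left|right]; exists u, v.
Qed.

Lemma series_cover_iso (G' : tbgraph) (i1 : G1 -> G) (i2 : G2 -> G) (phi : G -> G') :
  bijective phi -> (forall x y, adj (phi x) (phi y) <-> adj x y) ->
  phi bot = bot -> phi top = top ->
  series_cover i1 i2 -> series_cover (phi \o i1) (phi \o i2).
Proof.
move=> bij adjP pb pt [j1 j2 b t c m s a1 a2 aP].
have pinj := bij_inj bij; have [psi psiK phiK] := bij.
split => /=.
- exact: inj_comp.
- exact: inj_comp.
- by rewrite b.
- by rewrite t.
- by rewrite c.
- by move=> u v /pinj; exact: m.
- move=> x; have [[u e]|[v e]] := s (psi x).
    by left; exists u; rewrite e phiK.
  by right; exists v; rewrite e phiK.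
- by move=> u v /a1/adjP.
- by move=> u v /a2/adjP.
- move=> x y; rewrite -{1}(phiK x) -{1}(phiK y) => /adjP/aP.
  by case=> [[u [v [uv eu ev]]]|[u [v [uv eu ev]]]]; [left|right];
    exists u, v; rewrite eu ev !phiK.
Qed.

Lemma par_cover_iso (G' : tbgraph) (c : nat -> G1 -> G) (phi : G -> G') :
  bijective phi -> (forall x y, adj (phi x) (phi y) <-> adj x y) ->
  phi bot = bot -> phi top = top ->
  par_cover c -> par_cover (fun i => phi \o c i).
Proof.
move=> bij adjP pb pt [j b t m s a aP].
have pinj := bij_inj bij; have [psi psiK phiK] := bij.
split => /=.
- by move=> i; exact: inj_comp.
- by move=> i; rewrite b.
- by move=> i; rewrite t.
- by move=> i k u v ik /pinj; exact: m.
- by move=> x; have [i [u e]] := s (psi x); exists i, u; rewrite e phiK.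
- by move=> i u v /a/adjP.
- move=> x y; rewrite -{1}(phiK x) -{1}(phiK y) => /adjP/aP[i [u [v [uv eu ev]]]].
  by exists i, u, v; rewrite eu ev !phiK.
Qed.

End Covers.

Lemma edge_like_iso (G : tbgraph) : edge_like G <-> tbgraph_iso G path1.
Proof.
split=> [[bt adjbt]|[phi bij [adjP pb pt]]].
  have ntop : `[< bot = top :> G >] = false.
    by apply/asboolP; exact: bot_neq_top.
  have ttop : `[< top = top :> G >] = true by apply/asboolP.
  exists (fun v => `[< v = top >]).
    exists (fun b : bool => if b then top else bot).
      by move=> v; case: (bt v) => ->; rewrite ?ntop ?ttop.
    by case; rewrite ?ntop ?ttop.
  split=> [x y||]; last 2 first.
  - exact: ntop.
  - exact: ttop.
  split.
    case: (bt x) => ->; case: (bt y) => ->; rewrite ?ntop ?ttop //= => _ //.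
    exact: adj_sym.
  move=> xy /= e; case: (bt x) => ex; case: (bt y) => ey; subst x y.
  - exact: adj_irr xy.
  - by rewrite ntop ttop in e.
  - by rewrite ntop ttop in e.
  - exact: adj_irr xy.
have pinj := bij_inj bij; split=> [v|].
  by case e : (phi v); [right|left]; apply: pinj; rewrite e ?pb ?pt.
by apply/adjP; rewrite pb pt.
Qed.

Lemma tbgraph_iso_refl (G : tbgraph) : tbgraph_iso G G.
Proof. by exists id => //; exists id. Qed.

Lemma tbgraph_iso_trans (G H K : tbgraph) :
  tbgraph_iso G H -> tbgraph_iso H K -> tbgraph_iso G K.
Proof.
move=> [phi bphi [ap pb pt]] [psi bpsi [aq qb qt]].
exists (psi \o phi); first exact: bij_comp.
by split => [x y||] /=; rewrite ?pb ?pt//; split=> [/aq/ap|/ap/aq].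
Qed.

(** Covers absorb the isomorphisms, so that an induction never has to transport its
    conclusion. *)
Lemma formed_cover_ind (P : bool -> tbgraph -> Prop) :
  (forall G, edge_like G -> P false G) ->
  (forall b c (G G1 G2 : tbgraph) (i1 : G1 -> G) (i2 : G2 -> G), series_cover i1 i2 ->
     P b G1 -> P c G2 -> P (b || c) G) ->
  (forall b (G G1 : tbgraph) (c : nat -> G1 -> G), par_cover c -> edge_like G1 ->
     P b G1 -> P b G) ->
  (forall b (G G1 : tbgraph) (c : nat -> G1 -> G), par_cover c -> ~ edge_like G1 ->
     P b G1 -> P true G) ->
  forall b G, formed b G -> P b G.
Proof.
move=> Pedge Pseries Ppare Ppar b G fG.
suff h : forall G', tbgraph_iso G G' -> P b G' by exact: h (tbgraph_iso_refl G).
elim: {b G} fG => [|b c G H _ IHG _ IHH|b G _ IH eG|b G _ IH eG|b G H _ IH GH] G'.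
- move=> [phi [psi psiK phiK] [adjP pb pt]]; apply: Pedge; split=> [v|].
    rewrite -(phiK v) -pb -pt; by case: (psi v); [right|left].
  by rewrite -pb -pt; apply/adjP.
- move=> [phi bij [adjP pb pt]].
  apply: Pseries _ _ _ _ _ _ _ (series_cover_iso bij adjP pb pt (series_cover_series G H)) _ _.
    exact: IHG (tbgraph_iso_refl G).
  exact: IHH (tbgraph_iso_refl H).
- move=> [phi bij [adjP pb pt]].
  apply: Ppare _ _ _ _ (par_cover_iso bij adjP pb pt (par_cover_par G)) _ _.
    exact/edge_like_iso.
  exact: IH (tbgraph_iso_refl G).
- move=> [phi bij [adjP pb pt]].
  apply: Ppar _ _ _ _ (par_cover_iso bij adjP pb pt (par_cover_par G)) _ _.
    by move/edge_like_iso.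
  exact: IH (tbgraph_iso_refl G).
- by move=> /(tbgraph_iso_trans GH); exact: IH.
Qed.

Lemma series_glue (G G1 G2 : tbgraph) (i1 : G1 -> G) (i2 : G2 -> G) C
    (a : G1 -> C) (b : G2 -> C) : series_cover i1 i2 -> a top = b bot ->
  exists f : G -> C, (forall u, f (i1 u) = a u) /\ (forall v, f (i2 v) = b v).
Proof.
move=> sc ab.
have [f fP] : exists f : G -> C, forall x,
    (forall u, i1 u = x -> f x = a u) /\ (forall v, i2 v = x -> f x = b v).
  suff h x : exists z, (forall u, i1 u = x -> z = a u) /\ (forall v, i2 v = x -> z = b v).
    by exists (fun x => sval (cid (h x))) => x; case: cid.
  have [[u <-]|[v <-]] := series_surj sc x.
    exists (a u); split=> [u' /(series_inj1 sc) -> //|v /esym/(series_meet sc)].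
    by move=> [-> ->].
  exists (b v); split=> [u /(series_meet sc)[-> ->]//|v' /(series_inj2 sc) -> //].
by exists f; split=> [u|v]; [apply: (fP _).1|apply: (fP _).2].
Qed.

Lemma par_glue (G G1 : tbgraph) (c : nat -> G1 -> G) C (a : nat -> G1 -> C) :
  par_cover c -> (forall i j, a i bot = a j bot /\ a i top = a j top) ->
  exists f : G -> C, forall i u, f (c i u) = a i u.
Proof.
move=> pc aP.
have [f fP] : exists f : G -> C, forall x i u, c i u = x -> f x = a i u.
  suff h x : exists z, forall i u, c i u = x -> z = a i u.
    by exists (fun x => sval (cid (h x))) => x; case: cid.
  have [i [u <-]] := par_surj pc x; exists (a i u) => j v /esym.
  have [<-/(par_inj pc) ->//|/eqP ij] := eqVneq i j.
  by move=> /(par_meet pc ij)[[-> ->]|[-> ->]]; case: (aP i j).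
by exists f => i u; exact: fP.
Qed.

(** * Coordinates on bundle graphs *)

Definition absdiff (m n : nat) : nat := ((m - n) + (n - m))%N.

Definition supported (f : seq nat -> nat) (beta : seq nat) : Prop :=
  forall s, f s <> 0%N -> prefix s beta.

(** Coordinates of the vertices of a bundle graph, indexed by the nodes of the tree
    of finite sequences of naturals.  A node names a copy inside nested parallel
    compositions, and the coordinate at this node is the distance to the nearer
    end of that copy. *)
Record coordinates (G : tbgraph) (h : nat) (lev : G -> nat)
    (tau : G -> seq nat -> nat) (d : nat) : Prop := Coordinates {
  coord_graded : graded h lev ;
  coord_bot : forall s, tau bot s = 0%N ;
  coord_top : forall s, tau top s = 0%N ;
  coord_root : forall v, tau v [::] = 0%N ;
  coord_branch : forall u v, adj u v \/ u = v -> exists beta,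
    [/\ (size beta <= d)%N, supported (tau u) beta & supported (tau v) beta] ;
  coord_lipschitz : forall u v s, adj u v -> (tau u s <= (tau v s).+1)%N ;
  coord_walk : forall u v, exists n s, walk n u v /\
    (n <= 2 * absdiff (tau u s) (tau v s) + absdiff (lev u) (lev v))%N }.

Definition coded (G : tbgraph) (h : nat) : Prop :=
  exists lev tau d, @coordinates G h lev tau d.

Lemma coded_graded (G : tbgraph) h : coded G h -> exists lev : G -> nat, graded h lev.
Proof. by move=> [lev [tau [d [gr _ _ _ _ _ _]]]]; exists lev. Qed.

Lemma coded_edge (G : tbgraph) : edge_like G -> coded G 1.
Proof.
move=> [bt adjbt]; pose lev (v : G) : nat := if `[< v = bot >] then 0%N else 1%N.
have lb : lev bot = 0%N by rewrite /lev asboolT.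
have lt : lev top = 1%N by rewrite /lev asboolF// => /esym/bot_neq_top.
exists lev, (fun _ _ => 0%N), 0%N; split => //.
- split => //.
  + by move=> u v; case: (bt u) => ->; case: (bt v) => -> /[dup] uv;
      rewrite ?lb ?lt; first [by move=> /adj_irr|by left|by right].
  + move=> v; case: (bt v) => ->; rewrite ?lb ?lt//; exact: walk1.
  + move=> v; case: (bt v) => ->; rewrite ?lb ?lt; split=> //; exact: walk1.
- by move=> u v _; exists [::]; split.
- move=> u v; case: (bt u) => ->; case: (bt v) => ->.
  + by exists 0%N, [::].
  + by exists 1%N, [::]; rewrite lb lt; split; [exact: walk1|].
  + by exists 1%N, [::]; rewrite lb lt; split; [exact/walk1/adj_sym|].
  + by exists 0%N, [::].
Qed.

Lemma graded_series (G G1 G2 : tbgraph) (i1 : G1 -> G) (i2 : G2 -> G) h1 lev1 h2 lev2 :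
  series_cover i1 i2 -> graded h1 lev1 -> graded h2 lev2 ->
  exists lev : G -> nat, [/\ graded (h1 + h2) lev, forall u, lev (i1 u) = lev1 u,
    forall v, lev (i2 v) = (h1 + lev2 v)%N &
    forall u v, walk ((h1 - lev1 u) + lev2 v) (i1 u) (i2 v)].
Proof.
move=> sc [lb1 lt1 adj1 up1 dn1] [lb2 lt2 adj2 up2 dn2].
have [|lev [levE1 levE2]] := @series_glue _ _ _ _ _ nat lev1 (fun v => (h1 + lev2 v)%N) sc.
  by rewrite lt1 lb2 addn0.
have mix u v : walk ((h1 - lev1 u) + lev2 v) (i1 u) (i2 v).
  apply: walk_cat (walk_map (series_adj1 sc) (dn1 u).2) _.
  by rewrite (series_cut sc); exact: walk_map (series_adj2 sc) (up2 v).
exists lev; split => //; split.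
- by rewrite -(series_bot sc) levE1.
- by rewrite -(series_top sc) levE2 lt2.
- move=> x y /(series_adjP sc)[[u [v [uv <- <-]]]|[u [v [uv <- <-]]]].
    by rewrite !levE1; exact: adj1.
  by rewrite !levE2; have := adj2 _ _ uv; lia.
- move=> x; have [[u <-]|[v <-]] := series_surj sc x.
    by rewrite levE1 -(series_bot sc); exact: walk_map (series_adj1 sc) (up1 u).
  rewrite levE2 -(series_bot sc); have := mix bot v; by rewrite lb1 subn0.
- move=> x; have [[u <-]|[v <-]] := series_surj sc x.
    rewrite levE1 -(series_top sc); have [le1 _] := dn1 u.
    split; first exact: leq_trans le1 (leq_addr _ _).
    by have := mix u top; rewrite lt2 addnBAC.
  rewrite levE2 subnDl leq_add2l -(series_top sc); have [le2 w2] := dn2 v.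
  by split => //; exact: walk_map (series_adj2 sc) w2.
Qed.

Lemma graded_par (G G1 : tbgraph) (c : nat -> G1 -> G) h lev1 :
  par_cover c -> graded h lev1 ->
  exists lev : G -> nat, graded h lev /\ forall i u, lev (c i u) = lev1 u.
Proof.
move=> pc [lb1 lt1 adj1 up1 dn1].
have [|lev levE] := @par_glue _ _ _ nat (fun=> lev1) pc; first by [].
exists lev; split => //; split.
- by rewrite -(par_bot pc 0) levE.
- by rewrite -(par_top pc 0) levE.
- by move=> x y /(par_adjP pc)[i [u [v [uv <- <-]]]]; rewrite !levE; exact: adj1.
- move=> x; have [i [u <-]] := par_surj pc x.
  by rewrite levE -(par_bot pc i); exact: walk_map (@par_adj _ _ _ pc i) (up1 u).
- move=> x; have [i [u <-]] := par_surj pc x.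
  rewrite levE -(par_top pc i); split; first exact: (dn1 u).1.
  exact: walk_map (@par_adj _ _ _ pc i) (dn1 u).2.
Qed.

(** Points of different parts are joined by a monotone walk through the cut vertex, so
    their levels alone give their distance; both parts can use the same nodes. *)
Lemma coded_series (G G1 G2 : tbgraph) (i1 : G1 -> G) (i2 : G2 -> G) h1 h2 :
  series_cover i1 i2 -> coded G1 h1 -> coded G2 h2 -> coded G (h1 + h2).
Proof.
move=> sc [lev1 [tau1 [d1 [gr1 tb1 tt1 tr1 br1 li1 wa1]]]].
move=> [lev2 [tau2 [d2 [gr2 tb2 tt2 tr2 br2 li2 wa2]]]].
case: (gr1) (gr2) => [lb1 lt1 adj1 up1 dn1] [lb2 lt2 adj2 up2 dn2].
have [lev [gr levE1 levE2 mix]] := graded_series sc gr1 gr2.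
have [|tau [tauE1 tauE2]] := @series_glue _ _ _ _ _ _ tau1 tau2 sc.
  by apply/funext => s; rewrite tt1 tb2.
exists lev, tau, (maxn d1 d2); split => //.
- by move=> s; rewrite -(series_bot sc) tauE1.
- by move=> s; rewrite -(series_top sc) tauE2.
- by move=> x; have [[u <-]|[v <-]] := series_surj sc x; rewrite ?tauE1 ?tauE2.
- have br x y : (exists u v, [/\ adj u v \/ u = v, i1 u = x & i1 v = y]) \/
      (exists u v, [/\ adj u v \/ u = v, i2 u = x & i2 v = y]) -> exists beta,
      [/\ (size beta <= maxn d1 d2)%N, supported (tau x) beta & supported (tau y) beta].
    case=> [[u [v [uv <- <-]]]|[u [v [uv <- <-]]]].
      have [beta [sb bu bv]] := br1 _ _ uv; exists beta.
      by rewrite !tauE1; split => //; rewrite leq_max sb.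
    have [beta [sb bu bv]] := br2 _ _ uv; exists beta.
    by rewrite !tauE2; split => //; rewrite leq_max sb orbT.
  move=> x y [/(series_adjP sc)[[u [v [uv ? ?]]]|[u [v [uv ? ?]]]]|<-]; apply: br.
  + by left; exists u, v; split => //; left.
  + by right; exists u, v; split => //; left.
  + have [[u ?]|[v ?]] := series_surj sc x.
      by left; exists u, u; split => //; right.
    by right; exists v, v; split => //; right.
- move=> x y s /(series_adjP sc)[[u [v [uv <- <-]]]|[u [v [uv <- <-]]]].
    by rewrite !tauE1; exact: li1.
  by rewrite !tauE2; exact: li2.
- move=> x y; have [[u <-]|[u <-]] := series_surj sc x;
    have [[v <-]|[v <-]] := series_surj sc y.
  + have [n [s [w le]]] := wa1 u v; exists n, s; rewrite !levE1 !tauE1.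
    by split=> //; exact: walk_map (series_adj1 sc) w.
  + exists ((h1 - lev1 u) + lev2 v)%N, [::]; split; first exact: mix.
    by rewrite levE1 levE2 /absdiff; have := (dn1 u).1; lia.
  + exists ((h1 - lev1 v) + lev2 u)%N, [::]; split; first exact/walk_rev/mix.
    by rewrite levE1 levE2 /absdiff; have := (dn1 v).1; lia.
  + have [n [s [w le]]] := wa2 u v; exists n, s; rewrite !levE2 !tauE2.
    rewrite {2}/absdiff !subnDl; split=> //; exact: walk_map (series_adj2 sc) w.
Qed.

(** Two points of different copies are joined through the nearer end, so that the new
    coordinate of one of them, together with the levels, bounds their distance. *)
Lemma coded_par (G G1 : tbgraph) (c : nat -> G1 -> G) h :
  par_cover c -> coded G1 h -> coded G h.
Proof.
move=> pc [lev1 [tau1 [d1 [gr1 tb1 tt1 tr1 br1 li1 wa1]]]].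
case: (gr1) => [lb1 lt1 adj1 up1 dn1].
pose tent u := minn (lev1 u) (h - lev1 u).
pose nt (i : nat) (u : G1) (s : seq nat) : nat := if s is j :: s' then
  if j == i then (if s' == [::] then tent u else tau1 u s') else 0%N else 0%N.
have tentb : tent bot = 0%N by rewrite /tent lb1 min0n.
have tentt : tent top = 0%N by rewrite /tent lt1 subnn minn0.
have ntb i s : nt i bot s = 0%N.
  by case: s => [//|j s] /=; case: eqP => // _; case: eqP => // _.
have ntt i s : nt i top s = 0%N.
  by case: s => [//|j s] /=; case: eqP => // _; case: eqP => // _.
have [lev [gr levE]] := graded_par pc gr1.
have [|tau tauE] := @par_glue _ _ _ _ nt pc.
  by move=> i j; split; apply/funext => s; rewrite ?ntb ?ntt.
exists lev, tau, d1.+1; split => //.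
- by move=> s; rewrite -(par_bot pc 0) tauE.
- by move=> s; rewrite -(par_top pc 0) tauE.
- by move=> x; have [i [u <-]] := par_surj pc x; rewrite tauE.
- move=> x y xy.
  have [i [u [v [uv <- <-]]]] : exists i u v, [/\ adj u v \/ u = v, c i u = x & c i v = y].
    case: xy => [/(par_adjP pc)[i [u [v [uv ? ?]]]]|<-].
      by exists i, u, v; split => //; left.
    by have [i [u ?]] := par_surj pc x; exists i, u, u; split => //; right.
  have [beta [sb bu bv]] := br1 _ _ uv; exists (i :: beta).
  have sup w : supported (tau1 w) beta -> supported (tau (c i w)) (i :: beta).
    move=> bw [//|j s]; rewrite tauE /=; case: eqP => // _ /=.
    by case: eqP => [->|_ /bw]; rewrite ?prefix0s.
  by split => //; exact: sup.
- move=> x y s /(par_adjP pc)[i [u [v [uv <- <-]]]]; rewrite !tauE.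
  case: s => [//|j s] /=; case: eqP => // _; case: eqP => // _; last exact: li1.
  by rewrite /tent; have := adj1 _ _ uv; have := (dn1 u).1; have := (dn1 v).1; lia.
- move=> x y; have [i [u <-]] := par_surj pc x; have [j [v <-]] := par_surj pc y.
  have [e|/eqP ij] := eqVneq i j.
    subst j; have [n [s [w le]]] := wa1 u v.
    have wm := walk_map (@par_adj _ _ _ pc i) w.
    have [s0|s0] := eqVneq s [::].
      by exists n, [::]; split => //; rewrite !levE !tauE; move: le; rewrite s0 !tr1.
    exists n, (i :: s); split => //; rewrite !levE !tauE /= eqxx.
    by rewrite (negbTE s0).
  have t1 : tau (c i u) [:: i] = tent u by rewrite tauE /= eqxx.
  have t2 : tau (c j v) [:: i] = 0%N by rewrite tauE /=; case: eqP.
  have lu := (dn1 u).1; have lv := (dn1 v).1.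
  have [le|lt] := leqP (lev1 u) (h - lev1 u).
    exists (lev1 u + lev1 v)%N, [:: i]; split; last first.
      by rewrite t1 t2 !levE /tent /absdiff; lia.
    apply: walk_cat (walk_rev (walk_map (@par_adj _ _ _ pc i) (up1 u))) _.
    by rewrite (par_bot pc) -(par_bot pc j); exact: walk_map (@par_adj _ _ _ pc j) (up1 v).
  exists ((h - lev1 u) + (h - lev1 v))%N, [:: i]; split; last first.
    by rewrite t1 t2 !levE /tent /absdiff; lia.
  apply: walk_cat (walk_map (@par_adj _ _ _ pc i) (dn1 u).2) _.
  rewrite (par_top pc) -(par_top pc j); apply: walk_rev.
  exact: walk_map (@par_adj _ _ _ pc j) (dn1 v).2.
Qed.

Lemma coded_image (G K : tbgraph) (phi : K -> G) k : injective phi ->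
  (forall x, exists u, phi u = x) -> phi bot = bot -> phi top = top ->
  (forall u v, adj u v -> adj (phi u) (phi v)) ->
  (forall x y, adj x y -> exists u v, [/\ adj u v, phi u = x & phi v = y]) ->
  coded K k -> coded G k.
Proof.
move=> inj surj pb pt ad adP [lev [tau [d [gr tb tt tr br li wa]]]].
case: (gr) => [lb lt adjl up dn].
have [psi psiK] : exists psi : G -> K, forall u, psi (phi u) = u.
  exists (fun x => sval (cid (surj x))) => u; apply: inj.
  by case: (cid (surj (phi u))).
exists (lev \o psi), (tau \o psi), d; split => /=.
- split => /=.
  + by rewrite -pb psiK.
  + by rewrite -pt psiK.
  + by move=> x y /adP[u [v [uv <- <-]]]; rewrite !psiK; exact: adjl.
  + by move=> x; have [u <-] := surj x; rewrite psiK -pb; exact: walk_map ad (up u).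
  + move=> x; have [u <-] := surj x; rewrite psiK -pt; split; first exact: (dn u).1.
    exact: walk_map ad (dn u).2.
- by rewrite -pb psiK.
- by rewrite -pt psiK.
- by move=> x; exact: tr.
- move=> x y [/adP[u [v [uv <- <-]]]|<-]; rewrite ?psiK; apply: br; first by left.
  by right.
- by move=> x y s /adP[u [v [uv <- <-]]]; rewrite !psiK; exact: li.
- move=> x y; have [u <-] := surj x; have [v <-] := surj y.
  have [n [s [w le]]] := wa u v; exists n, s; rewrite !psiK; split => //.
  exact: walk_map ad w.
Qed.

Section OslashMaps.
Context (K : tbgraph).

Lemma arc_inj (G : tbgraph) (e f : Defs.arc G) : sval e = sval f -> e = f.
Proof. by case: e f => [e ep] [f fp] /= ef; exact: eq_exist. Qed.

Lemma oslash_copy_inner (G : tbgraph) (e : Defs.arc G) (w : Defs.interior K) :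
  oslash_copy e (sval w) = inr (e, w).
Proof.
case: w => w [nb nt] /=; rewrite /oslash_copy /Defs.glue.
case: (pselect (w = bot)) => // nb'; case: (pselect (w = top)) => // nt'.
by congr (inr (_, _)); exact: eq_exist.
Qed.

Lemma oslash_copy_bot (G : tbgraph) (e : Defs.arc G) :
  oslash_copy e (bot : K) = inl (sval e).1.
Proof. by rewrite /oslash_copy /Defs.glue; case: (pselect (bot = bot :> K)). Qed.

Lemma oslash_copy_top (G : tbgraph) (e : Defs.arc G) :
  oslash_copy e (top : K) = inl (sval e).2.
Proof.
rewrite /oslash_copy /Defs.glue.
case: (pselect (top = bot :> K)) => [/esym/bot_neq_top//|nt].
by case: (pselect (top = top :> K)).
Qed.

Lemma oslash_copy_inj (G : tbgraph) (e : Defs.arc G) : injective (@oslash_copy G K e).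
Proof.
apply: glue_inj => //=; last by move=> u v [].
by move=> [] h; have := (svalP e).1; rewrite h => /adj_irr.
Qed.

Lemma interiorP (v : K) : v <> bot -> v <> top -> exists w : Defs.interior K, sval w = v.
Proof. by move=> vb vt; exists (exist _ v (conj vb vt)). Qed.

(** The map of [oslash G1 K] into [oslash G K] induced by a map of graphs that
    preserves arcs. *)
Definition oslash_over (G1 G : tbgraph) (phi : G1 -> G)
    (F : oslash G1 K -> oslash G K) : Prop :=
  (forall u, F (inl u) = inl (phi u)) /\
  forall e : Defs.arc G1, exists e' : Defs.arc G,
    sval e' = (phi (sval e).1, phi (sval e).2) /\
    forall w : K, F (oslash_copy e w) = oslash_copy e' w.

Definition arc_preserving (G1 G : tbgraph) (phi : G1 -> G) : Prop :=
  (forall u v, adj u v -> adj (phi u) (phi v)) /\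
  forall u v, adj u v ->
    (gdist bot (phi u) < gdist bot (phi v))%N = (gdist bot u < gdist bot v)%N.

Lemma graded_arc_preserving (G1 G : tbgraph) (phi : G1 -> G) h1 (lev1 : G1 -> nat)
    h (lev : G -> nat) k : graded h1 lev1 -> graded h lev ->
  (forall u v, adj u v -> adj (phi u) (phi v)) ->
  (forall u, lev (phi u) = (k + lev1 u)%N) -> arc_preserving phi.
Proof.
move=> gr1 gr ad lE; split=> // u v uv.
by rewrite !(graded_gdist gr) !(graded_gdist gr1) !lE ltn_add2l.
Qed.

Lemma oslash_over_exists (G1 G : tbgraph) (phi : G1 -> G) : arc_preserving phi ->
  exists F, oslash_over phi F.
Proof.
move=> [ad arcP].
have [am amP] : exists am : Defs.arc G1 -> Defs.arc G,
    forall e : Defs.arc G1, sval (am e) = (phi (sval e).1, phi (sval e).2).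
  suff h (e : Defs.arc G1) : exists e' : Defs.arc G, sval e' = (phi (sval e).1, phi (sval e).2).
    by exists (fun e => sval (cid (h e))) => e; case: cid.
  case: e => -[u v] /= [uv lt].
  have p : adj (phi u, phi v).1 (phi u, phi v).2 /\
     (gdist bot (phi u, phi v).1 < gdist bot (phi u, phi v).2)%N.
    by split; [exact: ad|rewrite arcP].
  by exists (exist _ (phi u, phi v) p).
exists (fun x => match x with inl u => inl (phi u) | inr (e, w) => inr (am e, w) end).
split=> // e; exists (am e); split => // w.
have [->|wb] := pselect (w = bot); first by rewrite !oslash_copy_bot amP.
have [->|wt] := pselect (w = top); first by rewrite !oslash_copy_top amP.
by have [w' <-] := interiorP wb wt; rewrite !oslash_copy_inner.
Qed.

Lemma oslash_vertexP (G : tbgraph) (x : oslash G K) : (exists u : G, x = inl u) \/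
  exists (e : Defs.arc G) (w : K), [/\ w <> bot, w <> top & x = oslash_copy e w].
Proof.
case: x => [u|[e w]]; first by left; exists u.
right; exists e, (sval w); rewrite oslash_copy_inner.
by split => //; case: (svalP w).
Qed.

Lemma oslash_over_adj (G1 G : tbgraph) (phi : G1 -> G) F : oslash_over phi F ->
  forall x y, adj x y -> adj (F x) (F y).
Proof.
move=> [_ Fe] x y [e [u [v [uv <- <-]]]]; have [e' [_ FE]] := Fe e.
by rewrite !FE; exists e', u, v.
Qed.

Lemma oslash_copy_eq (G : tbgraph) (e f : Defs.arc G) (v w : K) : v <> bot -> v <> top ->
  oslash_copy e v = oslash_copy f w -> e = f /\ v = w.
Proof.
move=> vb vt; have [v' ev] := interiorP vb vt; rewrite -ev oslash_copy_inner.
have [->|wb] := pselect (w = bot); first by rewrite oslash_copy_bot.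
have [->|wt] := pselect (w = top); first by rewrite oslash_copy_top.
have [w' ew] := interiorP wb wt; rewrite -ew oslash_copy_inner.
by move=> [-> ->].
Qed.

Lemma oslash_copy_neq_inl (G : tbgraph) (e : Defs.arc G) (v : K) u : v <> bot -> v <> top ->
  oslash_copy e v <> inl u.
Proof.
by move=> vb vt; have [v' <-] := interiorP vb vt; rewrite oslash_copy_inner.
Qed.

(** Points identified by two such maps come from vertices identified below, unless the
    maps share an arc. *)
Lemma oslash_over_meet (G1 G2 G : tbgraph) (phi : G1 -> G) (psi : G2 -> G) F F' x y :
  oslash_over phi F -> oslash_over psi F' -> F x = F' y ->
  (exists u v, [/\ x = inl u, y = inl v & phi u = psi v]) \/
  exists (e : Defs.arc G1) (f : Defs.arc G2) (w : K), [/\ x = oslash_copy e w, y = oslash_copy f w,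
    phi (sval e).1 = psi (sval f).1 & phi (sval e).2 = psi (sval f).2].
Proof.
move=> [Fl Fe] [Fl' Fe'].
have [[u ->]|[e [w [wb wt ->]]]] := oslash_vertexP x;
  have [[v ->]|[f [z [zb zt ->]]]] := oslash_vertexP y.
- by rewrite Fl Fl' => -[uv]; left; exists u, v.
- have [f' [_ ->]] := Fe' f; rewrite Fl => /esym h.
  by have := oslash_copy_neq_inl zb zt h.
- have [e' [_ ->]] := Fe e; rewrite Fl' => h.
  by have := oslash_copy_neq_inl wb wt h.
- have [e' [ee ->]] := Fe e; have [f' [ff ->]] := Fe' f.
  move=> /(oslash_copy_eq wb wt)[ef wz]; right; exists e, f, w.
  by move: ee; rewrite ef ff wz => -[-> ->].
Qed.

Lemma oslash_over_inj (G1 G : tbgraph) (phi : G1 -> G) F : injective phi ->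
  oslash_over phi F -> injective F.
Proof.
move=> inj oF x y /(oslash_over_meet oF oF)[[u [v [-> -> /inj -> //]]]|].
move=> [e [f [w [-> -> /inj e1 /inj e2]]]]; congr (oslash_copy _ _); apply: arc_inj.
by case: (sval e) (sval f) e1 e2 => [a b] [a' b'] /= -> ->.
Qed.

Lemma oslash_over_lift (G1 G : tbgraph) (phi : G1 -> G) F (e : Defs.arc G) u v :
  arc_preserving phi -> oslash_over phi F -> adj u v ->
  phi u = (sval e).1 -> phi v = (sval e).2 ->
  exists e1 : Defs.arc G1, forall w, F (oslash_copy e1 w) = oslash_copy e w.
Proof.
move=> [_ arcP] [_ Fe] uv eu ev.
have p : adj (u, v).1 (u, v).2 /\ (gdist bot (u, v).1 < gdist bot (u, v).2)%N.
  by split => //=; rewrite -arcP// eu ev; case: (svalP e).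
have [e' [ee FE]] := Fe (exist _ (u, v) p); exists (exist _ (u, v) p) => w.
rewrite FE; congr (oslash_copy _ _); apply: arc_inj.
by rewrite ee /= eu ev; case: (sval e).
Qed.

Lemma oslash_series (G G1 G2 : tbgraph) (i1 : G1 -> G) (i2 : G2 -> G) :
  series_cover i1 i2 -> arc_preserving i1 -> arc_preserving i2 ->
  exists F1 F2, @series_cover (oslash G K) (oslash G1 K) (oslash G2 K) F1 F2.
Proof.
move=> sc ar1 ar2.
have [F1 o1] := oslash_over_exists ar1; have [F2 o2] := oslash_over_exists ar2.
exists F1, F2; split.
- exact: oslash_over_inj (series_inj1 sc) o1.
- exact: oslash_over_inj (series_inj2 sc) o2.
- by rewrite o1.1 (series_bot sc).
- by rewrite o2.1 (series_top sc).
- by rewrite o1.1 o2.1 (series_cut sc).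
- move=> x y /(oslash_over_meet o1 o2)[[u [v [-> -> /(series_meet sc)[-> ->]]]]//|].
  move=> [e [f [w [_ _ /(series_meet sc)[e1 _] /(series_meet sc)[e2 _]]]]].
  by have := (svalP e).1; rewrite e1 e2 => /adj_irr.
- move=> x; have [[u ->]|[e [w [_ _ ->]]]] := oslash_vertexP x.
    have [[v <-]|[v <-]] := series_surj sc u.
      by left; exists (inl v); rewrite o1.1.
    by right; exists (inl v); rewrite o2.1.
  have [[u [v [uv eu ev]]]|[u [v [uv eu ev]]]] := series_adjP sc (svalP e).1.
    have [e1 FE] := oslash_over_lift ar1 o1 uv eu ev.
    by left; exists (oslash_copy e1 w).
  have [e1 FE] := oslash_over_lift ar2 o2 uv eu ev.
  by right; exists (oslash_copy e1 w).
- exact: oslash_over_adj o1.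
- exact: oslash_over_adj o2.
- move=> x y [e [a [b [ab <- <-]]]].
  have [[u [v [uv eu ev]]]|[u [v [uv eu ev]]]] := series_adjP sc (svalP e).1.
    have [e1 FE] := oslash_over_lift ar1 o1 uv eu ev.
    by left; exists (oslash_copy e1 a), (oslash_copy e1 b); split => //; exists e1, a, b.
  have [e1 FE] := oslash_over_lift ar2 o2 uv eu ev.
  by right; exists (oslash_copy e1 a), (oslash_copy e1 b); split => //; exists e1, a, b.
Qed.

(** An arc from bottom to top would belong to all the copies at once, hence the last
    hypothesis. *)
Lemma oslash_par (G G1 : tbgraph) (c : nat -> G1 -> G) :
  par_cover c -> (forall i, arc_preserving (c i)) -> ~ adj (bot : G1) top ->
  exists F, @par_cover (oslash G K) (oslash G1 K) F.
Proof.
move=> pc ar nbt.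
have [F oF] : exists F, forall i, oslash_over (c i) (F i).
  exists (fun i => sval (cid (oslash_over_exists (ar i)))) => i.
  by case: cid.
exists F; split.
- by move=> i; exact: oslash_over_inj (@par_inj _ _ _ pc i) (oF i).
- by move=> i; rewrite (oF i).1 (par_bot pc).
- by move=> i; rewrite (oF i).1 (par_top pc).
- move=> i j x y ij /(oslash_over_meet (oF i) (oF j)).
  move=> [[u [v [-> -> /(par_meet pc ij)[[-> ->]|[-> ->]]]]]|]; [by left|by right|].
  move=> [e [f [w [_ _ h1 h2]]]]; have [ee lt] := svalP e.
  case: (par_meet pc ij h1) => -[e1 _]; case: (par_meet pc ij h2) => -[e2 _].
  + by rewrite e1 e2 in ee; have := adj_irr ee.
  + by rewrite e1 e2 in ee; have := nbt ee.
  + by rewrite e1 e2 in ee; have := nbt (adj_sym ee).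
  + by rewrite e1 e2 in ee; have := adj_irr ee.
- move=> x; have [[u ->]|[e [w [_ _ ->]]]] := oslash_vertexP x.
    by have [i [v <-]] := par_surj pc u; exists i, (inl v); rewrite (oF i).1.
  have [i [u [v [uv eu ev]]]] := par_adjP pc (svalP e).1.
  have [e1 FE] := oslash_over_lift (ar i) (oF i) uv eu ev.
  by exists i, (oslash_copy e1 w).
- by move=> i; exact: oslash_over_adj (oF i).
- move=> x y [e [a [b [ab <- <-]]]].
  have [i [u [v [uv eu ev]]]] := par_adjP pc (svalP e).1.
  have [e1 FE] := oslash_over_lift (ar i) (oF i) uv eu ev.
  by exists i, (oslash_copy e1 a), (oslash_copy e1 b); split => //; exists e1, a, b.
Qed.

Lemma oslash_edge (G : tbgraph) k : edge_like G -> coded K k -> coded (oslash G K) k.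
Proof.
move=> eG; have [lev gr] := coded_graded (coded_edge eG).
have [lb lt _ _ _] := gr; case: eG => bt adjbt.
have p : adj (bot : G, top : G).1 (bot : G, top : G).2 /\
    (gdist (bot : G) (bot : G, top : G).1 < gdist bot (bot : G, top : G).2)%N.
  by split => //=; rewrite !(graded_gdist gr) lb lt.
pose e : Defs.arc G := exist _ (bot, top) p.
have uniq_arc (f : Defs.arc G) : f = e.
  apply: arc_inj; have := svalP f; case: (sval f) => a b /=.
  rewrite !(graded_gdist gr); case: (bt a) => ->; case: (bt b) => -> // [];
    by rewrite ?lb ?lt ?ltnn// => /adj_irr.
apply: (@coded_image (oslash G K) K (oslash_copy e) k).
- exact: oslash_copy_inj.
- move=> x; have [[u ->]|[f [w [_ _ ->]]]] := oslash_vertexP x.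
    case: (bt u) => ->; first by exists bot; rewrite oslash_copy_bot.
    by exists top; rewrite oslash_copy_top.
  by exists w; rewrite (uniq_arc f).
- by rewrite oslash_copy_bot.
- by rewrite oslash_copy_top.
- by move=> u v uv; exists e, u, v.
- by move=> x y [f [u [v [uv <- <-]]]]; rewrite (uniq_arc f); exists u, v.
Qed.

End OslashMaps.

(** Substitution commutes with both compositions, and turns a single edge into the
    substituted graph. *)
Lemma coded_oslash b (G : tbgraph) : formed b G -> exists h, coded G h /\
  forall K k, coded K k -> coded (oslash G K) (h * k).
Proof.
move: b G; apply: (@formed_cover_ind (fun _ G => exists h, coded G h /\
  forall K k, coded K k -> coded (oslash G K) (h * k))).
- move=> G eG; exists 1%N; split=> [|K k cK]; first exact: coded_edge.
  by rewrite mul1n; exact: oslash_edge.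
- move=> _ _ G G1 G2 i1 i2 sc [h1 [c1 o1]] [h2 [c2 o2]].
  exists (h1 + h2)%N; split=> [|K k cK]; first exact: coded_series sc c1 c2.
  have [lev1 gr1] := coded_graded c1; have [lev2 gr2] := coded_graded c2.
  have [lev [gr l1 l2 _]] := graded_series sc gr1 gr2.
  have ar1 := graded_arc_preserving (k := 0) gr1 gr (series_adj1 sc) l1.
  have ar2 := graded_arc_preserving gr2 gr (series_adj2 sc) l2.
  have [F1 [F2 scF]] := oslash_series K sc ar1 ar2.
  by rewrite mulnDl; exact: coded_series scF (o1 _ _ cK) (o2 _ _ cK).
- move=> _ G G1 c pc eG1 _; exists 1%N.
  have eG : edge_like G.
    split=> [x|]; last by rewrite -(par_bot pc 0) -(par_top pc 0); exact/par_adj/eG1.2.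
    have [i [u <-]] := par_surj pc x.
    by case: (eG1.1 u) => ->; rewrite ?(par_bot pc) ?(par_top pc); [left|right].
  split=> [|K k cK]; first exact: coded_edge.
  by rewrite mul1n; exact: oslash_edge.
- move=> _ G G1 c pc neG1 [h [cG1 oG1]]; exists h.
  split=> [|K k cK]; first exact: coded_par pc cG1.
  have [lev1 gr1] := coded_graded cG1; have [lev [gr lE]] := graded_par pc gr1.
  have [|F pF] := @oslash_par K _ _ _ pc _ (fun bt => neG1 (graded_edge_like gr1 bt)).
    move=> i; exact: (graded_arc_preserving (k := 0) gr1 gr (@par_adj _ _ _ pc i) (lE i)).
  exact: coded_par pF (oG1 _ _ cK).
Qed.

Lemma coded_oslash_pow b (G : tbgraph) : formed b G -> exists h, coded G h /\
  forall n, coded (oslash_pow G n) (h ^ n.+1).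
Proof.
move=> /coded_oslash[h [cG oG]]; exists h; split => //.
by elim=> [|n IH] /=; [rewrite expn1|rewrite expnS; exact: oG].
Qed.

(** * AUC norms exclude the embeddings *)

Lemma walk_seminorm (R : realType) (X : normedModType R) (p : X -> R) (G : tbgraph)
    (g : G -> X) (L : R) n (u v : G) : seminorm p ->
  (forall u v : G, adj u v -> p (g u - g v) <= L) -> walk n u v ->
  p (g u - g v) <= n%:R * L.
Proof.
move=> sp gL; elim: n u => [|n IH] u /=.
  by move=> ->; rewrite subrr (sublinear0 (seminorm_sublinear sp)) mul0r.
move=> [z uz zv]; rewrite -(subrKA (g z)); apply: le_trans (sp.1 _ _) _.
by rewrite -natr1 mulrDl mul1r addrC; apply: lerD; [exact: IH|exact: gL].
Qed.

Section AUCObstruction.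
Context {R : realType} {X : normedModType R} {N : X -> R}.
Context (eqN : equivalent_norm N) (aucN : AUC N).

Let sN : seminorm N. Proof. by case: eqN => -[nD nZ _] _. Qed.

Let NN x : N (- x) = N x.
Proof. by rewrite -scaleN1r sN.2 normrN1 mul1r. Qed.

Let NB x y : N (x - y) = N (y - x).
Proof. by rewrite -opprB NN. Qed.

Let Ntri z x y : N (x - y) <= N (x - z) + N (z - y).
Proof. by rewrite -[x in leLHS](subrK z) -addrA; exact: sN.1. Qed.

(** By convexity of the norm, the gain at length [t] persists at larger lengths. *)
Lemma AUC_gain (t : R) : 0 < t -> exists2 eta : R, 0 < eta &
  forall w, 0 < N w -> exists2 Y, cof Y &
    forall y, Y y -> t * N w <= N y -> (1 + eta) * N w <= N (w + y).
Proof.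
move=> t0; have := aucN t0; set I := ereal_inf _ => I0.
have [eta eta0 etaI] : exists2 eta : R, 0 < eta & (eta%:E < I)%E.
  case: I I0 => [r| |] //; last by exists 1; rewrite // ltry.
  rewrite lte_fin => r0; exists (r / 2); rewrite ?lte_fin; lra.
exists eta => // w w0.
have Nx : N ((N w)^-1 *: w) = 1 by rewrite sN.2 ger0_norm ?invr_ge0 ?(ltW w0)// mulVf ?gt_eqF.
have := lt_le_trans etaI (ereal_inf_lbound _).
move=> /(_ _ (ex_intro2 _ _ ((N w)^-1 *: w) Nx erefl)) /ereal_sup_gt[_ [Y cY <-] hY].
exists Y => // y Yy ty.
have y0 : 0 < N y by apply: lt_le_trans ty; rewrite mulr_gt0.
have Ny : N ((N y)^-1 *: y) = 1 by rewrite sN.2 ger0_norm ?invr_ge0 ?(ltW y0)// mulVf ?gt_eqF.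
have Yy' : Y ((N y)^-1 *: y) by apply: subspaceZ Yy; exact: cof_subspace.
have := lt_le_trans hY (ereal_inf_lbound _).
move=> /(_ _ (ex_intro2 _ _ ((N y)^-1 *: y) (conj Yy' Ny) erefl)); rewrite lte_fin => h.
pose r := t * N w / N y.
have r0 : 0 < r by rewrite divr_gt0// mulr_gt0.
have r1 : r <= 1 by rewrite ler_pdivrMr// mul1r.
have h1 : (1 + eta) * N w <= N (w + r *: y).
  have -> : w + r *: y = N w *: ((N w)^-1 *: w + t *: ((N y)^-1 *: y)).
    rewrite scalerDr !scalerA mulfV ?gt_eqF// scale1r; congr (_ + _ *: _).
    by rewrite /r; ring.
  by rewrite sN.2 (gtr0_norm w0) mulrC ler_pM2l//; lra.
have h2 : N (w + r *: y) <= (1 - r) * N w + r * N (w + y).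
  have -> : w + r *: y = (1 - r) *: w + r *: (w + y).
    by rewrite scalerBl scale1r scalerDr addrA subrK.
  apply: le_trans (sN.1 _ _) _; rewrite !sN.2 ger0_norm ?subr_ge0//.
  by rewrite (gtr0_norm r0).
have : r * ((1 + eta) * N w) <= r * N (w + y).
  by have : r * (eta * N w) <= 1 * (eta * N w); [rewrite ler_pM2r// mulr_gt0|lra].
by rewrite ler_pM2l.
Qed.

(** Modulo [Y] the sequence lies in a bounded subset of a finite-dimensional space. *)
Lemma close_differences (Y : set X) (p : nat -> X) (M d : R) : cof Y -> 0 < d ->
  (forall i, N (p i) <= M) ->
  exists i j y, [/\ i <> j, Y y & N (p i - p j - y) <= d].
Proof.
move=> cY d0 pM; have [_ [k [K [k0 K0 kK]]]] := eqN.
have [s sY] := cof_proj cY.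
pose S := 1 + \sum_(q <- s) `|q.2|.
have S0 : 0 < S by rewrite ltr_pwDl// sumr_ge0.
have [||i [j [ij hij]]] := @pigeonhole_functionals _ _ (map fst s) p (M / k) (d / (K * S)).
- by rewrite divr_gt0// mulr_gt0.
- move=> i; rewrite ler_pdivlMr// mulrC; apply: le_trans (pM i).
  by case/andP: (kK (p i)).
exists i, j, (proj s (p i - p j)); split => //.
  by move=> e; move: ij; rewrite e ltnn.
apply: le_trans (andP (kK _)).2 _; rewrite -ler_pdivlMl//.
apply: le_trans (norm_proj_sub (d := d / (K * S)) _) _.
  by move=> q qs; apply/ltW/hij/map_f.
have -> : d / (K * S) * \sum_(q <- s) `|q.2| = K^-1 * d * ((\sum_(q <- s) `|q.2|) / S).
  by rewrite invfM; ring.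
rewrite ler_piMr ?mulr_ge0 ?invr_ge0 ?(ltW d0) ?(ltW K0)// ler_pdivrMr// mul1r.
by rewrite /S lerDr.
Qed.

(** The midpoint argument.  In a parallel composition, the points [g (c i z)] at the
    first level give [w + (p i - p j)] of norm at most [h * L], where [p i - p j] is
    almost in any prescribed subspace of finite codimension and is not small; by AUC
    this forces the norm of [w = g top - g bot] to be a definite factor below [h * L]. *)
Lemma bundle_contraction b (G : tbgraph) : formed b G -> exists h lev,
  @graded G h lev /\ (b -> forall c : R, 0 < c -> exists theta : R,
  [/\ 0 < theta, theta < 1 & forall (g : G -> X) (L : R),
    (forall u v : G, adj u v -> N (g u - g v) <= L) ->
    (forall u v : G, u <> v -> v <> bot -> v <> top -> c * L <= N (g u - g v)) ->
    N (g top - g bot) <= theta * h%:R * L]).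
Proof.
move: b G; apply: formed_cover_ind.
- by move=> G /coded_edge/coded_graded[lev gr]; exists 1%N, lev.
- move=> b c G G1 G2 i1 i2 sc [h1 [lev1 [gr1 P1]]] [h2 [lev2 [gr2 P2]]].
  have [lev [gr _ _ _]] := graded_series sc gr1 gr2.
  exists (h1 + h2)%N, lev; split => // bc d d0.
  have h1p : 0 < h1%:R :> R by rewrite ltr0n; exact: graded_height_gt0 gr1.
  have h2p : 0 < h2%:R :> R by rewrite ltr0n; exact: graded_height_gt0 gr2.
  have whole (g : G -> X) (L B1 B2 : R) : N (g (i1 top) - g (i1 bot)) <= B1 ->
      N (g (i2 top) - g (i2 bot)) <= B2 -> N (g top - g bot) <= B1 + B2.
    move=> b1 b2; rewrite -(series_top sc) -(series_bot sc).
    by apply: le_trans (Ntri (g (i1 top)) _ _) _; rewrite addrC {2}(series_cut sc) lerD.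
  have up (H : tbgraph) (k : nat) (l : H -> nat) (gk : graded k l) (g : H -> X) (L : R) :
      (forall u v : H, adj u v -> N (g u - g v) <= L) -> N (g top - g bot) <= k%:R * L.
    move=> gL; rewrite NB; apply: walk_seminorm sN gL _.
    by have [_ <- _ w _] := gk; exact: w.
  case: b P1 bc => [P1 _|_ /=]; last first.
    case: c P2 => // P2 _; have [th [th0 th1 hth]] := P2 erefl d d0.
    exists ((h1%:R + th * h2%:R) / (h1%:R + h2%:R)); split.
    + by rewrite divr_gt0 ?addr_gt0 ?mulr_gt0.
    + rewrite ltr_pdivrMr ?addr_gt0// mul1r ltrD2l.
      by rewrite gtr_pMl.
    move=> g L gL gsep; rewrite natrD divfK ?gt_eqF ?addr_gt0// mulrDl.
    apply: whole => //.
      by apply: (up _ _ _ gr1 (g \o i1)) => u v uv; apply: gL; exact: (series_adj1 sc).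
    apply: (hth (g \o i2)) => [u v uv|u v uv vb vt] /=.
      by apply: gL; exact: (series_adj2 sc).
    apply: gsep => [/(series_inj2 sc)//|/esym|].
      by rewrite -(series_bot sc) => /(series_meet sc)[].
    by rewrite -(series_top sc) => /(series_inj2 sc).
  have [th [th0 th1 hth]] := P1 erefl d d0.
  exists ((th * h1%:R + h2%:R) / (h1%:R + h2%:R)); split.
  + by rewrite divr_gt0 ?addr_gt0 ?mulr_gt0.
  + rewrite ltr_pdivrMr ?addr_gt0// mul1r ltrD2r.
    by rewrite gtr_pMl.
  move=> g L gL gsep; rewrite natrD divfK ?gt_eqF ?addr_gt0// mulrDl.
  apply: whole => //.
    apply: (hth (g \o i1)) => [u v uv|u v uv vb vt] /=.
      by apply: gL; exact: (series_adj1 sc).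
    apply: gsep => [/(series_inj1 sc)//||].
      by rewrite -(series_bot sc) => /(series_inj1 sc).
    by rewrite -(series_top sc) => /(series_meet sc)[].
  by apply: (up _ _ _ gr2 (g \o i2)) => u v uv; apply: gL; exact: (series_adj2 sc).
- move=> b G G1 c pc _ [h [lev1 [gr1 P1]]]; have [lev [gr _]] := graded_par pc gr1.
  exists h, lev; split => // bT d d0; have [th [th0 th1 hth]] := P1 bT d d0.
  exists th; split => // g L gL gsep.
  rewrite -(par_bot pc 0) -(par_top pc 0).
  apply: (hth (g \o c 0%N)) => [u v uv|u v uv vb vt] /=.
    by apply: gL; exact: (par_adj pc).
  apply: gsep => [/(par_inj pc)//||].
    by rewrite -(par_bot pc 0) => /(par_inj pc).
  by rewrite -(par_top pc 0) => /(par_inj pc).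
move=> _ G G1 c pc neG1 [h [lev1 [gr1 _]]]; have [lev [gr levE]] := graded_par pc gr1.
exists h, lev; split => // _ d d0.
have [lb1 lt1 adj1 up1 dn1] := gr1.
have h0 := graded_height_gt0 gr1.
have h2 : (1 < h)%N.
  rewrite ltn_neqAle h0 andbT; apply/eqP => h1; apply: neG1.
  apply: graded_edge_like gr1 _; have := up1 top.
  by rewrite lt1 -h1 => -[z bz /= <-].
have [z bz zt] : exists2 z : G1, adj bot z & walk h.-1 z top.
  by have := up1 top; rewrite lt1 -(prednK h0) => -[z bz zt]; exists z.
have lz : lev1 z = 1%N by have := adj1 _ _ bz; rewrite lb1; lia.
have zb : z <> bot by move=> e; move: lz; rewrite e lb1.
have znt : z <> top by move=> e; move: lz; rewrite e lt1; lia.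
have hR : 0 < h%:R :> R by rewrite ltr0n.
have t0 : 0 < d / (2 * h%:R) by rewrite divr_gt0// mulr_gt0.
have [eta eta0 gain] := AUC_gain t0.
have e1 : 0 < 1 + eta by rewrite addr_gt0.
exists ((1 + eta / 2) / (1 + eta)); split.
- by rewrite divr_gt0// addr_gt0// divr_gt0.
- by rewrite ltr_pdivrMr//; lra.
move=> g L gL gsep.
have L0 : 0 <= L.
  apply: le_trans (gL _ _ (par_adj pc 0 bz)); exact: seminorm_ge0.
pose w := g top - g bot; pose p i := g (c i z) - g bot.
have pL i : N (p i) <= L.
  by rewrite /p NB -(par_bot pc i); apply: gL; exact: (par_adj pc).
have wpL i : N (w - p i) <= (h%:R - 1) * L.
  rewrite /w /p opprB addrA subrK NB.
  have -> : h%:R - 1 = h.-1%:R :> R by rewrite -{1}(prednK h0) -natr1 addrK.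
  apply: walk_seminorm sN gL _; rewrite -(par_top pc i).
  exact: walk_map (@par_adj _ _ _ pc i) zt.
have sep i j : i <> j -> d * L <= N (p i - p j).
  move=> ij; rewrite /p opprB addrA subrK; apply: gsep.
  - by move=> /(par_meet pc ij)[[]|[]].
  - by rewrite -(par_bot pc j) => /(par_inj pc).
  - by rewrite -(par_top pc j) => /(par_inj pc).
rewrite -/w mulrAC -mulrA mulrAC ler_pdivlMr// mulrC.
have whL : N w <= h%:R * L.
  have := sN.1 (p 0%N) (w - p 0%N); rewrite addrC subrK.
  by have := pL 0%N; have := wpL 0%N; lra.
have [w0|w0] := leP (N w) 0.
  have : (1 + eta) * N w <= 0 by rewrite mulr_ge0_le0// ltW.
  move=> /le_trans; apply; rewrite !mulr_ge0// ?(ltW hR)//; lra.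
have Lp : 0 < L by move: (lt_le_trans w0 whL); rewrite pmulr_rgt0.
have [Y cY YP] := gain w w0.
pose k := Num.min (d / 2) (h%:R * eta / 2).
have k0 : 0 < k by rewrite lt_min !divr_gt0// mulr_gt0.
have kd : k <= d / 2 by rewrite ge_min lexx.
have kh : k <= h%:R * eta / 2 by rewrite ge_min lexx orbT.
have [i [j [y [ij Yy hy]]]] := close_differences cY (mulr_gt0 k0 Lp) pL.
have kdL : k * L <= d / 2 * L by rewrite ler_pM2r.
have khL : k * L <= h%:R * eta / 2 * L by rewrite ler_pM2r.
have yd : d / 2 * L <= N y.
  have := sN.1 (p i - p j - y) y; rewrite subrK; have := sep _ _ ij; lra.
have tw : d / (2 * h%:R) * N w <= N y.
  apply: le_trans yd; apply: le_trans (ler_wpM2l (ltW t0) whL) _.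
  by rewrite mulrA invfM mulrA divfK ?gt_eqF.
apply: le_trans (YP y Yy tw) _.
have : N (w + y) <= N (p i) + N (w - p j) + N (p i - p j - y).
  have -> : w + y = (p i + (w - p j)) - (p i - p j - y).
    have aux (a b v : X) : v + y = (a + (v - b)) - (a - b - y).
      by rewrite (addrCA a) opprB -addrA (addrC (a - b)) subrK.
    exact: aux.
  apply: le_trans (sN.1 _ _) _; rewrite NN lerD2r; exact: sN.1.
by have := pL i; have := wpL j; lra.
Qed.

(** The separation is only required against Lipschitz functions vanishing at both
    ends: these extend by zero from a copy to the whole graph, so that the
    hypothesis is inherited by copies without computing distances. *)
Lemma pow_contraction (G : tbgraph) : formed true G -> exists h,
  (forall n, coded (oslash_pow G n) (h ^ n.+1)) /\
  forall c : R, 0 < c -> exists theta : R, [/\ 0 < theta, theta < 1 &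
  forall n (g : oslash_pow G n -> X) (L a : R), 0 < L -> c * L <= a ->
    (forall u v, adj u v -> N (g u - g v) <= L) ->
    (forall psi : oslash_pow G n -> nat,
       (forall u v, adj u v -> (psi u <= (psi v).+1)%N) ->
       psi bot = 0%N -> psi top = 0%N ->
       forall u v, a * ((psi u)%:R - (psi v)%:R) <= N (g u - g v)) ->
    N (g top - g bot) <= theta ^+ n * (h ^ n.+1)%:R * L].
Proof.
move=> fG; have [h [cG cpow]] := coded_oslash_pow fG.
have [h' [lev' [gr' contr]]] := bundle_contraction fG.
have [lev gr] := coded_graded cG.
have hh' : h' = h by rewrite (graded_height gr') (graded_height gr).
subst h'; have [lb lt adjP up dn] := gr.
exists h; split => // c c0; have [th [th0 th1 hth]] := contr erefl c c0.
exists th; split => //; elim=> [|n IH] g L a L0 cLa gL gsep.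
  by rewrite expr0 mul1r expn1 NB; apply: walk_seminorm sN gL _; rewrite -lt; exact: up.
have [levK grK] := coded_graded (cpow n).
pose K := oslash_pow G n; pose k := (h ^ n.+1)%N.
have [lbK ltK adjK _ dnK] := grK.
pose L' := th ^+ n * k%:R * L.
have edge (e : Defs.arc G) : N (g (inl (sval e).2) - g (inl (sval e).1)) <= L'.
  rewrite -(oslash_copy_top K e) -(oslash_copy_bot K e).
  apply: (IH (g \o oslash_copy e) L a L0 cLa) => [u v uv|psi lip pb pt u v] /=.
    by apply: gL; exists e, u, v.
  (* The extension of [psi] by zero outside the copy on [e]. *)
  pose psi' (x : oslash G K) := match x with
    | inl _ => 0%N
    | inr (f, w) => if `[< f = e >] then psi (sval w) else 0%N end.
  have psiE f w : psi' (oslash_copy f w) = if `[< f = e >] then psi w else 0%N.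
    have [->|wb] := pselect (w = bot); first by rewrite oslash_copy_bot pb if_same.
    have [->|wt] := pselect (w = top); first by rewrite oslash_copy_top pt if_same.
    by have [w' <-] := interiorP wb wt; rewrite oslash_copy_inner.
  have := gsep psi' _ erefl erefl (oslash_copy e u) (oslash_copy e v).
  rewrite !psiE asboolT//; apply => x y [f [x' [y' [xy <- <-]]]]; rewrite !psiE.
  by case: asboolP => // _; exact: lip.
have L'0 : 0 <= L' by rewrite !mulr_ge0 ?exprn_ge0 ?(ltW th0) ?(ltW L0).
have -> : th ^+ n.+1 * (h ^ n.+2)%:R * L = th * h%:R * L'.
  by rewrite /L' exprS expnS natrM /k; ring.
apply: (hth (fun u => g (inl u))) => [u v uv|u v uv vb vt].
  have arcN (x y : G) : adj x y -> lev y = (lev x).+1 -> N (g (inl y) - g (inl x)) <= L'.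
    move=> xy lxy; have p : adj (x, y).1 (x, y).2 /\
       (gdist (bot : G) (x, y).1 < gdist bot (x, y).2)%N.
      by split => //=; rewrite !(graded_gdist gr) lxy.
    exact: (edge (exist _ (x, y) p)).
  case: (adjP _ _ uv) => l; first by rewrite NB; exact: arcN.
  by apply: arcN => //; exact: adj_sym.
(* The indicator of [v], interpolated linearly along the arcs and scaled by [k]. *)
pose psi (x : oslash G K) := match x with
  | inl x => if `[< x = v >] then k else 0%N
  | inr (e, w) => if `[< (sval e).2 = v >] then levK (sval w) else
                  if `[< (sval e).1 = v >] then (k - levK (sval w))%N else 0%N end.
have psiE e w : psi (oslash_copy e w) = if `[< (sval e).2 = v >] then levK w else
    if `[< (sval e).1 = v >] then (k - levK w)%N else 0%N.
  have [->|wb] := pselect (w = bot).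
    rewrite oslash_copy_bot /= lbK subn0; case: asboolP => [e1|_]; last by rewrite if_same.
    case: asboolP => // e2; have := (svalP e).1; by rewrite e1 e2 => /adj_irr.
  have [->|wt] := pselect (w = top).
    by rewrite oslash_copy_top /= ltK subnn if_same.
  by have [w' <-] := interiorP wb wt; rewrite oslash_copy_inner.
have lip x y : adj x y -> (psi x <= (psi y).+1)%N.
  move=> [e [a' [b' [ab <- <-]]]]; rewrite !psiE.
  have := adjK _ _ ab; have := (dnK a').1; have := (dnK b').1; rewrite -/k.
  by case: asboolP => _; [lia|case: asboolP => _; lia].
have pb : psi bot = 0%N by rewrite /= asboolF// => e; apply: vb.
have pt : psi top = 0%N by rewrite /= asboolF// => e; apply: vt.
have := gsep psi lip pb pt (inl v) (inl u).
rewrite /= asboolT// asboolF// subr0 NB; apply: le_trans.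
rewrite /L' mulrCA -mulrA -[leRHS]mul1r mulrCA.
have thn : th ^+ n <= 1 by rewrite exprn_ile1 ?(ltW th0) ?(ltW th1).
have : th ^+ n * (k%:R * (c * L)) <= 1 * (k%:R * (c * L)).
  by rewrite ler_wpM2r// !mulr_ge0 ?(ltW c0) ?(ltW L0).
have : k%:R * (c * L) <= k%:R * a by rewrite ler_wpM2l.
by lra.
Qed.

(** The contraction factors accumulate over the powers, whereas the distance from top to
    bottom must keep a fixed proportion of the Lipschitz bound. *)
Lemma AUC_not_embeds (G : tbgraph) : nontrivial_bundle_graph G ->
  ~ equi_lipschitz_embeds X (M := fun n : nat => vertex (oslash_pow G n))
      (fun n x y => (gdist x y)%:R).
Proof.
move=> fG [D D1 [f [s [s0 fs]]]].
have [_ [k [K [k0 K0 kK]]]] := eqN.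
have [h [cpow]] := pow_contraction fG.
have D0 : 0 < D by apply: lt_le_trans D1.
have KD0 : 0 < K * D by rewrite mulr_gt0.
move=> /(_ (k / (K * D)) (divr_gt0 k0 KD0))[th [th0 th1 hth]].
have [n thn] : exists n, th ^+ n < k / (K * D).
  have : th ^+ n @[n --> \oo] --> (0 : R) by apply: cvg_expr; rewrite gtr0_norm.
  move=> /cvgrPdist_lt/(_ _ (divr_gt0 k0 KD0))[n _ /(_ n (leqnn n))].
  rewrite sub0r normrN ger0_norm ?exprn_ge0 ?(ltW th0)// => ?; by exists n.
have [lev gr] := coded_graded (cpow n).
have sp := s0 n.
have H0 : 0 < (h ^ n.+1)%:R :> R by rewrite ltr0n; exact: graded_height_gt0 gr.
have low : k * (s n * (h ^ n.+1)%:R) <= N (f n top - f n bot).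
  rewrite NB; apply: le_trans (andP (kK _)).1; rewrite ler_pM2l//.
  have /andP[+ _] := fs n bot top; rewrite (graded_gdist gr).
  by have [_ -> _ _ _] := gr.
have ub : ~~ (N (f n top - f n bot) <= th ^+ n * (h ^ n.+1)%:R * (K * (s n * D))).
  rewrite -ltNge; apply: lt_le_trans low.
  have -> : th ^+ n * (h ^ n.+1)%:R * (K * (s n * D)) =
    (th ^+ n * (K * D)) * (s n * (h ^ n.+1)%:R) by ring.
  by rewrite ltr_pM2r ?mulr_gt0// -ltr_pdivlMr.
move/negP: ub; apply; apply: (hth n (f n) (K * (s n * D)) (k * s n)).
- by rewrite !mulr_gt0.
- by rewrite (_ : _ * _ = k * s n)//; field; rewrite !gt_eqF.
- move=> u v uv; apply: le_trans (andP (kK _)).2 _; rewrite ler_pM2l//.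
  have /andP[_ /le_trans] := fs n u v; apply.
  have [_ d1] := gdistP (walk1 uv); rewrite ler_piMr ?mulr_ge0 ?(ltW sp) ?(ltW D0)//.
  by rewrite (ler_nat R _ 1).
move=> psi lip _ _ u v; apply: le_trans (andP (kK _)).1; rewrite -mulrA ler_pM2l//.
have /andP[+ _] := fs n u v; apply: le_trans; rewrite ler_pM2l//.
have [m w] := graded_connected gr u v; have [{}w _] := gdistP w.
by have := walk_lipschitz lip w; rewrite -(ler_nat R) natrD; lra.
Qed.

End AUCObstruction.

(** * Games played with subspaces of finite codimension *)

Section Games.
Context {R : realType} {X : normedModType R}.
Implicit Types (P Q : seq X -> Prop) (s : seq X).

(** The game dual to [asymptotic_game]: the player choosing the vectors wins. *)
Fixpoint vector_game (n : nat) P s : Prop :=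
  if n is n'.+1 then
    forall Y, cof Y -> exists y, [/\ Y y, `|y| = 1 & vector_game n' P (rcons s y)]
  else P s.

Lemma vector_game_mono n P Q s : (forall s', P s' -> Q s') ->
  vector_game n P s -> vector_game n Q s.
Proof.
move=> PQ; elim: n s => [|n IH] s /=; first exact: PQ.
by move=> h Y /h[y [Yy y1 /IH hy]]; exists y.
Qed.

Lemma asymptotic_vector_game n P Q s : asymptotic_game n P s -> vector_game n Q s ->
  vector_game n (fun s' => P s' /\ Q s') s.
Proof.
elim: n s => [|n IH] s //= [Y cY hY] h Z cZ.
have [W [cW WY WZ]] := cof_meet cY cZ; have [y [Wy y1 hy]] := h W cW.
by exists y; split; [exact: WZ|by []|apply: IH hy; apply: hY => //; exact: WY].
Qed.

Lemma midpoint_decomposition (u z : X) (r : R) :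
  u + r *: z = ((1 + r) / 2) *: (u + z) + ((1 - r) / 2) *: (u - z).
Proof.
rewrite !scalerDr scalerN addrACA -scalerDl -scalerBl.
have -> : (1 + r) / 2 + (1 - r) / 2 = 1 by lra.
have -> : (1 + r) / 2 - (1 - r) / 2 = r by lra.
by rewrite scale1r.
Qed.

(** A norm bound over all signs extends to coefficients in the cube, of which the
    signs are the extreme points. *)
Lemma sign_convex (n : nat) (z : nat -> X) (M : R) (w : X) :
  (forall e : nat -> bool, `|w + \sum_(i < n) (-1) ^+ e i *: z i| <= M) ->
  forall r : nat -> R, (forall i, (i < n)%N -> `|r i| <= 1) ->
  `|w + \sum_(i < n) r i *: z i| <= M.
Proof.
elim: n w => [|n IH] w h r r1.
  by have := h (fun=> false); rewrite !big_ord0.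
have aux (b : bool) : `|w + \sum_(i < n) r i *: z i + (-1) ^+ b *: z n| <= M.
  rewrite addrAC; apply: IH => [e|i ltin]; last by apply: r1; exact: ltnW.
  have := h (fun i => if i == n then b else e i).
  rewrite big_ord_recr /= eqxx addrA addrAC.
  by under eq_bigr do rewrite ltn_eqF//.
have := r1 n (ltnSn n); rewrite ler_norml => /andP[rn1 rn2].
rewrite big_ord_recr /= addrA midpoint_decomposition.
apply: le_trans (ler_normD _ _) _; rewrite !normrZ !ger0_norm; try lra.
have := aux true; have := aux false; rewrite expr0 expr1 scale1r scaleN1r.
by nra.
Qed.

Definition cube_bounded (M : R) s : Prop := forall t : nat -> R,
  (forall i, (i < size s)%N -> `|t i| <= 1) -> `|\sum_(i < size s) t i *: s`_i| <= M.

Lemma unconditional_cube_bounded (C d B : R) s : 0 < d -> 0 <= C -> unconditional C s ->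
  (exists2 b : nat -> R, forall i, (i < size s)%N -> d <= b i &
     `|\sum_(i < size s) b i *: s`_i| <= B) ->
  cube_bounded (C * B / d) s.
Proof.
move=> d0 C0 us [b bd bB] t t1.
have : `|0 + \sum_(i < size s) (d * t i / b i) *: (b i *: s`_i)| <= C * B.
  apply: (@sign_convex (size s) (fun i => b i *: s`_i) _ 0 _ (fun i => d * t i / b i)).
    move=> e; rewrite add0r.
    have := us (fun i => b i) (fun i => e i).
    under eq_bigr do rewrite -scalerA; move=> /le_trans; apply.
    by rewrite ler_wpM2l.
  move=> i si; have bi := bd i si; have bi0 : 0 < b i by apply: lt_le_trans bi.
  rewrite normrM normfV (gtr0_norm bi0) ler_pdivrMr// mul1r normrM (gtr0_norm d0).
  by apply: le_trans bi; rewrite ler_piMr// ?(ltW d0)// t1.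
rewrite add0r ler_pdivlMr//; set T := \sum_(i < _) t i *: _.
have -> : `|T| * d = `|d *: T| by rewrite normrZ gtr0_norm// mulrC.
suff -> : d *: T = \sum_(i < size s) (d * t i / b i) *: (b i *: s`_i) by [].
rewrite scaler_sumr; apply: eq_bigr => i _; rewrite !scalerA divfK// gt_eqF//.
exact: lt_le_trans (bd i (ltn_ord i)).
Qed.

End Games.

Section SzlenkGame.
Context {R : realType} {X : normedModType R} (rX : reflexive_space X).

Lemma bidual_norm (phi : dual (dual X)) x : (forall f, phi f = f x) -> `|phi| = `|x|.
Proof.
move=> phiE; apply/le_anti/andP; split.
  by apply: dual_norm_bound => // f; rewrite phiE mulrC dual_norm_le.
have [f f1 fx] := norming_functional x.
rewrite -fx -phiE; apply: le_trans (ler_norm _) _; apply: le_trans (dual_norm_le _ _) _.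
by rewrite ler_piMr.
Qed.

(** A point surviving [m] derivations starts a game in which every weak
    neighbourhood contains a surviving point at distance more than [eps / 2]; the
    successive increments, pushed into the subspaces of finite codimension chosen by
    the opponent at a cost [k] each, have bounded sums. *)
Lemma szlenk_game (eps k : R) : 0 < k -> k <= eps / 4 -> forall m phi x,
  derived eps m phi -> (forall f : dual X, phi f = f x) -> forall s (b : nat -> R) (A : R),
  (forall i, (i < size s)%N -> eps / 4 <= b i) ->
  `|x - \sum_(i < size s) b i *: s`_i| <= A ->
  vector_game m (fun s' => exists2 b : nat -> R,
    forall i, (i < size s')%N -> eps / 4 <= b i &
    `|\sum_(i < size s') b i *: s'`_i| <= 1 + A + m%:R * k) s.
Proof.
move=> k0 ke; elim=> [|m IH] phi x Dphi phiE s b A bs hA /=.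
  exists b => //; rewrite mul0r addr0.
  have : `|x| <= 1 by rewrite -(bidual_norm phiE); exact: Dphi.
  have := ler_normB x (x - \sum_(i < size s) b i *: s`_i).
  by rewrite opprB addrC subrK; lra.
move=> Y cY; have [s0 s0Y] := cof_proj cY.
pose S := 1 + \sum_(q <- s0) `|q.2|.
have S0 : 0 < S by rewrite ltr_pwDl// sumr_ge0.
have [U [oU Uphi hU]] := weak_star_basic_open phi (map fst s0) (divr_gt0 k0 S0).
have [psi [Dpsi Upsi far]] := szlenk_step_separated Dphi oU Uphi.
have [x' psiE] := rX psi.
have dE : `|psi - phi| = `|x' - x|.
  by apply: bidual_norm => f; rewrite dualB -psiE -phiE.
pose z := proj s0 (x' - x).
have hz : `|x' - x - z| <= k.
  apply: le_trans (norm_proj_sub (d := k / S) _) _.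
    move=> q qs; apply/ltW; rewrite dualB -psiE -phiE; apply: hU Upsi.
    exact: map_f.
  have -> : k / S * \sum_(q <- s0) `|q.2| = k * ((\sum_(q <- s0) `|q.2|) / S) by ring.
  by rewrite ler_piMr ?(ltW k0)// ler_pdivrMr// mul1r /S lerDr.
have zb : eps / 4 <= `|z|.
  have := ler_normD (x' - x - z) z; rewrite subrK -dE; lra.
have z0 : 0 < `|z| by apply: lt_le_trans zb; lra.
exists (`|z|^-1 *: z); split.
- by apply: subspaceZ (s0Y _); exact: cof_subspace.
- by rewrite normrZ normfV normr_id mulVf ?gt_eqF.
pose b' i := if i == size s then `|z| else b i.
have -> : 1 + A + m.+1%:R * k = 1 + (A + k) + m%:R * k by rewrite -natr1; ring.
apply: (IH psi x' Dpsi psiE _ b').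
  move=> i; rewrite size_rcons ltnS leq_eqVlt /b' => /orP[/eqP ->|si].
    by rewrite eqxx.
  by rewrite ltn_eqF//; exact: bs.
rewrite size_rcons big_ord_recr /= nth_rcons ltnn eqxx /b' eqxx scalerA.
rewrite divff ?gt_eqF// scale1r.
under eq_bigr => i _ do rewrite ltn_eqF// nth_rcons ltn_ord.
set T := \sum_(i < size s) _.
have -> : x' - (T + z) = (x - T) + (x' - x - z).
  by rewrite [RHS]addrACA (addrC x) subrK opprD.
apply: le_trans (ler_normD _ _) _; exact: lerD.
Qed.

(** With unconditionality, all the sums with coefficients in the cube are bounded,
    uniformly in the length of the game. *)
Lemma not_szlenk_cube_game (eps : R) : 0 < eps ->
  (forall n, @derived R (dual X) eps n !=set0) -> unconditional_asymptotic_structure X ->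
  exists2 M : R, 0 < M & forall n, vector_game n.+1 (cube_bounded M) ([::] : seq X).
Proof.
move=> eps0 Dne [C C1 unc].
have C0 : 0 < C by apply: lt_le_trans C1.
exists (C * 3 / (eps / 4)); first by rewrite !divr_gt0// mulr_gt0.
move=> n; have [phi Dphi] := Dne n.+1; have [x phiE] := rX phi.
pose k := Num.min (eps / 4) n.+1%:R^-1.
have k0 : 0 < k by rewrite lt_min invr_gt0 ltr0n divr_gt0.
have ke : k <= eps / 4 by rewrite ge_min lexx.
have kn : n.+1%:R * k <= 1 by rewrite mulrC -ler_pdivlMr// div1r ge_min lexx orbT.
have x1 : `|x - \sum_(i < size ([::] : seq X)) 0 *: [::]`_i| <= 1.
  by rewrite big_ord0 subr0 -(bidual_norm phiE); exact: derived_ball Dphi.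
have b0 i : (i < size ([::] : seq X))%N -> eps / 4 <= 0 by [].
have game := asymptotic_vector_game (unc n.+1 isT)
  (szlenk_game k0 ke Dphi phiE (b := fun=> 0) b0 x1).
apply: vector_game_mono game => s [us [b bs hb]].
apply: unconditional_cube_bounded; rewrite ?divr_gt0 ?(ltW C0)//.
by exists b => //; apply: le_trans hb _; lra.
Qed.

End SzlenkGame.

(** * Trees of vectors and embeddings of bundle graphs *)

(** The nodes of the tree of finite sequences, numbered so that an initial segment
    comes before its extensions. *)
Definition node_index (s : seq nat) : nat := CodeSeq.code (rev s).
Definition node (m : nat) : seq nat := rev (CodeSeq.decode m).

Lemma node_indexK : cancel node_index node.
Proof. by move=> s; rewrite /node /node_index CodeSeq.codeK revK. Qed.

Lemma nodeK : cancel node node_index.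
Proof. by move=> m; rewrite /node /node_index revK CodeSeq.decodeK. Qed.

Lemma node_index_rcons s n : (node_index s < node_index (rcons s n))%N.
Proof.
rewrite /node_index rev_rcons /=; have : (0 < 2 ^ n)%N by rewrite expn_gt0.
by case: (2 ^ n)%N => // k _; rewrite mulSn; lia.
Qed.

Lemma node_index_take s k : (node_index (take k s) <= node_index s)%N.
Proof.
elim/last_ind: s k => [|s n IH] k //.
have [le|lt] := leqP (size (rcons s n)) k; first by rewrite take_oversize.
rewrite size_rcons ltnS in lt.
rewrite -cats1 takel_cat//; apply: leq_trans (IH k) _; rewrite cats1.
exact/ltnW/node_index_rcons.
Qed.

Section Tree.
Context {R : realType} {X : normedModType R}.

Definition branch (e : nat -> X) (s : seq nat) : seq X :=
  [seq e (node_index (take k s)) | k <- iota 0 (size s).+1].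

Lemma branch_rcons (e : nat -> X) (s : seq nat) n :
  branch e (rcons s n) = rcons (branch e s) (e (node_index (rcons s n))).
Proof.
rewrite /branch size_rcons -[(size s).+2]addn1 iotaD map_cat add0n -[RHS]cats1.
congr (_ ++ _); last by rewrite /= take_oversize// size_rcons.
apply/eq_in_map => k; rewrite mem_iota /= add0n ltnS => ks.
by rewrite -cats1 takel_cat.
Qed.

Lemma eq_branch (e e' : nat -> X) s :
  (forall m, (m <= node_index s)%N -> e m = e' m) -> branch e s = branch e' s.
Proof. by move=> ee'; apply: eq_map => k; apply: ee'; exact: node_index_take. Qed.

(** Each new vector is killed by norming functionals of the finitely many
    combinations of the previous ones with coefficients [a i - b i], so that the
    partial sums of such combinations have nondecreasing norms. *)
Lemma tree_of_game (d H : nat) (P : seq X -> Prop) : vector_game d.+1 P [::] ->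
  exists e : nat -> X, [/\ forall s, size s = d -> P (branch e s),
    forall m, `|e m| = 1 &
    forall m (a b : nat -> nat), (forall i, (a i <= H)%N) -> (forall i, (b i <= H)%N) ->
      `|\sum_(i < m) ((a i)%:R - (b i)%:R) *: e i| <=
      `|\sum_(i < m.+1) ((a i)%:R - (b i)%:R) *: e i|].
Proof.
move=> game.
pose Q (l : seq X) :=
  (forall m, (m < size l)%N -> (size (node m) <= d)%N ->
     vector_game (d - size (node m)) P (branch (nth 0 l) (node m))) /\
  (forall m, (m < size l)%N -> `|l`_m| = 1 /\
   forall (a b : nat -> nat), (forall i, (a i <= H)%N) -> (forall i, (b i <= H)%N) ->
      `|\sum_(i < m) ((a i)%:R - (b i)%:R) *: l`_i| <=
      `|\sum_(i < m.+1) ((a i)%:R - (b i)%:R) *: l`_i|).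
have [//|l [Q1 Q2]|e eQ] := @list_choice _ Q; last first.
  exists e; split.
  - move=> s sd; have [+ _] := eQ (node_index s).+1.
    rewrite size_mkseq => /(_ _ (ltnSn _)); rewrite node_indexK sd subnn => /(_ (leqnn _)).
    rewrite (@eq_branch _ e)// => m ms; rewrite nth_mkseq//.
  - by move=> m; have [_ /(_ m)] := eQ m.+1; rewrite size_mkseq ltnSn nth_mkseq// => -[].
  - move=> m a b aH bH; have [_ /(_ m)] := eQ m.+1.
    rewrite size_mkseq ltnSn => -[//|_ /(_ a b aH bH)].
    under eq_bigr => i _ do rewrite nth_mkseq ?(ltnW (ltn_ord i))// ?ltnS ?(ltnW (ltn_ord i))//.
    by under [in leRHS]eq_bigr => i _ do rewrite nth_mkseq//.
pose m := size l; pose s := node m.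
pose T := ({ffun 'I_m -> 'I_H.+1} * {ffun 'I_m -> 'I_H.+1})%type.
pose z (p : T) : X := \sum_(i < m) ((p.1 i)%:R - (p.2 i)%:R) *: l`_i.
have [nf nfP] : exists nf : T -> dual X, forall p, `|nf p| <= 1 /\ nf p (z p) = `|z p|.
  suff h p : exists f : dual X, `|f| <= 1 /\ f (z p) = `|z p|.
    by exists (fun p => sval (cid (h p))) => p; case: cid.
  by have [f f1 fz] := norming_functional (z p); exists f.
have [Y [cY _ Yf]] := cof_kers [seq nf p | p : T] (@cof_setT R X).
have [y [Yy y1 gy]] : exists y, [/\ Y y, `|y| = 1 & (size s <= d)%N ->
    vector_game (d - size s) P (branch (nth 0 (rcons l y)) s)].
  have [sd|ds] := leqP (size s) d; last by have [y [Yy y1 _]] := game Y cY; exists y.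
  have last_y y : nth 0 (rcons l y) (node_index s) = y.
    by rewrite nodeK nth_rcons ltnn eqxx.
  case/lastP es : s => [|s' n].
    have [y [Yy y1 gy]] := game Y cY; exists y; split => // _.
    by rewrite subn0 /branch /= -es last_y.
  have lt : (node_index s' < m)%N by rewrite -[m]nodeK -/s es node_index_rcons.
  rewrite es size_rcons in sd.
  have := Q1 _ lt; rewrite node_indexK => /(_ (ltnW sd)).
  have -> : (d - size s' = (d - (size s').+1).+1)%N by rewrite subnSK.
  move=> /(_ Y cY)[y [Yy y1 gy]]; exists y; split => // _.
  rewrite size_rcons branch_rcons -es last_y.
  rewrite (@eq_branch _ (nth 0 l))// => i is'; rewrite nth_rcons.
  by rewrite (leq_ltn_trans is' lt).
exists y; split=> [j|j]; rewrite size_rcons ltnS leq_eqVlt => /orP[/eqP ->|jl].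
- exact: gy.
- move=> jd; have := Q1 j jl jd.
  rewrite (@eq_branch _ (nth 0 (rcons l y)))// => i; rewrite nodeK => ij.
  by rewrite nth_rcons (leq_ltn_trans ij jl).
- rewrite nth_rcons ltnn eqxx; split => // a b aH bH.
  pose p : T := ([ffun i : 'I_m => inord (a i)], [ffun i : 'I_m => inord (b i)]).
  have zE : \sum_(i < m) ((a i)%:R - (b i)%:R) *: (rcons l y)`_i = z p.
    apply: eq_bigr => i _; rewrite !ffunE !inordK ?ltnS// nth_rcons.
    by rewrite ltn_ord.
  rewrite big_ord_recr /= zE nth_rcons ltnn eqxx.
  have [f1 fz] := nfP p; rewrite -fz.
  have -> : nf p (z p) = nf p (z p + ((a m)%:R - (b m)%:R) *: y).
    rewrite dualD dual_funZ (Yf (nf p) y) ?mulr0 ?addr0//.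
    by apply/mapP; exists p; rewrite ?mem_enum.
  exact: dual_norm1_le.
- have [l1 mono] := Q2 j jl; rewrite nth_rcons jl; split => // a b aH bH.
  have := mono a b aH bH.
  have E k : (k <= j.+1)%N -> \sum_(i < k) ((a i)%:R - (b i)%:R) *: (rcons l y)`_i =
      \sum_(i < k) ((a i)%:R - (b i)%:R) *: l`_i.
    move=> kj; apply: eq_bigr => i _; rewrite nth_rcons.
    by rewrite (leq_trans (ltn_ord i) (leq_trans kj jl)).
  by rewrite !E.
Qed.

(** Vectors supported by different branches can only be subtracted along the common
    numbering of the nodes. *)
Lemma branch_sum (e : nat -> X) (c : seq nat -> R) (beta : seq nat) M :
  (forall s, c s != 0 -> prefix s beta) -> (node_index beta < M)%N ->
  \sum_(i < size (branch e beta)) c (take i beta) *: (branch e beta)`_i =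
  \sum_(m < M) c (node m) *: e m.
Proof.
move=> cbeta betaM.
pose L := [seq node_index (take k beta) | k <- iota 0 (size beta).+1].
have uL : uniq L.
  rewrite map_inj_in_uniq ?iota_uniq// => i j; rewrite !mem_iota /= add0n !ltnS => il jl.
  by move=> /(can_inj node_indexK)/(congr1 size); rewrite !size_takel.
transitivity (\sum_(m <- L) c (node m) *: e m).
  rewrite size_map size_iota big_map.
  rewrite -(big_mkord xpredT (fun i => c (take i beta) *: (branch e beta)`_i)).
  rewrite /index_iota subn0; apply: eq_big_seq => k; rewrite mem_iota /= add0n => kb.
  by rewrite (nth_map 0%N) ?size_iota// nth_iota// add0n node_indexK.
rewrite -(big_mkord xpredT (fun m => c (node m) *: e m)) [RHS](bigID (mem L))/=.
rewrite [X in _ + X]big1 ?addr0 => [|m mL]; last first.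
  have [->|cm] := eqVneq (c (node m)) 0; first by rewrite scale0r.
  case/negP: mL; have /prefixP[s es] := cbeta _ cm.
  apply/mapP; exists (size (node m)); last by rewrite es take_size_cat// nodeK.
  by rewrite mem_iota /= add0n ltnS es size_cat leq_addr.
rewrite -[RHS]big_filter; apply: perm_big; apply: uniq_perm => //.
  by rewrite filter_uniq// iota_uniq.
move=> m; rewrite mem_filter mem_index_iota /=.
case mL : (m \in L) => //=; move/mapP : mL => [k _ ->].
by rewrite (leq_ltn_trans (node_index_take _ _) betaM).
Qed.

Lemma coordinate_bound (e : nat -> X) (H : nat) (a b : nat -> nat) m M :
  (forall m, `|e m| = 1) ->
  (forall m (a b : nat -> nat), (forall i, (a i <= H)%N) -> (forall i, (b i <= H)%N) ->
      `|\sum_(i < m) ((a i)%:R - (b i)%:R) *: e i| <=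
      `|\sum_(i < m.+1) ((a i)%:R - (b i)%:R) *: e i|) ->
  (forall i, (a i <= H)%N) -> (forall i, (b i <= H)%N) -> (m < M)%N ->
  `|(a m)%:R - (b m)%:R| <= 2 * `|\sum_(i < M) ((a i)%:R - (b i)%:R) *: e i|.
Proof.
move=> e1 mono aH bH mM.
pose S k := \sum_(i < k) ((a i)%:R - (b i)%:R) *: e i.
have Smono k l : (k <= l)%N -> `|S k| <= `|S l|.
  move=> /subnK <-; elim: (l - k)%N => [//|j IH].
  by apply: le_trans IH _; rewrite addSn; exact: mono.
have -> : `|(a m)%:R - (b m)%:R| = `|S m.+1 - S m|.
  by rewrite /S big_ord_recr /= addrAC subrr add0r normrZ e1 mulr1.
apply: le_trans (ler_normB _ _) _.
by have := Smono _ _ mM; have := Smono _ _ (leqnSn m); rewrite -/(S M); lra.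
Qed.

(** The embedding: the level is the coordinate at the root, and adjacent vertices
    have coordinates supported by a common branch. *)
Lemma coded_embeds (M : R) : 0 < M ->
  (forall n, vector_game n.+1 (cube_bounded M) ([::] : seq X)) ->
  forall (G : tbgraph) h, coded G h -> exists f : G -> X, forall x y,
    1 / 6 * (gdist x y)%:R <= `|f x - f y| <= M * (gdist x y)%:R.
Proof.
move=> M0 game G h [lev [tau [d co]]].
have gr := coord_graded co; have [lb _ _ up dn] := gr.
pose cv (v : G) (s : seq nat) : nat := if s == [::] then lev v else tau v s.
have cvh v s : (cv v s <= h)%N.
  rewrite /cv; case: eqP => _; first exact: (dn v).1.
  have lip (u w : G) : adj u w -> (tau u s <= (tau w s).+1)%N.
    by move=> /(coord_lipschitz co).
  have := walk_lipschitz lip (walk_rev (up v)); rewrite (coord_bot co) add0n.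
  by move=> /leq_trans; apply; exact: (dn v).1.
have [e [eM e1 mono]] := @tree_of_game d h _ (game d).
have br u v : adj u v \/ u = v -> exists beta, [/\ size beta = d,
    forall s, cv u s <> 0%N -> prefix s beta & forall s, cv v s <> 0%N -> prefix s beta].
  move=> /(coord_branch co)[beta [sb bu bv]].
  exists (beta ++ nseq (d - size beta) 0%N); rewrite size_cat size_nseq subnKC//.
  have pre w : supported (tau w) beta -> forall s, cv w s <> 0%N ->
      prefix s (beta ++ nseq (d - size beta) 0%N).
    move=> bw s; rewrite /cv; case: eqP => [->|_ /bw]; first by rewrite prefix0s.
    by move=> /prefix_trans; apply; exact: prefix_prefix.
  by split => //; exact: pre.
have [be beP] : exists be : G -> seq nat, forall v, size (be v) = d /\
    forall s, cv v s <> 0%N -> prefix s (be v).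
  suff hb v : exists beta, size beta = d /\ forall s, cv v s <> 0%N -> prefix s beta.
    by exists (fun v => sval (cid (hb v))) => v; case: cid.
  by have [beta [sb bv _]] := br v v (or_intror erefl); exists beta.
pose f v := \sum_(m < (node_index (be v)).+1) (cv v (node m))%:R *: e m.
have fE v K : (node_index (be v) < K)%N -> f v = \sum_(m < K) (cv v (node m))%:R *: e m.
  move=> vK; have sv s : (cv v s)%:R != 0 :> R -> prefix s (be v).
    by move=> h0; apply: (beP v).2 => h1; move: h0; rewrite h1 eqxx.
  by rewrite /f -!(branch_sum e sv).
have fB u v K : (node_index (be u) < K)%N -> (node_index (be v) < K)%N ->
    f u - f v = \sum_(m < K) ((cv u (node m))%:R - (cv v (node m))%:R) *: e m.
  move=> uK vK; rewrite (fE u K uK) (fE v K vK) -sumrB.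
  by apply: eq_bigr => i _; rewrite scalerBl.
exists f => x y; have [n [s [w le]]] := coord_walk co x y.
have [wd dn'] := gdistP w; apply/andP; split.
  pose K := (maxn (maxn (node_index (be x)) (node_index (be y)))
     (maxn (node_index s) (node_index [::]))).+1.
  have cb t : (node_index t < K)%N ->
      (absdiff (cv x t) (cv y t))%:R <= 2 * `|f x - f y|.
    move=> tK; rewrite (fB x y K); try by rewrite /K; lia.
    have := @coordinate_bound e h (fun m => cv x (node m)) (fun m => cv y (node m))
      (node_index t) K e1 mono (fun i => cvh x _) (fun i => cvh y _) tK.
    rewrite node_indexK; apply: le_trans; rewrite /absdiff.
    have [xy|/ltnW yx] := leqP (cv x t) (cv y t).
      by rewrite (eqP (_ : cv x t - cv y t == 0)%N)// add0n natrB// distrC ler_norm.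
    by rewrite (eqP (_ : cv y t - cv x t == 0)%N)// addn0 natrB// ler_norm.
  have cs : (node_index s < K)%N by rewrite /K; lia.
  have c0 : (node_index [::] < K)%N by rewrite /K; lia.
  have h1 := cb _ cs; have h2 := cb _ c0.
  have h3 : (absdiff (tau x s) (tau y s))%:R <= 2 * `|f x - f y|.
    move: h1; rewrite /cv; case: eqP => // ->; rewrite !(coord_root co) => _.
    by rewrite /absdiff subn0 mulr_ge0.
  rewrite /cv eqxx in h2.
  have : (gdist x y)%:R <= (2 * absdiff (tau x s) (tau y s) + absdiff (lev x) (lev y))%:R :> R.
    by rewrite ler_nat; exact: leq_trans dn' le.
  by rewrite natrD natrM; lra.
rewrite mulrC; apply: (walk_seminorm (p := fun v : X => `|v|)) wd.
  by split=> [a b|a b]; [exact: ler_normD|exact: normrZ].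
move=> u v uv; have [beta [sb bu bv]] := br u v (or_introl uv).
pose K := (maxn (node_index beta) (maxn (node_index (be u)) (node_index (be v)))).+1.
rewrite (fB u v K); try by rewrite /K; lia.
rewrite -(@branch_sum e (fun s => (cv u s)%:R - (cv v s)%:R) beta K); last 2 first.
- move=> t; apply: contraNT => nt; rewrite subr_eq0; apply/eqP; congr (_%:R).
  suff [-> ->] : cv u t = 0%N /\ cv v t = 0%N by [].
  by split; apply: contrapT => h0; move/negP: nt; apply; [exact: bu|exact: bv].
- by rewrite /K; lia.
apply: (eM beta sb
  (fun i => (cv u (take i beta))%:R - (cv v (take i beta))%:R)) => i _.
set t := take i beta.
have lipt : (cv u t <= (cv v t).+1)%N /\ (cv v t <= (cv u t).+1)%N.
  rewrite /cv; case: eqP => _; last first.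
    by split; apply: (coord_lipschitz co) => //; exact: adj_sym.
  by split; apply: graded_lipschitz gr _ _ _ => //; exact: adj_sym.
move: lipt => [l1 l2]; rewrite -(ler_nat R) -natr1 in l1.
by rewrite -(ler_nat R) -natr1 in l2; rewrite ler_norml; lra.
Qed.

End Tree.

(** The bound of the cube game does not depend on its length, nor does the distortion
    of the embedding on the graph. *)
Lemma not_szlenk_embeds (R : realType) (X : normedModType R) (G : tbgraph) :
  reflexive_space X -> unconditional_asymptotic_structure X ->
  nontrivial_bundle_graph G -> ~ eole (szlenk_index (dual X)) (Some omega) ->
  equi_lipschitz_embeds X (M := fun n : nat => vertex (oslash_pow G n))
    (fun n x y => (gdist x y)%:R).
Proof.
move=> rX uX fG /szlenk_index_omegaP/existsNP[eps /not_implyP[eps0 nfin]].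
have [|M M0 game] := not_szlenk_cube_game rX eps0 _ uX.
  by move=> n; apply/set0P/eqP => n0; apply: nfin; exists n.
have [h [_ cpow]] := coded_oslash_pow fG.
have [f fP] : exists f : forall n, oslash_pow G n -> X, forall n x y,
    1 / 6 * (gdist x y)%:R <= `|f n x - f n y| <= M * (gdist x y)%:R.
  exists (fun n => sval (cid (coded_embeds M0 game (cpow n)))) => n.
  by case: cid.
pose D : R := Num.max 1 (6 * M).
exists D; first by rewrite le_max lexx.
exists f, (fun=> 1 / 6); split=> [n|n x y]; first by rewrite divr_gt0.
have /andP[-> /= h2] := fP n x y; apply: le_trans h2 _.
rewrite ler_wpM2r//; have : 6 * M <= D by rewrite le_max lexx orbT.
lra.
Qed.

Theorem mainTheorem13 (R : realType) (X : completeNormedModType R) (G : tbgraph)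
    (X_reflexive : reflexive_space X)
    (X_uncond : unconditional_asymptotic_structure X)
    (G_bundle : nontrivial_bundle_graph G) :
  (eole (szlenk_index (dual X)) (Some omega) <->
     exists N : X -> R, equivalent_norm N /\ AUC N) /\
  ((exists N : X -> R, equivalent_norm N /\ AUC N) <->
     ~ equi_lipschitz_embeds X (M := fun n : nat => vertex (oslash_pow G n))
         (fun n x y => (gdist x y)%:R)).
Proof.
have auc_nemb : (exists N : X -> R, equivalent_norm N /\ AUC N) ->
    ~ equi_lipschitz_embeds X (M := fun n : nat => vertex (oslash_pow G n))
        (fun n x y => (gdist x y)%:R).
  by move=> [N [eqN aucN]]; exact: (AUC_not_embeds eqN aucN G_bundle).
have nemb_szlenk : ~ equi_lipschitz_embeds X
      (M := fun n : nat => vertex (oslash_pow G n)) (fun n x y => (gdist x y)%:R) ->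
    eole (szlenk_index (dual X)) (Some omega).
  by apply: contra_notP => nS; exact: not_szlenk_embeds.
have szlenk_auc : eole (szlenk_index (dual X)) (Some omega) ->
    exists N : X -> R, equivalent_norm N /\ AUC N.
  by move=> /szlenk_index_omegaP; exact: AUC_renorming.
split; split.
- exact: szlenk_auc.
- by move=> /auc_nemb/nemb_szlenk.
- exact: auc_nemb.
- by move=> /nemb_szlenk/szlenk_auc.
Qed.
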